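(* Let $X$ be a separable real Hilbert space, $T>0$, and let $A$ generate a $C_0$-semigroup on $X$ such that either $A^*=A$ with $\sup\sigma(A)=-\sigma_0<0$, or $A^*=-A$. Let $(b,g,h)\in\mathcal{G}_2\cap\mathcal{G}_3$ admit a type (I) or type (II) Lyapunov operator $\Pi(\cdot)$. Then for every $x\in X$ the forward-backward evolution equation (FBEE) $$\begin{cases}\dot y(t)=Ay(t)+b(t,y(t),\psi(t)),\\ \dot\psi(t)=-A^*\psi(t)-g(t,y(t),\psi(t)),\quad t\in[0,T],\\ y(0)=x,\quad\psi(T)=h(y(T))\end{cases}$$ admits a unique mild solution $(y(\cdot),\psi(\cdot))$. Moreover, there is a constant $K>0$ such that $$\|y(\cdot)\|_\infty+\|\psi(\cdot)\|_\infty\le K\Big[\|x\|+\|h(0)\|+\int_0^T\big(\|b(s,0,0)\|+\|g(s,0,0)\|\big)ds\Big].$$ Further, if $(\bar y(\cdot),\bar\psi(\cdot))$ is a mild solution of the FBEE with $(b,g,h)$ replaced by $(\bar b,\bar g,\bar h)\in\mathcal{G}_2\cap\mathcal{G}_3$ and $x$ replaced by $\bar x\in X$, then $$\|\bar y(\cdot)-y(\cdot)\|_\infty+\|\bar\psi(\cdot)-\psi(\cdot)\|_\infty\le K\Big\{\|\bar x-x\|+\|\bar h(\bar y(T))-h(\bar y(T))\|$$ $$+\int_0^T\Big(\|\bar b(s,\bar y(s),\bar\psi(s))-b(s,\bar y(s),\bar\psi(s))\|+\|\bar g(s,\bar y(s),\bar\psi(s))-g(s,\bar y(s),\bar\ps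i(s))\|\Big)ds\Big\}.$$
   Context: $\mathcal{L}(\cdot)$: bounded operators; $\mathbb{S}(\cdot)$: bounded self-adjoint operators; scalars in operator matrices denote multiples of the identity; $\|\cdot\|_\infty$ is the sup norm on $C([0,T];X)$. $\mathcal{G}_2$: triples $(b,g,h)$ with $b,g:[0,T]\times X\times X\to X$, $h:X\to X$ continuous, for which there is $L>0$ with $\|b(t,0,0)\|,\|g(t,0,0)\|\le L$, and $b(t,\cdot,\cdot),g(t,\cdot,\cdot)$, $h$ globally Lipschitz with constant $L$ (i.e. $\|b(t,y,\psi)-b(t,\bar y,\bar\psi)\|\le L\|y-\bar y\|+L\|\psi-\bar\psi\|$, likewise $g$, and $\|h(y)-h(\bar y)\|\le L\|y-\bar y\|$), uniformly in $t\in[0,T]$. $\mathcal{G}_3$: triples $(b,g,h)$ of continuous maps, locally Lipschitz in $(y,\psi)$, such that $(y,\psi)\mapsto(b(t,y,\psi),g(t,y,\psi),h(y))$ is Fréchet differentiable with continuous Fréchet derivatives. Mild solution of the FBEE: continuous $(y,\psi)$ with $y(t)=e^{At}x+\int_0^te^{A(t-s)}b(s,y(s),\psi(s))ds$ and $\psi(t)=e^{A^*(T-t)}h(y(T))+\int_t^Te^{A^*(s-t)}g(s,y(s),\psi(s))ds$, $t\in[0,T]$. Lyapunov differential equation: $\dot\Pi+\Pi[\mathbb{A}-\mathbb{M}]+[\mathbb{A}-\mathbb{M}]^*\Pi+\mathbb{Q}=0$ on $[0,T]$, where $$\mathbb{A}=\begin{pmatrix}A&0\\0&-A^*\end{pmatrix},\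 \Pi=\begin{pmatrix}P&\Gamma^*\\ \Gamma&\bar P\end{pmatrix},\ \mathbb{M}=\begin{pmatrix}M&0\\0&-\bar M^*\end{pmatrix},\ \mathbb{Q}=\begin{pmatrix}Q_0&\Theta^*\\ \Theta&\bar Q_0\end{pmatrix},$$ $M,\bar M,\Theta:[0,T]\to\mathcal{L}(X)$, $Q_0,\bar Q_0:[0,T]\to\mathbb{S}(X)$ bounded and strongly measurable. $\Pi$ (strongly continuous, $\mathbb{S}(X\times X)$-valued) is a mild solution if $$P(t)=e^{A^*(T-t)}P(T)e^{A(T-t)}-\int_t^Te^{A^*(s-t)}[PM+M^*P-Q_0](s)e^{A(s-t)}ds,$$ $$\bar P(t)=e^{At}\bar P(0)e^{A^*t}-\int_0^te^{A(t-s)}[\bar P\bar M^*+\bar M\bar P+\bar Q_0](s)e^{A^*(t-s)}ds,$$ and: if $A^*=A$, $\Gamma(t)=\Gamma(T)+\int_t^T[\bar M\Gamma-\Gamma M+\Theta](s)ds$ with $\Gamma(t)\mathcal{D}(A)\subseteq\mathcal{D}(A)$, $\Gamma(t)Az=A\Gamma(t)z$ for $z\in\mathcal{D}(A)$; if $A^*=-A$, $\Gamma(t)=e^{-A(T-t)}\Gamma(T)e^{A(T-t)}+\int_t^Te^{-A(s-t)}[\bar M\Gamma-\Gamma M+\Theta](s)e^{A(s-t)}ds$. Set $\mathbb{B}(t,y,\psi)=\begin{pmatrix}b_y&b_\psi\\-g_y&-g_\psi\end{pmatrix}(t,y,\psi)$ and $\mathbb{H}^\rho(t,\Pi,y,\psi)=\rho[\Pi\mathbb{B}(t,y,\psi)+\mathbb{B}(t,y,\psi)^*\Pi]+\Pi\mathbb{M}(t)+\mathbb{M}(t)^*\Pi$.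 A strongly continuous $\Pi:[0,T]\to\mathbb{S}(X\times X)$ is a type (I) Lyapunov operator of $(b,g,h)\in\mathcal{G}_3$ if there are $\mathbb{Q}=\begin{pmatrix}Q_0&\Theta^*\\ \Theta&\bar Q_0\end{pmatrix}$ and $\mathbb{M}=\begin{pmatrix}M&0\\0&-\bar M^*\end{pmatrix}$, with $M,\bar M,\Theta:[0,T]\to\mathcal{L}(X)$ and $Q_0,\bar Q_0:[0,T]\to\mathbb{S}(X)$ bounded and strongly measurable, such that $\Pi$ is a mild solution of the Lyapunov differential equation and for some constants $\mu,K>0$: (a) $\Pi(0)+\begin{pmatrix}-K&0\\0&0\end{pmatrix}\le0$; (b) $\begin{pmatrix}I&\rho h_y(y)^*\\0&I\end{pmatrix}\Pi(T)\begin{pmatrix}I&0\\ \rho h_y(y)&I\end{pmatrix}+\begin{pmatrix}-\mu h_y(y)^*h_y(y)&0\\0&K\end{pmatrix}\ge0$ for all $y\in X$, $\rho\in[0,1]$; (c) $\begin{pmatrix}\mathbb{H}^\rho(t,\Pi(t),y,\psi)-\mathbb{Q}(t)+\mu\begin{pmatrix}g_y(t,y,\psi)^*g_y(t,y,\psi)&0\\0&0\end{pmatrix}&\Pi(t)\\ \Pi(t)&-K\end{pmatrix}\le0$ for all $(t,y,\psi)\in[0,T]\times X\times X$, $\rho\in[0,1]$. It is a type (II) Lyapunov operator if instead (a) holds together with (b') $\begin{pmatrix}I&\rho h_y(y)^*\\0&I\end{pmatrix}\Pi(T)\begin{pmatrix}I&0\\ \rho h_y(y)&I\end{pmatrix}+\begin{pmatrix}0&0\\0&K\end{pmatrix}\ge0$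 for all $y\in X$, $\rho\in[0,1]$; (c') $\begin{pmatrix}\mathbb{H}^\rho(t,\Pi(t),y,\psi)-\mathbb{Q}(t)+\mu\begin{pmatrix}0&0\\0&b_\psi(t,y,\psi)^*b_\psi(t,y,\psi)\end{pmatrix}&\Pi(t)\\ \Pi(t)&-K\end{pmatrix}\le0$ for all $(t,y,\psi)\in[0,T]\times X\times X$, $\rho\in[0,1]$. The constant $K$ in the estimates does not depend on $x,\bar x$ or on $(\bar b,\bar g,\bar h)$. *)

(* Defs.v *)
From HB Require Import structures.
From mathcomp Require Import all_boot all_order all_algebra sesquilinear.
From mathcomp Require Import all_classical all_reals all_analysis.
Import Order.TTheory GRing.Theory Num.Theory.
Import numFieldNormedType.Exports.

Set Implicit Arguments.
Unset Strict Implicit.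
Unset Printing Implicit Defensive.

Local Open Scope classical_set_scope.
Local Open Scope ring_scope.

(* Bochner integration over a set D of finite Lebesgue measure. *)
Section bochner.
Context {R : realType} {X : normedModType R}.
Implicit Types (D : set R) (f : R -> X) (s : nat -> R -> X).

Local Notation mu := (@lebesgue_measure R).

Definition simple_on D f : Prop :=
  finite_set (f @` D) /\
  forall x : X, measurable (D `&` f @^-1` [set x] : set (measurableTypeR R)).

Definition simple_integral D f : X :=
  \sum_(x \in f @` D) fine (mu (D `&` f @^-1` [set x])) *: x.

Definition simple_approx D f s : Prop :=
  (forall n, simple_on D (s n)) /\
  {ae mu, forall t, D t -> s n t @[n --> \oo] --> f t}.

Definition strongly_measurable D f : Prop := exists s, simple_approx D f s.

(* f is Bochner integrable over D, with integral v. *)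
Definition has_bochner_integral D f (v : X) : Prop :=
  exists s, [/\ simple_approx D f s,
    (\int[mu]_(t in D) (`|f t - s n t|)%:E @[n --> \oo] --> 0)%E &
    simple_integral D (s n) @[n --> \oo] --> v].

End bochner.

Section operators.
Context {R : realType}.

Definition bounded_op {U V : normedModType R} (f : U -> V) : Prop :=
  linear f /\ exists C : R, forall x, `|f x| <= C * `|x|.

(* The adjoint of an everywhere defined bounded operator, for the inner product
   d; it exists (Riesz) and is unique when d is a Hilbert inner product. *)
Definition adj {U : lmodType R} (d : U -> U -> R) (f : U -> U) : U -> U :=
  fun v => xget 0 [set w | forall u, d (f u) v = d u w].

Definition self_adjoint {U : normedModType R} (d : U -> U -> R)
  (f : U -> U) : Prop := bounded_op f /\ forall u v, d (f u) v = d u (f v).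

(* The order on self-adjoint operators. *)
Definition op_ge0 {U : lmodType R} (d : U -> U -> R) (f : U -> U) : Prop :=
  forall u, 0 <= d (f u) u.
Definition op_le0 {U : lmodType R} (d : U -> U -> R) (f : U -> U) : Prop :=
  forall u, d (f u) u <= 0.

(* The inner product of U x U. The library norm of U x U is the max norm, which
   is only equivalent to the norm of this inner product. *)
Definition pdot {U : lmodType R} (d : U -> U -> R) (z w : U * U) : R :=
  d z.1 w.1 + d z.2 w.2.

Definition blockop {U : lmodType R} (L11 L12 L21 L22 : U -> U)
  (z : U * U) : U * U := (L11 z.1 + L12 z.2, L21 z.1 + L22 z.2).

Definition block11 {U : lmodType R} (L : U * U -> U * U) (x : U) : U :=
  (L (x, 0)).1.
Definition block21 {U : lmodType R} (L : U * U -> U * U) (x : U) : U :=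
  (L (x, 0)).2.
Definition block22 {U : lmodType R} (L : U * U -> U * U) (x : U) : U :=
  (L (0, x)).2.

End operators.

Definition separable (X : topologicalType) : Prop :=
  exists D : set X, countable D /\ dense D.

(* An unbounded operator A is its graph: A (x, y) means x \in D(A), Ax = y. *)
Section unbounded.
Context {R : realType} {X : normedModType R}.
Implicit Types (A : set (X * X)) (S : R -> X -> X) (d : X -> X -> R).

Definition C0_semigroup S : Prop :=
  [/\ forall t, 0 <= t -> bounded_op (S t),
      S 0 = idfun,
      forall s t, 0 <= s -> 0 <= t -> S (s + t) = S s \o S t &
      forall x, S t x @[t --> 0^'+] --> x].

Definition generator S : set (X * X) :=
  [set p | t^-1 *: (S t p.1 - p.1) @[t --> 0^'+] --> p.2].

Definition generates A S : Prop := C0_semigroup S /\ generator S = A.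

(* t |-> e^{At}; for t >= 0 it is determined by A, which must be a generator. *)
Definition sg A : R -> X -> X := get [set S : R -> X -> X | generates A S].

Definition adjoint_graph d A : set (X * X) :=
  [set p | forall x y, A (x, y) -> d y p.1 = d x p.2].

Definition opp_graph A : set (X * X) := [set p | A (p.1, - p.2)].

Definition resolvent_set A : set R :=
  [set l | exists J : X -> X, bounded_op J /\
             forall x y, A (x, l *: x - y) <-> x = J y].

Definition spectrum A : set R := ~` resolvent_set A.

End unbounded.

Section fbee.
Context {R : realType} {X : normedModType R}.
Variables (T : R) (d : X -> X -> R) (A : set (X * X)).
Implicit Types (b g : R -> X -> X -> X) (h : X -> X).

Definition jointly_continuous (f : R -> X -> X -> X) : Prop :=
  {within [set p : R * (X * X) | 0 <= p.1 <= T],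
    continuous (fun p => f p.1 p.2.1 p.2.2)}.

Definition coef_continuous b g h : Prop :=
  [/\ jointly_continuous b, jointly_continuous g & continuous h].

Definition G2 b g h : Prop :=
  coef_continuous b g h /\
  exists L : R, [/\ 0 < L,
    forall t, 0 <= t <= T -> `|b t 0 0| <= L /\ `|g t 0 0| <= L,
    forall t y psi y' psi', 0 <= t <= T ->
      `|b t y psi - b t y' psi'| <= L * `|y - y'| + L * `|psi - psi'|,
    forall t y psi y' psi', 0 <= t <= T ->
      `|g t y psi - g t y' psi'| <= L * `|y - y'| + L * `|psi - psi'| &
    forall y y', `|h y - h y'| <= L * `|y - y'|].

Definition coef_map b g h (t : R) (z : X * X) : X * X * X :=
  (b t z.1 z.2, g t z.1 z.2, h z.1).

(* The last clause is continuity of the derivative in operator norm. *)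
Definition continuously_differentiable {U V : normedModType R}
  (f : U -> V) : Prop :=
  (forall z : U, differentiable f z) /\
  forall (z : U) (e : R), 0 < e ->
    \forall w \near z, forall v, `|'d f w v - 'd f z v| <= e * `|v|.

Definition G3 b g h : Prop :=
  [/\ coef_continuous b g h,
    forall z : X * X, exists L : R, exists2 N : set (X * X), nbhs z N &
      forall t, 0 <= t <= T -> L.-lipschitz_N (coef_map b g h t) &
    forall t, 0 <= t <= T -> continuously_differentiable (coef_map b g h t)].

Definition mild_solution b g h (x : X) (y psi : R -> X) : Prop :=
  [/\ {within `[0, T]%classic, continuous y},
      {within `[0, T]%classic, continuous psi},
    forall t, 0 <= t <= T ->
      has_bochner_integral `[0, t]%classic
        (fun s => sg A (t - s) (b s (y s) (psi s)))
        (y t - sg A t x) &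
    forall t, 0 <= t <= T ->
      has_bochner_integral `[t, T]%classic
        (fun s => sg (adjoint_graph d A) (s - t) (g s (y s) (psi s)))
        (psi t - sg (adjoint_graph d A) (T - t) (h (y T)))].

Definition sup_norm (y : R -> X) : R :=
  sup [set `|y t| | t in `[0, T]%classic].

Definition bounded_measurable (M : R -> X -> X) : Prop :=
  [/\ forall t, 0 <= t <= T -> linear (M t),
      exists C : R, forall t x, 0 <= t <= T -> `|M t x| <= C * `|x| &
      forall x, strongly_measurable `[0, T]%classic (M ^~ x)].

Definition strongly_continuous_sa (Pi : R -> X * X -> X * X) : Prop :=
  (forall t, 0 <= t <= T -> self_adjoint (pdot d) (Pi t)) /\
  forall z, {within `[0, T]%classic, continuous (Pi ^~ z)}.

(* Operator-valued integrals are taken pointwise on X. *)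
Definition lyapunov_mild (Pi : R -> X * X -> X * X)
  (M Mb Theta Q0 Qb : R -> X -> X) : Prop :=
  let P t := block11 (Pi t) in
  let Gamma t := block21 (Pi t) in
  let Pb t := block22 (Pi t) in
  let As := adjoint_graph d A in
  [/\ forall t z, 0 <= t <= T ->
        has_bochner_integral `[t, T]%classic
          (fun s => sg As (s - t)
             (((P s \o M s) + (adj d (M s) \o P s) - Q0 s) (sg A (s - t) z)))
          (sg As (T - t) (P T (sg A (T - t) z)) - P t z),
      forall t z, 0 <= t <= T ->
        has_bochner_integral `[0, t]%classic
          (fun s => sg A (t - s)
             (((Pb s \o adj d (Mb s)) + (Mb s \o Pb s) + Qb s)
                (sg As (t - s) z)))
          (sg A t (Pb 0 (sg As t z)) - Pb t z),
      As = A -> forall t, 0 <= t <= T ->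
        (forall z, has_bochner_integral `[t, T]%classic
           (fun s => ((Mb s \o Gamma s) - (Gamma s \o M s) + Theta s) z)
           (Gamma t z - Gamma T z)) /\
        (forall z w, A (z, w) -> A (Gamma t z, Gamma t w)) &
      As = opp_graph A -> forall t z, 0 <= t <= T ->
        has_bochner_integral `[t, T]%classic
          (fun s => sg (opp_graph A) (s - t)
             (((Mb s \o Gamma s) - (Gamma s \o M s) + Theta s)
                (sg A (s - t) z)))
          (Gamma t z
           - sg (opp_graph A) (T - t) (Gamma T (sg A (T - t) z)))].

(* Partial Frechet derivatives of f(t, y, psi) in y and in psi. *)
Definition d_y (f : R -> X -> X -> X) t y psi : X -> X :=
  'd (fun y' => f t y' psi) y.
Definition d_psi (f : R -> X -> X -> X) t y psi : X -> X :=
  'd (fun psi' => f t y psi') psi.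

Definition d_h h (y : X) : X -> X := 'd h y.

Definition BB b g t y psi : X * X -> X * X :=
  blockop (d_y b t y psi) (d_psi b t y psi)
          (- d_y g t y psi) (- d_psi g t y psi).

Definition MM (M Mb : R -> X -> X) t : X * X -> X * X :=
  blockop (M t) 0 0 (- adj d (Mb t)).

Definition QQ (Theta Q0 Qb : R -> X -> X) t : X * X -> X * X :=
  blockop (Q0 t) (adj d (Theta t)) (Theta t) (Qb t).

Definition HH b g (M Mb : R -> X -> X) (rho t : R) (Pi : X * X -> X * X)
  y psi : X * X -> X * X :=
  rho *: ((Pi \o BB b g t y psi) + (adj (pdot d) (BB b g t y psi) \o Pi))
  + (Pi \o MM M Mb t) + (adj (pdot d) (MM M Mb t) \o Pi).

Definition lyapunov_initial (K : R) (Pi0 : X * X -> X * X) : Prop :=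
  op_le0 (pdot d) (Pi0 + blockop ((- K) *: idfun) 0 0 0).

Definition lyapunov_terminal h (D : X -> X * X -> X * X)
  (PiT : X * X -> X * X) : Prop :=
  forall (y : X) (rho : R), 0 <= rho <= 1 ->
    op_ge0 (pdot d)
      ((blockop idfun (rho *: adj d (d_h h y)) 0 idfun \o PiT
          \o blockop idfun 0 (rho *: d_h h y) idfun) + D y).

Definition lyapunov_running b g (M Mb Theta Q0 Qb : R -> X -> X)
  (E : R -> X -> X -> X * X -> X * X) (K : R) (Pi : R -> X * X -> X * X) :
  Prop :=
  forall (t : R) (y psi : X) (rho : R), 0 <= t <= T -> 0 <= rho <= 1 ->
    op_le0 (pdot (pdot d))
      (blockop (HH b g M Mb rho t (Pi t) y psi - QQ Theta Q0 Qb t + E t y psi)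
               (Pi t) (Pi t) ((- K) *: idfun)).

Definition lyapunov_data (Pi : R -> X * X -> X * X)
  (M Mb Theta Q0 Qb : R -> X -> X) : Prop :=
  [/\ bounded_measurable M, bounded_measurable Mb, bounded_measurable Theta &
    [/\ bounded_measurable Q0, bounded_measurable Qb,
      forall t, 0 <= t <= T -> self_adjoint d (Q0 t) /\ self_adjoint d (Qb t) &
      lyapunov_mild Pi M Mb Theta Q0 Qb]].

Definition type_I b g h (Pi : R -> X * X -> X * X) : Prop :=
  strongly_continuous_sa Pi /\
  exists M Mb Theta Q0 Qb : R -> X -> X,
    lyapunov_data Pi M Mb Theta Q0 Qb /\
    exists mu K : R, [/\ 0 < mu, 0 < K &
      [/\ lyapunov_initial K (Pi 0),
          lyapunov_terminal h
            (fun y => blockop ((- mu) *: (adj d (d_h h y) \o d_h h y)) 0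
                              0 (K *: idfun)) (Pi T) &
          lyapunov_running b g M Mb Theta Q0 Qb
            (fun t y psi => mu *:
               blockop (adj d (d_y g t y psi) \o d_y g t y psi) 0 0 0) K Pi]].

Definition type_II b g h (Pi : R -> X * X -> X * X) : Prop :=
  strongly_continuous_sa Pi /\
  exists M Mb Theta Q0 Qb : R -> X -> X,
    lyapunov_data Pi M Mb Theta Q0 Qb /\
    exists mu K : R, [/\ 0 < mu, 0 < K &
      [/\ lyapunov_initial K (Pi 0),
          lyapunov_terminal h (fun=> blockop 0 0 0 (K *: idfun)) (Pi T) &
          lyapunov_running b g M Mb Theta Q0 Qb
            (fun t y psi => mu *:
               blockop 0 0 0 (adj d (d_psi b t y psi) \o d_psi b t y psi))
            K Pi]].

End fbee.

(* Main.v *)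
Require Import Defs.
From HB Require Import structures.
From mathcomp Require Import all_boot all_order all_algebra sesquilinear.
From mathcomp Require Import all_classical all_reals all_analysis.
From mathcomp Require Import finmap measurable_realfun ring lra.
Import Order.TTheory GRing.Theory Num.Theory.
Import numFieldNormedType.Exports.
Local Open Scope classical_set_scope.
Local Open Scope ring_scope.
Set Implicit Arguments.
Unset Strict Implicit.
Unset Printing Implicit Defensive.

(** The theorem is an energy argument followed by a continuation argument.

    Two solutions, with different data and with additional forcing terms, have a difference
    z = (eta, zeta), and the energy is <Pi(t) z(t), z(t)>. Its formal derivative, computed from
    the Lyapunov equation, is the quadratic form of the running condition applied to z, except
    that increments of b and g stand where the condition has their derivatives. The mean value
    theorem removes that discrepancy, for b and g in running_increment and for h in
    terminal_increment. Hence the energy decreases up to the work of the forcing, and its values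
    at the two ends are controlled by the initial and terminal conditions. What remains is a
    bound (energy_estimate) on the square of the increment of h and of the part of the increment
    of g that zeta does not explain (type I), or of the part of the increment of b that eta does
    not explain (type II). In type I a Gronwall estimate for the backward equation bounds zeta,
    and one for the forward equation then bounds eta; in type II the order is reversed. The
    energy bound contains z itself, but only to the first power, so it can be absorbed. The
    outcome is stability_estimate, with a constant that is the same for all the systems in which
    the coupling is multiplied by rho in [0, 1].

    Existence follows by continuation in rho. At rho = 0 the equations decouple and are solved by
    the variation of constants formula; because the constant is uniform in rho, a Picard
    iteration goes from rho to rho + e with e independent of rho (picard_fixpoint), and rho = 1 is
    reached in finitely many steps (solvable1). Uniqueness and both estimates are stability for
    suitable forcings: the solution is compared with the zero path, which solves the equation
    forced by the opposites of b(., 0, 0), g(., 0, 0) and h(0), or with the solution of the other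
    equation, which solves the given one forced by the differences of the coefficients.

    Mild solutions are not differentiable, so the energy has no derivative to compute. All
    integral formulas are paired with vectors, which reduces Bochner integrals to scalar ones
    (integral_is), and the increment of the energy over a short interval is rewritten exactly as
    the integral of a function close to the formal derivative (energy_increment, mixed_increment,
    energy_identity); telescoping over a fine subdivision then gives the integrated inequality
    (almost_integral_le). *)

(** * Hilbert spaces *)

Section complete.
Context {R : realType} {X : completeNormedModType R}.

(** The rate e passes to the limit, so that a limit can be compared directly with its
    approximants. *)
Lemma cauchy_rate_limit (u : nat -> X) (e : nat -> R) :
  (forall n m, (n <= m)%N -> `|u n - u m| <= e n) ->
  (forall eps : R, 0 < eps -> exists n, e n <= eps) ->
  exists w, forall n, `|u n - w| <= e n.
Proof.
move=> ue e0.
have cu : cauchy (u @ \oo).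
  apply: cauchy_exP => eps eps0.
  have [n en] := e0 (eps / 2) (divr_gt0 eps0 (ltr0n _ 2)).
  exists (u n); rewrite /fmap /=; exists n => // m /= nm.
  rewrite -ball_normE /ball_ /=; apply: le_lt_trans (ue _ _ nm) _; apply: le_lt_trans en _; lra.
have [w uw] := (cvg_ex _).1 ((cauchy_cvgP _).1 cu).
exists w => n.
have c : `|u n - u m| @[m --> \oo] --> `|u n - w|.
  by apply: cvg_norm; apply: cvgB => //; apply: cvg_cst.
rewrite -(cvg_lim _ c) //.
apply: limr_le.
- by apply/cvg_ex; exists `|u n - w|.
- by exists n => // m /= nm; apply: ue.
Qed.

End complete.

(** The inner product is kept as a plain function with its laws, since adj, pdot and
    adjoint_graph take one. *)
Definition inner_product {R : realType} {X : normedModType R} (d : X -> X -> R) :=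
  [/\ forall u v w, d (u + v) w = d u w + d v w,
      forall a u v, d (a *: u) v = a * d u v,
      forall u v, d u v = d v u &
      forall u, d u u = `|u| ^+ 2].

Section inner.
Context {R : realType} {X : normedModType R} {d : X -> X -> R}.
Hypothesis dP : inner_product d.

Lemma ipDl u v w : d (u + v) w = d u w + d v w.
Proof. by have [] := dP. Qed.
Lemma ipZl a u v : d (a *: u) v = a * d u v.
Proof. by have [] := dP. Qed.
Lemma ipC u v : d u v = d v u.
Proof. by have [] := dP. Qed.
Lemma ipxx u : d u u = `|u| ^+ 2.
Proof. by have [] := dP. Qed.
Lemma ipDr u v w : d w (u + v) = d w u + d w v.
Proof. by rewrite ipC ipDl !(ipC w). Qed.
Lemma ipZr a u v : d v (a *: u) = a * d v u.
Proof. by rewrite ipC ipZl ipC. Qed.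
Lemma ip0l u : d 0 u = 0.
Proof. by rewrite -(scale0r (0 : X)) ipZl mul0r. Qed.
Lemma ip0r u : d u 0 = 0.
Proof. by rewrite ipC ip0l. Qed.
Lemma ipNl u v : d (- u) v = - d u v.
Proof. by rewrite -scaleN1r ipZl mulN1r. Qed.
Lemma ipNr u v : d u (- v) = - d u v.
Proof. by rewrite ipC ipNl ipC. Qed.
Lemma ipBl u v w : d (u - v) w = d u w - d v w.
Proof. by rewrite ipDl ipNl. Qed.
Lemma ipBr u v w : d w (u - v) = d w u - d w v.
Proof. by rewrite ipDr ipNr. Qed.

Lemma CauchySchwarz u v : `|d u v| <= `|u| * `|v|.
Proof.
have [->|u0] := eqVneq u 0; first by rewrite ip0l !normr0 mul0r.
rewrite -(@ler_pXn2r _ 2) ?nnegrE ?mulr_ge0 // real_normK ?num_real // exprMn.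
have := sqr_ge0 `|v - (d u v / `|u| ^+ 2) *: u|.
rewrite -(ipxx (v - _)) ipBl !ipBr !ipZl !ipZr (ipC v u) !ipxx.
have n0 : 0 < `|u| ^+ 2 by rewrite exprn_gt0 // normr_gt0.
set a := d u v; set U := `|u| ^+ 2 in n0 *; set V := `|v| ^+ 2.
have -> : V - a / U * a - (a / U * a - a / U * (a / U * U)) = V - a ^+ 2 / U.
  by field; rewrite gt_eqF.
by rewrite subr_ge0 ler_pdivrMr // (mulrC V).
Qed.

Lemma ip_le u v : d u v <= `|u| * `|v|.
Proof. exact: le_trans (ler_norm _) (CauchySchwarz u v). Qed.

Lemma ip_ext u v : (forall w, d u w = d v w) -> u = v.
Proof.
move=> h; apply/eqP; rewrite -subr_eq0 -normr_eq0 -sqrf_eq0 -ipxx ipBl h subrr //.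
Qed.

Lemma norm_le_ip u (C : R) : 0 <= C -> (forall w, d u w <= C * `|w|) -> `|u| <= C.
Proof.
move=> C0 h; have [->|u0] := eqVneq u 0; first by rewrite normr0.
by have := h u; rewrite ipxx expr2 ler_pM2r // normr_gt0.
Qed.

Lemma parallelogram (u v : X) : `|u - v| ^+ 2 + `|u + v| ^+ 2 = 2 * (`|u| ^+ 2 + `|v| ^+ 2).
Proof. rewrite -!ipxx !ipBl !ipDl !ipBr !ipDr (ipC v u); ring. Qed.

End inner.

Section riesz.
Context {R : realType} {X : completeNormedModType R} {d : X -> X -> R}.
Hypothesis dP : inner_product d.

(** The energy |u|^2 / 2 - phi u is bounded below. By the parallelogram identity its minimising
    sequences are Cauchy, and the first variation at the minimiser shows that it represents phi. *)
Lemma riesz (phi : X -> R) (C : R) :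
  (forall a u v, phi (a *: u + v) = a * phi u + phi v) ->
  (forall u, `|phi u| <= C * `|u|) -> exists w, forall u, phi u = d u w.
Proof.
move=> lphi bphi.
have phi0 : phi 0 = 0.
  by apply/eqP; rewrite -normr_le0; have := bphi 0; rewrite normr0 mulr0.
have phiZ a u : phi (a *: u) = a * phi u by rewrite -[a *: u]addr0 lphi phi0 addr0.
have phiD u v : phi (u + v) = phi u + phi v by rewrite -{1}[u]scale1r lphi mul1r.
pose J u := `|u| ^+ 2 / 2 - phi u.
have Jlb u : - (C ^+ 2 / 2) <= J u.
  have h := le_trans (ler_norm _) (bphi u).
  have := sqr_ge0 (`|u| - C); rewrite /J; move: h; set p := phi u; set q := `|u|; nra.
have infJ : has_inf (range J).
  by split; [exists (J 0); exists 0 | exists (- (C ^+ 2 / 2)) => _ [u _ <-]].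
pose m := inf (range J).
have mJ u : m <= J u by apply: ge_inf; [exact: infJ.2 | exists u].
have /choice[u uJ] : forall n : nat, exists v, J v < m + n.+1%:R^-1.
  move=> n; have [|_ [v _ <-] h] := @inf_adherent _ _ n.+1%:R^-1 _ infJ; last by exists v.
  by rewrite invr_gt0.
have key a b e : 0 <= e -> J a <= m + e -> J b <= m + e -> `|a - b| <= Num.sqrt (8 * e).
  move=> e0 Ja Jb.
  rewrite -(@ler_pXn2r _ 2) ?nnegrE ?sqrtr_ge0 // sqr_sqrtr ?mulr_ge0 //.
  have := parallelogram dP a b; have := mJ (2^-1 *: (a + b)).
  rewrite /J phiZ phiD normrZ exprMn (ger0_norm (x := 2^-1)) ?invr_ge0 //.
  move: Ja Jb; rewrite /J.
  set A := `|a| ^+ 2; set B := `|b| ^+ 2; set P := `|a + b| ^+ 2; set Q := `|a - b| ^+ 2.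
  set pa := phi a; set pb := phi b => *; lra.
have [|e0|w uw] := @cauchy_rate_limit R X u (fun n => Num.sqrt (8 * n.+1%:R^-1)).
- move=> n k nk; apply: key; first by rewrite invr_ge0.
    exact/ltW.
  apply: le_trans (ltW (uJ k)) _.
  by rewrite lerD2l lef_pV2 ?posrE ?ltr0n // ler_nat ltnS.
- move=> e0pos.
  have [n nh] : exists n : nat, 8 / e0 ^+ 2 <= n%:R.
    by exists (Num.truncn (8 / e0 ^+ 2)).+1; apply: ltW; exact: truncnS_gt.
  exists n; rewrite -(@ler_pXn2r _ 2) ?nnegrE ?sqrtr_ge0 ?(ltW e0pos) // sqr_sqrtr ?mulr_ge0 ?invr_ge0 //.
  rewrite ler_pdivrMr ?ltr0n // -ler_pdivrMl ?exprn_gt0 // mulrC.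
  by apply: le_trans nh _; rewrite ler_nat.
exists w => v.
(* the first variation of J vanishes at the minimiser w *)
have var s : s * (phi v - d w v) <= s ^+ 2 * `|v| ^+ 2 / 2.
  apply/ler_addgt0Pr => e epos.
  pose D := 1 + `|s| * `|v| * 3.
  have D0 : 0 < D by rewrite /D ltr_wpDr // !mulr_ge0.
  have [n nh] : exists n : nat, (D / e) ^+ 2 + D / e <= n%:R.
    by exists (Num.truncn ((D / e) ^+ 2 + D / e)).+1; apply: ltW; exact: truncnS_gt.
  have De : 0 < D / e by apply: divr_gt0.
  have n1 : n.+1%:R^-1 <= e / D.
    rewrite -[e / D]invrK invf_div lef_pV2 ?posrE ?ltr0n //.
    apply: (@le_trans _ _ n%:R); last by rewrite ler_nat.
    by apply: le_trans nh; rewrite lerDr sqr_ge0.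
  have n2 : Num.sqrt (8 * n.+1%:R^-1) <= 3 * (e / D).
    have p3 : 0 <= 3 * (e / D) by apply: mulr_ge0 => //; apply: ltW; apply: divr_gt0.
    rewrite -(@ler_pXn2r _ 2) ?nnegrE ?sqrtr_ge0 //.
    rewrite sqr_sqrtr ?mulr_ge0 ?invr_ge0 // exprMn.
    have : n.+1%:R^-1 <= (e / D) ^+ 2.
      rewrite -[e / D]invrK invf_div exprVn lef_pV2 ?posrE ?ltr0n ?exprn_gt0 //.
      apply: (@le_trans _ _ n%:R); last by rewrite ler_nat.
      by apply: le_trans nh; rewrite lerDl ltW.
    move: (sqr_ge0 (e / D)); set a := (_ / _) ^+ 2; set b := _^-1; lra.
  have h1 := mJ (u n + s *: v); have h2 := ltW (uJ n).
  have h3 : s * d (u n - w) v <= `|s| * `|v| * (3 * (e / D)).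
    apply: le_trans (ler_norm _) _; rewrite normrM -mulrA ler_wpM2l //.
    apply: le_trans (CauchySchwarz dP _ _) _; rewrite mulrC ler_wpM2l //.
    exact: le_trans (uw n) n2.
  have h4 : `|s| * `|v| * (3 * (e / D)) + e / D = e.
    have -> : `|s| * `|v| * (3 * (e / D)) + e / D = D * (e / D) by rewrite /D; ring.
    by rewrite mulrC divfK // gt_eqF.
  move: h1 h2 h3; rewrite /J phiD phiZ -!(ipxx dP) !(ipDl dP, ipDr dP) !(ipZl dP, ipZr dP) (ipNl dP).
  rewrite (ipC dP v (u n)).
  move: n1 h4; set x1 := n.+1%:R^-1; set y1 := e / D; set y2 := `|s| * _ * _.
  set c1 := d (u n) (u n); set c2 := d (u n) v; set c3 := d w v; set c4 := d v v.
  move=> *; nra.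
set q := phi v - d w v in var.
suff: q = 0 by rewrite /q => /subr0_eq ->; rewrite ipC.
have := var (q / (1 + `|v| ^+ 2)); set N := `|v| ^+ 2.
have N0 : 0 <= N by rewrite sqr_ge0.
move=> h; apply/eqP; rewrite -sqrf_eq0 eq_le sqr_ge0 andbT.
have h' : q ^+ 2 * (1 + N) <= q ^+ 2 * N / 2.
  have P : 0 < (1 + N) ^+ 2 by apply: exprn_gt0; lra.
  have := ler_wpM2r (ltW P) h.
  have -> : q / (1 + N) * q * (1 + N) ^+ 2 = q ^+ 2 * (1 + N) by field; lra.
  have -> // : (q / (1 + N)) ^+ 2 * N / 2 * (1 + N) ^+ 2 = q ^+ 2 * N / 2 by field; lra.
have := sqr_ge0 q; nra.
Qed.

Lemma adjP (f : X -> X) : bounded_op f -> forall u v, d (f u) v = d u (adj d f v).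
Proof.
move=> [lf [C fC]] u v; rewrite /adj.
have [||w hw] := @riesz (fun u => d (f u) v) (C * `|v|).
- by move=> a x y; rewrite lf (ipDl dP) (ipZl dP).
- move=> x; apply: le_trans (CauchySchwarz dP _ _) _.
  by rewrite mulrAC ler_wpM2r.
by case: xgetP => [z _ ->//|/(_ w)] /= []; apply: hw.
Qed.

End riesz.

(** * Weak integrals over intervals *)

Section weak_integral.
Context {R : realType}.
Local Notation mu := (@lebesgue_measure R).
Local Notation I a b := (`[a, b]%classic : set (measurableTypeR R)).
Implicit Types (A B D N : set (measurableTypeR R)) (f g : R -> R) (a b c v w : R).

(** Vector-valued integrals are only used against test vectors. What a Bochner integral then
    provides is a scalar integrand that is measurable off a null set, which is why N is part of
    the definition. *)
Definition integral_is D f v := exists N,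
  [/\ measurable N, mu N = 0%E, mu.-integrable (D `\` N) (EFin \o f) &
      \int[mu]_(s in D `\` N) f s = v].

(** Removing one more null set changes nothing, so two integrals can share their null sets. *)
Lemma integral_off_null D N N' f v : measurable D -> measurable N -> measurable N' ->
  mu N' = 0%E -> mu.-integrable (D `\` N) (EFin \o f) ->
  \int[mu]_(s in D `\` N) f s = v ->
  mu.-integrable (D `\` (N `|` N')) (EFin \o f) /\
  \int[mu]_(s in D `\` (N `|` N')) f s = v.
Proof.
move=> mD mN mN' N'0 i e; rewrite -setDDl; have mDN := measurableD mD mN; split.
  by rewrite -negligible_integrable //; apply: measurable_int i.
by rewrite -e /Rintegral [in RHS](negligible_integral mN').
Qed.

Lemma integral_is_eq D f g v : measurable D -> (forall s, D s -> f s = g s) ->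
  integral_is D f v -> integral_is D g v.
Proof.
move=> mD fg [N [mN N0 i <-]]; exists N.
have fg' : {in D `\` N, f =1 g} by move=> s /set_mem[Ds _]; exact: fg.
split => //; last by apply/esym/eq_Rintegral.
by apply: eq_integrable i; [exact: measurableD | move=> s sD; rewrite /= fg'].
Qed.

Lemma integral_isD D f g v w : measurable D ->
  integral_is D f v -> integral_is D g w -> integral_is D (fun s => f s + g s) (v + w).
Proof.
move=> mD [N [mN N0 i e]] [N' [mN' N'0 i' e']]; exists (N `|` N').
have [j j'] := integral_off_null mD mN mN' N'0 i e.
have [k k'] := integral_off_null mD mN' mN N0 i' e'; rewrite setUC in k k'.
have mNN : measurable (D `\` (N `|` N')) by apply: measurableD => //; exact: measurableU.
split; [exact: measurableU|by rewrite [LHS]measureU0| |].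
  by apply: eq_integrable (integrableD mNN j k) => // s _; rewrite /= EFinD.
by rewrite RintegralD // j' k'.
Qed.

Lemma integral_isZ D f v r : measurable D ->
  integral_is D f v -> integral_is D (fun s => r * f s) (r * v).
Proof.
move=> mD [N [mN N0 i e]]; exists N; have mDN := measurableD mD mN.
split => //; first by apply: eq_integrable (integrableZl mDN r i) => // s _; rewrite /= EFinM.
by rewrite RintegralZl // e.
Qed.

Lemma integral_isN D f v : measurable D ->
  integral_is D f v -> integral_is D (fun s => - f s) (- v).
Proof.
move=> mD /(integral_isZ (-1) mD); rewrite mulN1r; apply: integral_is_eq => // s _.
by rewrite mulN1r.
Qed.

Lemma integral_isB D f g v w : measurable D ->
  integral_is D f v -> integral_is D g w -> integral_is D (fun s => f s - g s) (v - w).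
Proof. by move=> mD fv gw; apply: integral_isD => //; apply: integral_isN. Qed.

Lemma integral_is_le D f g v w : measurable D -> (forall s, D s -> f s <= g s) ->
  integral_is D f v -> integral_is D g w -> v <= w.
Proof.
move=> mD fg [N [mN N0 i e]] [N' [mN' N'0 i' e']].
have [j <-] := integral_off_null mD mN mN' N'0 i e.
have [k <-] := integral_off_null mD mN' mN N0 i' e'; rewrite setUC in k *.
apply: le_Rintegral => //; last by move=> s [Ds _]; exact: fg.
by apply: measurableD => //; exact: measurableU.
Qed.

Lemma integral_is_uniq D f v w : measurable D ->
  integral_is D f v -> integral_is D f w -> v = w.
Proof.
by move=> mD fv fw; apply/eqP; rewrite eq_le !(@integral_is_le D f f).
Qed.

Lemma integral_isW D f : mu.-integrable D (EFin \o f) ->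
  integral_is D f (\int[mu]_(s in D) f s).
Proof. by move=> i; exists set0; rewrite setD0 measure0. Qed.

Lemma measurable_I a b : measurable (I a b).
Proof. exact: measurable_itv. Qed.

Lemma mu_I a b : a <= b -> mu (I a b) = (b - a)%:E.
Proof.
move=> ab; rewrite lebesgue_measure_itv /= lte_fin.
by move: ab; rewrite le_eqVlt => /predU1P[->|->]; rewrite ?ltxx ?subrr // EFinD.
Qed.

Lemma integral_is_cst a b r : a <= b -> integral_is (I a b) (fun=> r) (r * (b - a)).
Proof.
move=> ab; have -> : r * (b - a) = \int[mu]_(s in I a b) r.
  rewrite Rintegral_cst; last exact: measurable_I.
  by rewrite [X in fine X](mu_I ab).
apply: integral_isW; apply: continuous_compact_integrable; first exact: segment_compact.
by move=> ?; exact: cvg_cst.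
Qed.

Lemma integral_is_cont a b f : {within `[a, b], continuous f} ->
  integral_is (I a b) f (\int[mu]_(s in I a b) f s).
Proof.
move=> cf; apply: integral_isW; apply: continuous_compact_integrable => //.
exact: segment_compact.
Qed.

Lemma integrableU A B f : measurable A -> measurable B -> [disjoint A & B] ->
  mu.-integrable A (EFin \o f) -> mu.-integrable B (EFin \o f) ->
  mu.-integrable (A `|` B) (EFin \o f).
Proof.
move=> mA mB AB /integrableP[mfA iA] /integrableP[mfB iB].
have mf := (measurable_funU _ mA mB).2 (conj mfA mfB).
apply/integrableP; split => //; rewrite ge0_integral_setU //=.
  exact: lte_add_pinfty.
apply/measurable_EFinP; apply: measurableT_comp => //; exact/measurable_EFinP.
Qed.

Lemma integral_is_cat a b c f v w : a <= b -> b <= c ->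
  integral_is (I a b) f v -> integral_is (I b c) f w -> integral_is (I a c) f (v + w).
Proof.
move=> ab bc [N [mN N0 i e]] [N' [mN' N'0 i' e']].
have mI x y := measurable_I x y.
have [j j'] := integral_off_null (mI a b) mN mN' N'0 i e.
have [k k'] := integral_off_null (mI b c) mN' mN N0 i' e'; rewrite setUC in k k'.
pose M := N `|` N'; have mM : measurable M by exact: measurableU.
have mb : measurable ([set b] : set (measurableTypeR R)) by exact: measurable_set1.
have b0 : mu [set b] = 0%E by exact: lebesgue_measure_set1.
have [l l'] := integral_off_null (mI b c) mM mb b0 k k'.
have E : I a c `\` M = (I a b `\` M) `|` (I b c `\` (M `|` [set b])).
  rewrite eqEsubset; split => s /=; rewrite !in_itv /=.
    move=> [/andP[h1 h2] h3]; have [h|h] := leP s b; first by left; rewrite h1.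
    by right; rewrite ltW //; split => // -[//|/= sb]; rewrite sb ltxx in h.
  move=> [[/andP[h1 h2] h3]|[/andP[h1 h2] h3]].
    by rewrite h1 (le_trans h2).
  by rewrite (le_trans ab h1) h2; split => // h; apply: h3; left.
have m1 : measurable (I a b `\` M) by exact: measurableD.
have m2 : measurable (I b c `\` (M `|` [set b])).
  by apply: measurableD => //; exact: measurableU.
have dis : [disjoint I a b `\` M & I b c `\` (M `|` [set b])].
  rewrite /disj_set; apply/eqP; rewrite -subset0 => s [] /= [].
  rewrite !in_itv /= => /andP[_ h1] _ [/andP[h2 _] h3]; apply: h3; right => /=.
  by apply/eqP; rewrite eq_le h1.
have iE : mu.-integrable (I a c `\` M) (EFin \o f) by rewrite E; exact: integrableU.
exists M; split => //; first by rewrite [LHS]measureU0.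
by rewrite -j' -l' E Rintegral_setU // -?E.
Qed.

Lemma integral_is_sub a b a' b' f v : a <= a' -> b' <= b ->
  integral_is (I a b) f v -> exists w, integral_is (I a' b') f w.
Proof.
move=> aa bb [N [mN N0 i e]]; exists (\int[mu]_(s in I a' b' `\` N) f s).
exists N; split => //; apply: integrableS i; try exact: measurableD.
move=> s /=; rewrite !in_itv /= => -[/andP[h1 h2] h3]; split => //.
by rewrite (le_trans aa) ?(le_trans _ bb).
Qed.

Lemma integral_is_tail a b c f v w : a <= b -> b <= c ->
  integral_is (I a c) f v -> integral_is (I a b) f w -> integral_is (I b c) f (v - w).
Proof.
move=> ab bc fv fw; have [u fu] := integral_is_sub ab (lexx c) fv.
by rewrite -(integral_is_uniq (measurable_I _ _) (integral_is_cat ab bc fw fu) fv) addrC addKr.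
Qed.

Lemma integral_is_init a b c f v w : a <= b -> b <= c ->
  integral_is (I a c) f v -> integral_is (I b c) f w -> integral_is (I a b) f (v - w).
Proof.
move=> ab bc fv fw; have [u fu] := integral_is_sub (lexx a) bc fv.
by rewrite -(integral_is_uniq (measurable_I _ _) (integral_is_cat ab bc fu fw) fv) addrK.
Qed.

Lemma integral_is_norm_le a b f v (C : R) : a <= b ->
  (forall s, a <= s <= b -> `|f s| <= C) -> integral_is (I a b) f v -> `|v| <= C * (b - a).
Proof.
move=> ab fC fv; rewrite ler_norml -mulNr; apply/andP; split.
  apply: integral_is_le (integral_is_cst _ ab) fv; first exact: measurable_I.
  by move=> s /=; rewrite in_itv /= => /fC; rewrite ler_norml => /andP[].
apply: integral_is_le fv (integral_is_cst _ ab); first exact: measurable_I.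
by move=> s /=; rewrite in_itv /= => /fC; rewrite ler_norml => /andP[].
Qed.

End weak_integral.

(** * Continuity on a segment *)

Section interval_continuity.
Context {R : realType} {V : normedModType R}.
Implicit Types (f : R -> V) (a b : R).

(** Continuity within a segment in elementary form, so that radii can be manipulated without
    filters on subspaces. *)
Definition cont_on a b f := forall x, a <= x <= b -> forall e : R, 0 < e ->
  exists2 r : R, 0 < r & forall t, a <= t <= b -> `|t - x| < r -> `|f t - f x| <= e.

Lemma within_contP a b f : {within `[a, b], continuous f} <-> cont_on a b f.
Proof.
rewrite subspace_continuousP; split.
  move=> cf x xab e e0; have xI : `[a, b]%classic x by rewrite /= in_itv.
  have /cvgrPdist_le/(_ e e0) := cf x xI.
  rewrite near_withinE => /nbhs_ballP[r /= r0 h]; exists r => // t tab tx.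
  rewrite distrC; apply: (h t); last by rewrite /= in_itv.
  by rewrite -ball_normE /ball_ /= distrC.
move=> cf x; rewrite /= in_itv /= => xab; apply/cvgrPdist_le => e e0.
have [r r0 h] := cf x xab e e0; rewrite near_withinE; apply/nbhs_ballP.
exists r => //= t; rewrite -ball_normE /ball_ /= in_itv /= distrC => tx tab.
by rewrite distrC; exact: h.
Qed.

Lemma unif_cont_on a b f : cont_on a b f -> forall e : R, 0 < e ->
  exists2 r : R, 0 < r & forall s t, a <= s <= b -> a <= t <= b ->
    `|t - s| < r -> `|f t - f s| <= e.
Proof.
move=> cf e e0.
have /near_covering_withinP cov := (compact_near_coveringP _).1 (@segment_compact R a b).
pose P (r s : R) := forall t, a <= t <= b -> `|t - s| < r -> `|f t - f s| <= e.
have [x xab|r /= r0 h] := cov _ (0^'+ : set_system R) P _.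
  have {}xab : a <= x <= b by move: xab; rewrite /= in_itv.
  have [r r0 h] := cf x xab (e / 2) (divr_gt0 e0 (ltr0n _ 2)).
  have r20 : 0 < r / 2 by rewrite divr_gt0.
  exists (ball x (r / 2), [set i | i < r / 2]) => /=.
    by split; [exact: nbhsx_ballx | exact: nbhs_right_lt].
  move=> [s i] /=; rewrite -ball_normE /ball_ /= => -[xs ir] sab t tab ts.
  have {}sab : a <= s <= b by move: sab; rewrite in_itv.
  have hs : `|f s - f x| <= e / 2 by apply: h => //; rewrite distrC; lra.
  have ht : `|f t - f x| <= e / 2.
    by apply: h => //; have := ler_distD s t x; rewrite (distrC s x); lra.
  have := ler_distD (f x) (f t) (f s); rewrite (distrC (f x)); lra.
exists (r / 2); first by rewrite divr_gt0.
move=> s t sab tab ts; apply: (h (r / 2)) => //=.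
- by rewrite /ball_ /= sub0r normrN gtr0_norm ?divr_gt0 //; move: (r0) => /=; lra.
- by rewrite divr_gt0.
Qed.

Lemma cont_on_bounded a b f : cont_on a b f ->
  exists C : R, 0 <= C /\ forall t, a <= t <= b -> `|f t| <= C.
Proof.
move=> /within_contP cf.
have /compact_bounded[M [_ hM]] := continuous_compact cf (@segment_compact R a b).
exists (Num.max 0 (M + 1)); rewrite le_max lexx; split => // t tab.
apply: hM; last by exists t => //=; rewrite in_itv.
by rewrite lt_max ltrDl ltr01 orbT.
Qed.

End interval_continuity.

(** * Bochner integrals against functionals *)

Section simple_functions.
Context {R : realType} {X : normedModType R}.
Local Notation mu := (@lebesgue_measure R).
Implicit Types (D E : set (measurableTypeR R)).

Lemma integral_is_indic D E : measurable D -> (mu D < +oo)%E -> measurable E -> E `<=` D ->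
  integral_is D \1_E (fine (mu E)).
Proof.
move=> mD Dfin mE ED.
have iE : mu.-integrable D (EFin \o \1_E).
  have mI : measurable_fun D (\1_E : measurableTypeR R -> R) by exact: measurable_indic.
  apply: (measurable_bounded_integrable mD Dfin mI).
  exists 1; split => // M M1 t _ /=; rewrite indicE ger0_norm ?ler0n //.
  by apply: le_trans (ltW M1); case: (_ \in _).
have -> : fine (mu E) = \int[mu]_(s in D) \1_E s.
  by rewrite /Rintegral integral_indic // setIidl.
exact: integral_isW.
Qed.

Lemma simple_preimage D (s : R -> X) (Y : set X) : measurable D -> simple_on D s ->
  measurable (D `&` s @^-1` Y : set (measurableTypeR R)).
Proof.
move=> mD [fs ms].
have -> : D `&` s @^-1` Y = \bigcup_(x in (s @` D) `&` Y) (D `&` s @^-1` [set x]).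
  rewrite eqEsubset; split => t /=.
    by move=> [Dt Yt]; exists (s t) => //; split => //; exists t.
  by move=> [x [_ Yx] [Dt /= st]]; split => //; rewrite /preimage /= st.
by apply: fin_bigcup_measurable; [exact: finite_setIl | move=> x _; exact: ms].
Qed.

Lemma simple_integralP D (s : R -> X) (phi : X -> R) :
  measurable D -> (mu D < +oo)%E -> simple_on D s ->
  (forall a u v, phi (a *: u + v) = a * phi u + phi v) ->
  integral_is D (phi \o s) (phi (simple_integral D s)).
Proof.
move=> mD Dfin ss lphi; have [fs ms] := ss.
have phi0 : phi 0 = 0.
  by have := lphi 1 0 0; rewrite scale1r addr0 mul1r => /eqP; rewrite -subr_eq subrr => /eqP <-.
have phiZ a u : phi (a *: u) = a * phi u by rewrite -[a *: u]addr0 lphi phi0 addr0.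
have phiD u v : phi (u + v) = phi u + phi v by rewrite -{1}[u]scale1r lphi mul1r.
rewrite /simple_integral fsbig_finite //.
have rs t : D t -> s t \in fset_set (s @` D) by move=> Dt; rewrite in_fset_set //; apply/mem_set; exists t.
move: (fset_uniq (fset_set (s @` D))) rs.
set r := enum_fset _ => ur rs.
have -> : phi (\sum_(x <- r) fine (mu (D `&` s @^-1` [set x])) *: x) =
  \sum_(x <- r) fine (mu (D `&` s @^-1` [set x])) * phi x.
  elim: r {ur rs} => [|x r IH]; first by rewrite !big_nil.
  by rewrite !big_cons phiD phiZ IH.
have key : integral_is D
    (fun t => \sum_(x <- r) \1_(D `&` s @^-1` [set x]) t * phi x)
    (\sum_(x <- r) fine (mu (D `&` s @^-1` [set x])) * phi x).
  elim: r {ur rs} => [|x r IH].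
    rewrite big_nil.
    have i0 := integral_is_indic mD Dfin (@measurable0 _ (measurableTypeR R)) (@sub0set _ D).
    have := integral_isZ 0 mD i0; rewrite mul0r; apply: integral_is_eq => // t _.
    by rewrite mul0r big_nil.
  rewrite big_cons.
  have mE : measurable (D `&` s @^-1` [set x] : set (measurableTypeR R)) by exact: ms.
  have ix := integral_isZ (phi x) mD (integral_is_indic mD Dfin mE (@subIsetl _ _ _)).
  rewrite (mulrC _ (phi x)).
  apply: integral_is_eq (integral_isD mD ix IH) => // t _.
  by rewrite big_cons (mulrC (phi x)).
apply: integral_is_eq key => // t Dt /=.
rewrite (bigD1_seq (s t)) //=; last exact: rs.
rewrite indicE mem_set // mul1r big1_seq ?addr0 // => x /andP[xs _].
by rewrite indicE memNset ?mul0r // => -[_ /= e]; rewrite e eqxx in xs.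
Qed.

Lemma integral_le_outer D E (F G : R -> \bar R) :
  (forall t, E t -> 0 <= F t)%E -> (forall t, D t -> 0 <= G t)%E ->
  E `<=` D -> (forall t, E t -> F t <= G t)%E ->
  (\int[mu]_(t in E) F t <= \int[mu]_(t in D) G t)%E.
Proof.
move=> F0 G0 ED FG; rewrite !ge0_integralE //.
apply: le_ereal_sup => _ [h hF <-]; exists h => // t.
apply: le_trans (hF t) _; rewrite /patch; case: ifPn => [/set_mem Et|_].
  by rewrite mem_set; [exact: FG | exact: ED].
by case: ifPn => // /set_mem /G0.
Qed.

(** A bounded functional commutes with the integrals of the approximating simple functions, and
    the L1 convergence of the approximants passes this to the limit. *)
Lemma bochner_functional D (f : R -> X) v (phi : X -> R) (C : R) :
  measurable D -> (mu D < +oo)%E -> has_bochner_integral D f v ->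
  (forall a u v, phi (a *: u + v) = a * phi u + phi v) ->
  (forall u, `|phi u| <= C * `|u|) ->
  integral_is D (phi \o f) (phi v).
Proof.
move=> mD Dfin [s [[ss [N [mN N0 hN]] Is vs]]] lphi bphi.
have phiB u w : phi (u - w) = phi u - phi w.
  by rewrite -scaleN1r addrC lphi mulN1r addrC.
have mDN : measurable (D `\` N) by exact: measurableD.
have cvgDN t : (D `\` N) t -> s n t @[n --> \oo] --> f t.
  by move=> [Dt Nt]; apply: contrapT => h; apply: Nt; apply: hN => /=; exact/not_implyP.
have phic (u : nat -> X) l : u n @[n --> \oo] --> l -> phi (u n) @[n --> \oo] --> phi l.
  move=> /cvgrPdist_le ul; apply/cvgrPdist_le => e e0.
  have C1 : 0 < `|C| + 1 by rewrite ltr_wpDl.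
  near=> n; rewrite -phiB; apply: le_trans (bphi _) _.
  apply: (@le_trans _ _ ((`|C| + 1) * `|l - u n|)).
    by rewrite ler_wpM2r // (le_trans (ler_norm C)) // lerDl.
  rewrite mulrC -ler_pdivlMr //; near: n; apply: ul; exact: divr_gt0.
have phis n := simple_integralP mD Dfin (ss n) lphi.
have mphis n : measurable_fun (D `\` N) (phi \o s n : R -> R).
  move=> _ Y mY; have -> : (D `\` N) `&` (phi \o s n) @^-1` Y =
      (D `&` s n @^-1` (phi @^-1` Y)) `\` N.
    by rewrite eqEsubset; split => t /=; [move=> [[]] | move=> [[]]].
  by apply: measurableD => //; exact: simple_preimage.
have mphi : measurable_fun (D `\` N) (phi \o f : R -> R).
  by apply: measurable_fun_cvg mphis _ => t /cvgDN /phic.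
have phisDN n : mu.-integrable (D `\` N) (EFin \o (phi \o s n)) /\
    \int[mu]_(t in D `\` N) (phi \o s n) t = phi (simple_integral D (s n)).
  have [N' [mN' N'0 i e]] := phis n.
  have [j k] := integral_off_null mD mN' mN N0 i e.
  have E : D `\` (N' `|` N) = (D `\` N) `\` N' by rewrite setDDl setUC.
  rewrite E in j k.
  have i2 : mu.-integrable (D `\` N) (EFin \o (phi \o s n)).
    by rewrite (negligible_integrable mN') //; exact/measurable_EFinP.
  split => //; rewrite -k /Rintegral; congr fine; exact: negligible_integral.
pose En n := (\int[mu]_(t in D) (`|f t - s n t|)%:E)%E.
have En0 n : (0 <= En n)%E by exact: integral_ge0.
have C1 : 0 < `|C| + 1 by rewrite ltr_wpDl.
pose psi n t := (phi (f t) - phi (s n t)) / (`|C| + 1).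
have mpsi n : measurable_fun (D `\` N) (psi n).
  apply: (measurable_funM (f := fun t => phi (f t) - phi (s n t)) (g := fun=> _^-1)) => //.
  exact: (measurable_funB mphi (mphis n)).
have bnd n : (\int[mu]_(t in D `\` N) `|(psi n t)%:E| <= En n)%E.
  apply: integral_le_outer => // t _.
  rewrite abse_EFin lee_fin /psi -phiB normrM normfV (gtr0_norm C1).
  rewrite ler_pdivrMr // mulrC; apply: le_trans (bphi _) _.
  by rewrite ler_wpM2r // (le_trans (ler_norm C)) // lerDl.
have ipsi n : (En n < +oo)%E -> mu.-integrable (D `\` N) (EFin \o psi n).
  move=> Enoo; apply/integrableP; split; first exact/measurable_EFinP.
  exact: le_lt_trans (bnd n) Enoo.
have phif n t : phi (f t) = phi (s n t) + (`|C| + 1) * psi n t.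
  by rewrite /psi mulrC divfK ?gt_eqF // addrC subrK.
have step n : (En n < +oo)%E -> mu.-integrable (D `\` N) (EFin \o (phi \o f)) /\
  `|\int[mu]_(t in D `\` N) phi (f t) - phi (simple_integral D (s n))| <=
    (`|C| + 1) * fine (En n).
  move=> Enoo; have [i1 i2] := phisDN n; have i3 := ipsi n Enoo.
  have i4 : mu.-integrable (D `\` N) (EFin \o (fun t => (`|C| + 1) * psi n t)).
    by apply: eq_integrable (integrableZl mDN _ i3) => // t _; rewrite /= EFinM.
  split.
    by apply: eq_integrable (integrableD mDN i1 i4) => // t _; rewrite /= (phif n) EFinD.
  rewrite (_ : (fun t => phi (f t)) = (fun t => phi (s n t) + (`|C| + 1) * psi n t)); last first.
    by apply/funext => t; exact: phif.
  rewrite RintegralD // i2 addrC addKr RintegralZl // normrM (gtr0_norm C1).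
  rewrite ler_wpM2l ?(ltW C1) //; apply: le_trans (le_normr_Rintegral mDN i3) _.
  rewrite /Rintegral; apply: fine_le; last exact: bnd.
    by rewrite ge0_fin_numE ?(le_lt_trans (bnd n) Enoo) //; exact: integral_ge0.
  by rewrite ge0_fin_numE.
have Efin : \forall n \near \oo, (En n < +oo)%E.
  have /fine_cvgP[+ _] := Is; apply: filterS => n; rewrite fin_num_abs gee0_abs //.
  exact: integral_ge0.
have Ecvg : fine (En n) @[n --> \oo] --> (0 : R) by have /fine_cvgP[_] := Is.
exists N; split => //.
  by have [n /step[]] := filter_ex Efin.
apply/eqP; rewrite -subr_eq0 -normr_le0; apply/ler_addgt0Pr => e e0; rewrite add0r.
have e20 : 0 < e / 2 by rewrite divr_gt0.
have /cvgrPdist_le/(_ _ e20) h1 := phic _ _ vs.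
have /cvgrPdist_le/(_ _ (divr_gt0 e20 C1)) h2 := Ecvg.
have [n [[n1 n2] n3]] := filter_ex (filterI (filterI h1 h2) Efin).
have [_ n4] := step n n3.
move: n2; rewrite sub0r normrN ger0_norm ?fine_ge0 // ler_pdivlMr // mulrC => n2.
rewrite distrC in n1.
have := ler_distD (phi (simple_integral D (s n))) (\int[mu]_(t in D `\` N) phi (f t)) (phi v).
move=> h; apply: le_trans h _; lra.
Unshelve. all: by end_near. Qed.

End simple_functions.

(** * Bochner integrals of continuous functions *)

Section bochner_of_continuous.
Context {R : realType} {X : completeNormedModType R} {d : X -> X -> R}.
Hypothesis dP : inner_product d.
Local Notation mu := (@lebesgue_measure R).
Local Notation I a b := (`[a, b]%classic : set (measurableTypeR R)).

(** The left end point of the cell of t, in the partition of step 1 / (N + 1) that starts at a. *)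
Definition step_down (a : R) (N : nat) (t : R) : R :=
  a + (Num.truncn ((t - a) * N.+1%:R))%:R / N.+1%:R.

Lemma step_down_near a N t : a <= t -> a <= step_down a N t <= t /\
  t - step_down a N t < N.+1%:R^-1.
Proof.
move=> at0; have N0 : 0 < N.+1%:R :> R by rewrite ltr0n.
have ta : 0 <= (t - a) * N.+1%:R by rewrite mulr_ge0 // subr_ge0.
have /andP[h1 h2] := truncn_itv ta.
rewrite /step_down; split; last first.
  move: h2; rewrite -[X in _ < X]natr1 -ltr_pdivlMr // mulrDl mul1r; set x := _ / _; set z := N.+1%:R^-1; lra.
move: h1; rewrite -ler_pdivrMr // => h1.
have : 0 <= (Num.truncn ((t - a) * N.+1%:R))%:R / N.+1%:R :> R by rewrite divr_ge0.
move: h1; set x := _ / _; lra.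
Qed.

Lemma step_down_simple a b N (f : R -> X) : simple_on (I a b) (f \o step_down a N).
Proof.
have N0 : 0 < N.+1%:R :> R by rewrite ltr0n.
pose M := (Num.truncn ((b - a) * N.+1%:R)).+1.
pose p (k : nat) := f (a + k%:R / N.+1%:R).
have kM t : a <= t <= b -> (Num.truncn ((t - a) * N.+1%:R) < M)%N.
  move=> /andP[at0 tb]; rewrite ltnS; apply: le_truncn.
  by rewrite ler_wpM2r ?(ltW N0) // lerD2r.
split.
  apply: (@sub_finite_set _ _ (p @` `I_M)); last exact/finite_image/finite_II.
  move=> _ [t /= tab <-]; exists (Num.truncn ((t - a) * N.+1%:R)) => //.
  by apply: kM; move: tab; rewrite in_itv.
move=> x; have -> : I a b `&` (f \o step_down a N) @^-1` [set x] =
    \bigcup_(k in `I_M `&` [set k | p k = x])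
      (I a b `&` `[a + k%:R / N.+1%:R, a + k.+1%:R / N.+1%:R[%classic).
  have cell t k : a <= t -> (k%:R <= (t - a) * N.+1%:R < k.+1%:R) =
      (t \in `[a + k%:R / N.+1%:R, a + k.+1%:R / N.+1%:R[).
    move=> at0; rewrite in_itv /= -ler_pdivrMr // -ltr_pdivlMr //.
    by rewrite lerBrDl ltrBlDl.
  have arg t : a <= t -> 0 <= (t - a) * N.+1%:R by move=> at0; rewrite mulr_ge0 // subr_ge0.
  rewrite eqEsubset; split => t /=.
    rewrite in_itv /= => -[tab fx]; exists (Num.truncn ((t - a) * N.+1%:R)).
      by split => //; exact: kM.
    have /andP[at0 _] := tab; split; first by rewrite /= in_itv.
    by rewrite /= -cell //; exact/truncn_itv/arg.
  move=> [k [kM' pk]] [tab tk]; split => //.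
  have at0 : a <= t by move: tab; rewrite /= in_itv => /andP[].
  by move: tk; rewrite /= -cell // => /truncn_def e; rewrite /step_down e.
apply: fin_bigcup_measurable; first exact/finite_setIl/finite_II.
by move=> k _; apply: measurableI; exact: measurable_itv.
Qed.

(** By uniform continuity the step functions f o step_down converge uniformly. Their integrals
    form a Cauchy sequence because they do so at a uniform rate against every test vector. *)
Lemma cont_bochner a b (f : R -> X) : a <= b -> cont_on a b f ->
  exists v, has_bochner_integral `[a, b]%classic f v.
Proof.
move=> ab cf; have mD : measurable (I a b) by exact: measurable_I.
have Dfin : (mu (I a b) < +oo)%E by rewrite [X in (X < _)%E](mu_I ab) ltry.
have inv0 (n : nat) : 0 < n.+1%:R^-1 :> R by rewrite invr_gt0.
have /choice[N hN] : forall n : nat, exists k : nat, forall t, a <= t <= b ->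
    `|f t - f (step_down a k t)| <= n.+1%:R^-1.
  move=> n; have [r r0 h] := unif_cont_on cf (inv0 n).
  exists (Num.truncn r^-1) => t /andP[at0 tb].
  have [/andP[s1 s2] s3] := step_down_near (Num.truncn r^-1) at0.
  apply: h; rewrite ?at0 ?s1 ?(le_trans s2) //.
  rewrite ger0_norm ?subr_ge0 //; apply: lt_trans s3 _.
  by rewrite -[X in _ < X]invrK ltf_pV2 ?posrE ?invr_gt0 // truncnS_gt.
pose s n := f \o step_down a (N n).
have ss n : simple_on (I a b) (s n) := step_down_simple a b (N n) f.
have lphi w : forall c u v, d (c *: u + v) w = c * d u w + d v w.
  by move=> c u v; rewrite (ipDl dP) (ipZl dP).
have Is n w := simple_integralP mD Dfin (ss n) (lphi w).
pose v n := simple_integral (I a b) (s n).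
have bma : 0 <= b - a by rewrite subr_ge0.
have [n m nm|e e0|w vw] := @cauchy_rate_limit R X v (fun n => n.+1%:R^-1 * 2 * (b - a)).
- have p0 : 0 <= n.+1%:R^-1 * 2 * (b - a) :> R by rewrite !mulr_ge0.
  apply: (norm_le_ip dP p0) => w.
  have h := integral_isB mD (Is n w) (Is m w); rewrite -(ipBl dP) in h.
  apply: le_trans (ler_norm _) _; rewrite mulrAC.
  apply: integral_is_norm_le h => // t tab /=; rewrite -(ipBl dP).
  apply: le_trans (CauchySchwarz dP _ _) _; rewrite ler_wpM2r //.
  have := ler_distD (f t) (s n t) (s m t); rewrite (distrC (s n t) (f t)).
  have h1 : `|f t - s n t| <= n.+1%:R^-1 := hN n t tab.
  have h2 : `|f t - s m t| <= m.+1%:R^-1 := hN m t tab.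
  move: h1 h2; have : m.+1%:R^-1 <= n.+1%:R^-1 :> R by rewrite lef_pV2 ?posrE ?ltr0n // ler_nat ltnS.
  set z1 := n.+1%:R^-1; set z2 := m.+1%:R^-1; lra.
- exists (Num.truncn (2 * (b - a) / e)); rewrite -mulrA ler_pdivrMl ?ltr0n //.
  by rewrite -ler_pdivrMr //; apply/ltW/truncnS_gt.
have nat_inv (e : R) : 0 < e -> \forall n \near \oo, n.+1%:R^-1 <= e.
  move=> e0; exists (Num.truncn e^-1) => // n /= hn.
  rewrite -[e]invrK lef_pV2 ?posrE ?invr_gt0 //; apply: le_trans (ltW (truncnS_gt _)) _.
  by rewrite ler_nat ltnS.
exists w, s; split.
- split => //; apply: aeW => t /= tab; rewrite in_itv /= in tab.
  apply/cvgrPdist_le => e e0; have := nat_inv e e0; apply: filterS => n hn.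
  exact: le_trans (hN n t tab) hn.
- apply/fine_cvgP.
  have h n : (\int[mu]_(t in I a b) (`|f t - s n t|)%:E <= (n.+1%:R^-1 * (b - a))%:E)%E.
    have -> : ((n.+1%:R^-1 * (b - a))%:E = \int[mu]_(t in I a b) (n.+1%:R^-1)%:E :> \bar R)%E.
      by rewrite integral_cst // [X in (_ * X)%E](mu_I ab) EFinM.
    apply: integral_le_outer => // t /=.
    by rewrite in_itv => tab; rewrite lee_fin; exact: hN.
  have h0 n : (0 <= \int[mu]_(t in I a b) (`|f t - s n t|)%:E)%E by exact: integral_ge0.
  have hfin n : (\int[mu]_(t in I a b) (`|f t - s n t|)%:E \is a fin_num)%E.
    by rewrite ge0_fin_numE // (le_lt_trans (h n)) ?ltry.
  split; first by apply: nearW.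
  apply/cvgrPdist_le => e e0; have b1 : 0 < b - a + 1 by rewrite ltr_wpDl.
  have := nat_inv _ (divr_gt0 e0 b1); apply: filterS => n hn.
  rewrite sub0r normrN /= ger0_norm ?fine_ge0 // -lee_fin fineK //.
  apply: le_trans (h n) _; rewrite lee_fin.
  apply: (@le_trans _ _ (n.+1%:R^-1 * (b - a + 1))); first by rewrite ler_wpM2l // lerDl.
  by rewrite -ler_pdivlMr.
- apply/cvgrPdist_le => e e0; have b1 : 0 < 2 * (b - a) + 1 by rewrite ltr_wpDl ?mulr_ge0.
  have := nat_inv _ (divr_gt0 e0 b1); apply: filterS => n hn.
  rewrite distrC; apply: le_trans (vw n) _; rewrite -mulrA.
  apply: (@le_trans _ _ (n.+1%:R^-1 * (2 * (b - a) + 1))); first by rewrite ler_wpM2l // lerDl.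
  by rewrite -ler_pdivlMr.
Qed.

End bochner_of_continuous.

(** * Strongly continuous semigroups on a bounded interval *)

Section linear_functions.
Context {R : realType} {U V : lmodType R} {f : U -> V}.
Hypothesis lf : linear f.

Lemma lin0 : f 0 = 0.
Proof.
by have := lf (-1) 0 0; rewrite scaler0 addr0 scaleN1r addNr.
Qed.
Lemma linZ a u : f (a *: u) = a *: f u.
Proof. by rewrite -[a *: u]addr0 lf lin0 addr0. Qed.
Lemma linD u v : f (u + v) = f u + f v.
Proof. by rewrite -{1}[u]scale1r lf scale1r. Qed.
Lemma linN u : f (- u) = - f u.
Proof. by rewrite -scaleN1r linZ scaleN1r. Qed.
Lemma linB u v : f (u - v) = f u - f v.
Proof. by rewrite linD linN. Qed.

End linear_functions.

Section telescoping.
Context {R : realType}.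

(** A function whose increments are o(t - s), uniformly, does not grow. This stands in for
    differentiation, since the energies considered below need not be differentiable along mild
    orbits. *)
Lemma telescope_le (a b : R) (k : R -> R) : a <= b ->
  (forall e : R, 0 < e -> exists2 r : R, 0 < r & forall s t, a <= s -> s <= t -> t <= b ->
     t - s < r -> k t - k s <= e * (t - s)) ->
  k b <= k a.
Proof.
move=> ab h; apply/ler_addgt0Pr => e e0.
have b1 : 0 < b - a + 1 by rewrite ltr_wpDl // subr_ge0.
have [r r0 hr] := h (e / (b - a + 1)) (divr_gt0 e0 b1).
pose N := Num.truncn ((b - a) / r); pose dl := (b - a) / N.+1%:R.
have N0 : 0 < N.+1%:R :> R by rewrite ltr0n.
have dl0 : 0 <= dl by rewrite divr_ge0 // subr_ge0.
have dlr : dl < r.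
  by rewrite /dl ltr_pdivrMr // mulrC -ltr_pdivrMr // truncnS_gt.
have key i : (i <= N.+1)%N -> k (a + i%:R * dl) - k a <= e / (b - a + 1) * (i%:R * dl).
  elim: i => [|i IH] iN; first by rewrite mul0r addr0 mulr0 subrr.
  have iN' : i%:R * dl + dl <= b - a.
    rewrite -{2}[dl]mul1r -mulrDl natr1 /dl mulrCA ler_piMr ?subr_ge0 //.
    by rewrite ler_pdivrMr // mul1r ler_nat.
  have i0 : 0 <= i%:R * dl by rewrite mulr_ge0.
  have := hr (a + i%:R * dl) (a + i.+1%:R * dl).
  rewrite -natr1 mulrDl mul1r.
  have -> : a + (i%:R * dl + dl) - (a + i%:R * dl) = dl by ring.
  move: (IH (ltnW iN)) => h1 h2.
  have := h2 _ _ _ dlr; move=> /(_ ltac:(lra) ltac:(lra) ltac:(lra)).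
  move: h1; rewrite [_ * (i%:R * dl + dl)]mulrDr; set q := e / _ * (_ * _); set p := e / _ * dl; lra.
have := key N.+1 (leqnn _).
have -> : N.+1%:R * dl = b - a by rewrite /dl mulrCA divff ?mulr1 // gt_eqF.
have -> : a + (b - a) = b by ring.
move=> hk.
have : e / (b - a + 1) * (b - a) <= e.
  by rewrite mulrAC ler_pdivrMr // ler_pM2l // lerDl.
move: hk; set q := _ * (b - a); lra.
Qed.

Lemma telescope_eq (a b : R) (k : R -> R) : a <= b ->
  (forall e : R, 0 < e -> exists2 r : R, 0 < r & forall s t, a <= s -> s <= t -> t <= b ->
     t - s < r -> `|k t - k s| <= e * (t - s)) ->
  k b = k a.
Proof.
move=> ab h; apply/eqP; rewrite eq_le; apply/andP; split.
  apply: telescope_le => // e /h[r r0 hr]; exists r => // s t *.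
  by apply: le_trans (ler_norm _) _; apply: hr.
rewrite -lerN2; apply: (@telescope_le a b (fun t => - k t)) => // e /h[r r0 hr].
exists r => // s t *; apply: (@le_trans _ _ `|k t - k s|); last exact: hr.
have -> : - k t - - k s = - (k t - k s) by ring.
by rewrite -normrN ler_norm.
Qed.

End telescoping.

Section semigroups.
Context {R : realType} {X : completeNormedModType R}.

(** What estimates on [0, T] use of a semigroup: a single bound C on [0, T], and continuity at 0
    with explicit radii. *)
Definition semigroup_on (T C : R) (S : R -> X -> X) :=
  [/\ forall t : R, 0 <= t -> linear (S t),
      forall (t : R) x, 0 <= t <= T -> `|S t x| <= C * `|x|,
      forall x, S 0 x = x,
      forall (s t : R) x, 0 <= s -> 0 <= t -> S (s + t) x = S s (S t x) &
      forall x (e : R), 0 < e -> exists2 r : R, 0 < r &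
        forall t : R, 0 <= t < r -> `|S t x - x| <= e].

Lemma linear_norm_le (U V : normedModType R) (f : U -> V) (M : R) : linear f ->
  (forall x, `|x| <= 1 -> `|f x| <= M) -> forall x, `|f x| <= M * `|x|.
Proof.
move=> lf h x.
have [->|x0] := eqVneq x 0.
  by rewrite (lin0 lf) !normr0 mulr0.
have nx : 0 < `|x| by rewrite normr_gt0.
have := h (`|x|^-1 *: x); rewrite normrZ normfV normr_id mulVf ?gt_eqF // => /(_ (lexx _)).
by rewrite (linZ lf) normrZ normfV normr_id ler_pdivrMl // mulrC.
Qed.

Lemma right_cvgP (V : normedModType R) (f : R -> V) (l : V) :
  f t @[t --> 0^'+] --> l <-> forall e : R, 0 < e -> exists2 r : R, 0 < r &
    forall t, 0 < t < r -> `|f t - l| <= e.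
Proof.
split=> [/cvgrPdist_le h e /h|h].
  move=> [r /= r0 hr]; exists r => // t /andP[t0 tr]; rewrite distrC; apply: hr => //=.
  by rewrite /ball_ /= sub0r normrN gtr0_norm.
apply/cvgrPdist_le => e /h[r r0 hr]; exists r => //= t; rewrite /ball_ /= sub0r normrN => tr t0.
by rewrite distrC; apply: hr; rewrite t0 -(gtr0_norm t0).
Qed.

Lemma C0_near0 (S : R -> X -> X) : C0_semigroup S ->
  forall x (e : R), 0 < e -> exists2 r : R, 0 < r & forall t, 0 <= t < r -> `|S t x - x| <= e.
Proof.
move=> [_ S0 _ Sc] x e e0; have [r r0 hr] := (right_cvgP _ _).1 (Sc x) e e0.
exists r => // t /andP[]; rewrite le_eqVlt => /predU1P[<- _|t0 tr].
  by rewrite S0 subrr normr0 ltW.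
by apply: hr; rewrite t0.
Qed.

(** Otherwise there are times tending to 0 at which the norms of the operators tend to infinity,
    although every orbit is bounded along them: this contradicts the uniform boundedness
    principle. *)
Lemma C0_bound_near0 (S : R -> X -> X) : C0_semigroup S ->
  exists r M : R, [/\ 0 < r, 1 <= M & forall t x, 0 <= t <= r -> `|S t x| <= M * `|x|].
Proof.
move=> C0; have [bS _ _ _] := C0; apply: contrapT => H.
have /choice[p hp] : forall n : nat, exists p : R * X,
    0 <= p.1 <= n.+1%:R^-1 /\ n.+1%:R * `|p.2| < `|S p.1 p.2|.
  move=> n; apply: contrapT => Hn; apply: H; exists n.+1%:R^-1, n.+1%:R.
  split; rewrite ?invr_gt0 ?ltr0n ?ler1n // => t x tn; rewrite leNgt; apply/negP => h.
  by apply: Hn; exists (t, x).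
pose F : set (X -> X) := [set S (p n).1 | n in setT].
have Flin f : F f -> bounded_fun_norm f /\ linear f.
  move=> [n _ <-]; have [/andP[pn _] _] := hp n; have [lS [C hC]] := bS _ pn.
  split => // r; exists (`|C| * r) => x xr; apply: le_trans (hC x) _.
  apply: (@le_trans _ _ (`|C| * `|x|)); first by rewrite ler_wpM2r // ler_norm.
  by rewrite ler_wpM2l.
have Fpt : pointwise_bounded F.
  move=> x; have [r r0 hr] := C0_near0 C0 x ltr01.
  pose N := Num.truncn r^-1.
  exists (\sum_(i < N.+1) `|S (p i).1 x| + (`|x| + 1)) => _ [n _ <-].
  have [nN|Nn] := ltnP n N.+1.
    rewrite (bigD1 (Ordinal nN)) //= -addrA lerDl addr_ge0 ?addr_ge0 //.
    by apply: sumr_ge0.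
  apply: ler_wpDl; first exact: sumr_ge0.
  have [/andP[pn0 pn] _] := hp n.
  have pr : (p n).1 < r.
    apply: le_lt_trans pn _; rewrite invf_plt ?posrE //.
    by apply: lt_le_trans (truncnS_gt _) _; rewrite ler_nat; exact: ltnW.
  have := hr (p n).1; rewrite pn0 pr => /(_ isT) h.
  by have := ler_normD (S (p n).1 x - x) x; rewrite subrK; lra.
have [M hM] := Banach_Steinhauss Flin Fpt 1.
have := hp (Num.truncn M); set n := Num.truncn M => -[pn0 hn].
have [/andP[pn _] _] := hp n; have [lS _] := bS _ pn.
have Fn : F (S (p n).1) by exists n.
have := linear_norm_le lS (hM _ Fn) (p n).2; rewrite leNgt => /negP; apply.
apply: le_lt_trans hn; rewrite ler_wpM2r //; exact/ltW/truncnS_gt.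
Qed.

(** The bound near 0 is iterated as often as needed to reach T. *)
Lemma C0_semigroup_on (S : R -> X -> X) (T : R) : C0_semigroup S ->
  exists2 C : R, 1 <= C & semigroup_on T C S.
Proof.
move=> C0; have [r [M [r0 M1 hM]]] := C0_bound_near0 C0; have [bS S0 SD _] := C0.
have bn n : forall t x, 0 <= t <= n%:R * r -> `|S t x| <= M ^+ n * `|x|.
  elim: n => [|n IH] t x.
    by rewrite mul0r => t0; rewrite (@le_anti _ _ t 0) 1?andbC // S0 expr0 mul1r.
  have [tn|nt] := leP t (n%:R * r) => /andP[t0 tn1].
    apply: le_trans (IH t x _) _; first by rewrite t0 tn.
    by rewrite ler_wpM2r // exprS ler_peMl // exprn_ge0 // (le_trans _ M1).
  have -> : t = (t - n%:R * r) + n%:R * r by rewrite subrK.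
  have n0 : 0 <= n%:R * r by rewrite mulr_ge0 // ltW.
  have d0 : 0 <= t - n%:R * r by rewrite subr_ge0 ltW.
  have d1 : t - n%:R * r <= r by move: tn1; rewrite -natr1 mulrDl mul1r; lra.
  rewrite SD //= exprS -mulrA; apply: le_trans (hM _ _ _) _; first by rewrite d0.
  by rewrite ler_wpM2l ?(le_trans _ M1) //; apply: IH; rewrite n0 lexx.
exists (M ^+ (Num.truncn (T / r)).+1); first by rewrite exprn_ege1.
split.
- by move=> t /bS[].
- move=> t x /andP[t0 tT]; apply: bn; rewrite t0 (le_trans tT) //.
  by rewrite -ler_pdivrMr // ltW // truncnS_gt.
- by move=> x; rewrite S0.
- by move=> s t x s0 t0; rewrite SD.
- exact: C0_near0.
Qed.

End semigroups.

(** * Self-adjoint and skew-adjoint generators *)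

(** Identities between vectors are checked after pairing with a test vector. *)
Ltac vec dP := apply: (ip_ext dP) => ?; rewrite ?(ipDl dP, ipNl dP, ipZl dP); ring.

Section generators.
Context {R : realType} {X : completeNormedModType R} {d : X -> X -> R}.
Hypothesis dP : inner_product d.
Implicit Types (A B : set (X * X)) (S V : R -> X -> X).

(** The difference quotient, cleared of its denominator. *)
Lemma generatorE S x y : generator S (x, y) <->
  forall e : R, 0 < e -> exists2 r : R, 0 < r &
    forall t : R, 0 < t < r -> `|S t x - x - t *: y| <= e * t.
Proof.
rewrite /generator /=.
have E (t : R) : 0 < t -> `|S t x - x - t *: y| = t * `|t^-1 *: (S t x - x) - y|.
  move=> t0; transitivity (`|t *: (t^-1 *: (S t x - x) - y)|).
    by rewrite scalerBr scalerA mulfV ?gt_eqF // scale1r.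
  by rewrite normrZ gtr0_norm.
split=> [/right_cvgP h e /h[r r0 hr]|h].
  exists r => // t /andP[t0 tr]; rewrite E // mulrC ler_wpM2r ?(ltW t0) //.
  by apply: hr; rewrite t0.
apply/right_cvgP => e /h[r r0 hr]; exists r => // t /andP[t0 tr].
by have := hr t; rewrite t0 tr E // mulrC ler_pM2r // => /(_ isT).
Qed.

Lemma generatorP A S x y : generates A S -> A (x, y) <->
  forall e : R, 0 < e -> exists2 r : R, 0 < r &
    forall t : R, 0 < t < r -> `|S t x - x - t *: y| <= e * t.
Proof. by move=> [_ <-]; exact: generatorE. Qed.

Lemma generator_orbit A S x y t : generates A S -> 0 <= t -> A (x, y) ->
  A (S t x, S t y).
Proof.
move=> gA t0 /(generatorP _ _ gA) h; apply/(generatorP _ _ gA) => e e0.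
have [C0 _] := gA; have [C C1 [lS bS _ SD _]] := C0_semigroup_on t C0.
have Cpos : 0 < C by exact: lt_le_trans C1.
have [r r0 hr] := h (e / C) (divr_gt0 e0 Cpos); exists r => // s /andP[s0 sr].
have -> : S s (S t x) - S t x - s *: S t y = S t (S s x - x - s *: y).
  rewrite !(linB (lS t t0)) (linZ (lS t t0)).
  by rewrite -!SD ?(ltW s0) // addrC [t + s]addrC addrC.
apply: le_trans (bS _ _ _) _; first by rewrite t0 lexx.
rewrite mulrC -ler_pdivlMr // mulrAC; apply: hr; by rewrite s0.
Qed.

(** Density of the domain of A, in the form in which adjoints provide it. *)
Definition total A := forall z, (forall x y, A (x, y) -> d x z = 0) -> z = 0.

Lemma functional_total A (phi : X -> R) (C : R) : total A ->
  (forall (a : R) u v, phi (a *: u + v) = a * phi u + phi v) ->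
  (forall u, `|phi u| <= C * `|u|) ->
  (forall x y, A (x, y) -> phi x = 0) -> forall x, phi x = 0.
Proof.
move=> tA lphi bphi h x; have [w hw] := riesz dP lphi bphi.
by rewrite hw (tA w) ?(ip0r dP) // => u v Auv; rewrite -hw; exact: h Auv.
Qed.

(** For x and w in the domains, s |-> beta (S s x) (V (t - s) w) has derivative 0, hence is
    constant; density extends this to all x and w. With beta = d this is the duality of the two
    semigroups; with beta u v = d (L u) v it says that L commutes with them. *)
Lemma orbit_backward A B S V (beta : X -> X -> R) (Cb : R) :
  generates A S -> generates B V -> total A -> total B ->
  (forall w a u v, beta (a *: u + v) w = a * beta u w + beta v w) ->
  (forall w a u v, beta w (a *: u + v) = a * beta w u + beta w v) ->
  (forall u v, `|beta u v| <= Cb * `|u| * `|v|) ->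
  (forall u u' v v', A (u, u') -> B (v, v') -> beta u' v = beta u v') ->
  forall t x w, 0 <= t -> beta (S t x) w = beta x (V t w).
Proof.
move=> gA gB tA tB bl br bb skew t x w t0.
have [C0 _] := gA; have [C C1 [lS bS S0 SD Sc]] := C0_semigroup_on t C0.
have [C0' _] := gB; have [C' C1' [lV bV V0 VD Vc]] := C0_semigroup_on t C0'.
have Cpos : 0 < C by exact: lt_le_trans C1.
have Cpos' : 0 < C' by exact: lt_le_trans C1'.
have Cb' : forall u v, `|beta u v| <= (`|Cb| + 1) * `|u| * `|v|.
  move=> u v; apply: le_trans (bb u v) _; rewrite !ler_wpM2r //.
  by rewrite (le_trans (ler_norm _)) // lerDl.
have bb3 p q P Q : `|p| <= P -> `|q| <= Q -> `|beta p q| <= (`|Cb| + 1) * P * Q.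
  move=> pP qQ; apply: le_trans (Cb' _ _) _; rewrite -!mulrA ler_wpM2l ?addr_ge0 //.
  exact: ler_pM.
have core u u' v v' : A (u, u') -> B (v, v') -> beta (S t u) v = beta u (V t v).
  move=> Au Bv.
  have -> : beta (S t u) v = beta (S t u) (V (t - t) v) by rewrite subrr V0.
  have -> : beta u (V t v) = beta (S 0 u) (V (t - 0) v) by rewrite subr0 S0.
  apply: (@telescope_eq _ 0 t (fun s => beta (S s u) (V (t - s) v))) => // e e0.
  pose K := (`|Cb| + 1) * C * C' * (`|u| + `|v| + 1).
  have K0 : 0 < K by rewrite !mulr_gt0 // ltr_wpDl // addr_ge0.
  have [r1 r10 h1] := (generatorP _ _ gA).1 Au (e / K) (divr_gt0 e0 K0).
  have [r2 r20 h2] := (generatorP _ _ gB).1 Bv (e / K) (divr_gt0 e0 K0).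
  exists (Num.min r1 r2); first by rewrite lt_min r10.
  move=> s s' s0 ss s't; rewrite lt_min => /andP[d1 d2].
  move: ss; rewrite le_eqVlt => /predU1P[<-|ss]; first by rewrite !subrr normr0 mulr0.
  pose h := s' - s; have h0 : 0 < h by rewrite subr_gt0.
  have tau0 : 0 <= t - s' by rewrite subr_ge0.
  pose a := S h u - u - h *: u'; pose b := V h v - v - h *: v'.
  have Es : S s' u = S s u + (h *: S s u' + S s a).
    have -> : s' = s + h by rewrite /h; ring.
    rewrite SD ?(ltW h0) // -(linZ (lS s s0)) -!(linD (lS s s0)) /a.
    by congr (S s _); rewrite addrC [h *: u' + _]addrC subrK subrK.
  have Ev : V (t - s) v = V (t - s') v + (h *: V (t - s') v' + V (t - s') b).
    have -> : t - s = (t - s') + h by rewrite /h; ring.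
    rewrite VD ?(ltW h0) // -(linZ (lV _ tau0)) -!(linD (lV _ tau0)) /b.
    by congr (V _ _); rewrite addrC [h *: v' + _]addrC subrK subrK.
  have bZl z c y : beta (c *: y) z = c * beta y z.
    have b0 : beta 0 z = 0 by have := bl z (-1) 0 0; rewrite scaler0 addr0 mulN1r addNr.
    by rewrite -[c *: y]addr0 bl b0 addr0.
  have bZr z c y : beta z (c *: y) = c * beta z y.
    have b0 : beta z 0 = 0 by have := br z (-1) 0 0; rewrite scaler0 addr0 mulN1r addNr.
    by rewrite -[c *: y]addr0 br b0 addr0.
  have bDl z y y' : beta (y + y') z = beta y z + beta y' z by rewrite -{1}[y]scale1r bl mul1r.
  have bDr z y y' : beta z (y + y') = beta z y + beta z y' by rewrite -{1}[y]scale1r br mul1r.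
  have sk : beta (S s u') (V (t - s') v) = beta (S s u) (V (t - s') v').
    exact: (skew _ _ _ _ (generator_orbit gA s0 Au) (generator_orbit gB tau0 Bv)).
  have -> : beta (S s' u) (V (t - s') v) - beta (S s u) (V (t - s) v) =
      beta (S s a) (V (t - s') v) - beta (S s u) (V (t - s') b).
    by rewrite Es Ev !bDl !bDr bZl bZr sk; ring.
  have na : `|a| <= e / K * h by apply: h1; rewrite h0.
  have nb : `|b| <= e / K * h by apply: h2; rewrite h0.
  have sT : s <= t by apply: le_trans (ltW ss) s't.
  have tT : t - s' <= t by rewrite gerBl (le_trans s0) // ltW.
  have nSa : `|S s a| <= C * (e / K * h).
    apply: le_trans (bS _ _ _) _; first by rewrite s0.
    by rewrite ler_wpM2l // ltW.
  have nVb : `|V (t - s') b| <= C' * (e / K * h).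
    apply: le_trans (bV _ _ _) _; first by rewrite tau0.
    by rewrite ler_wpM2l // ltW.
  have nVv : `|V (t - s') v| <= C' * `|v| by apply: bV; rewrite tau0.
  have nSu : `|S s u| <= C * `|u| by apply: bS; rewrite s0.
  have n1 := bb3 _ _ _ _ nSa nVv; have n2 := bb3 _ _ _ _ nSu nVb.
  apply: le_trans (ler_normB _ _) _; apply: le_trans (lerD n1 n2) _.
  have E : (`|Cb| + 1) * C * C' * (`|u| + `|v| + 1) * (e / K * h) = e * h.
    by rewrite -/K mulrA mulrCA mulfV ?mulr1 // gt_eqF.
  rewrite -/h -E.
  have : 0 <= (`|Cb| + 1) * C * C' * (e / K * h).
    by apply/ltW; rewrite !mulr_gt0 ?invr_gt0 // ltr_wpDl.
  move: (e / K * h) => q; lra.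
have stp1 v v' : B (v, v') -> forall u, beta (S t u) v = beta u (V t v).
  move=> Bv u; apply/eqP; rewrite -subr_eq0; apply/eqP.
  apply: (functional_total (phi := fun u => beta (S t u) v - beta u (V t v))
    (C := (`|Cb| + 1) * C * `|v| + (`|Cb| + 1) * `|V t v|) tA).
  - by move=> a y z; rewrite lS // !bl; ring.
  - move=> y; apply: le_trans (ler_normB _ _) _; rewrite [X in _ <= X]mulrDl; apply: lerD.
      rewrite mulrAC -(mulrA _ C); apply: bb3 => //.
      by apply: bS; rewrite t0 lexx.
    by rewrite mulrAC; exact: bb3.
  - by move=> y y' Ay; rewrite (core _ _ _ _ Ay Bv) subrr.
apply/eqP; rewrite -subr_eq0; apply/eqP.
apply: (functional_total (phi := fun w => beta (S t x) w - beta x (V t w))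
  (C := (`|Cb| + 1) * `|S t x| + (`|Cb| + 1) * `|x| * C') tB).
- by move=> a y z; rewrite lV // !br; ring.
- move=> y; apply: le_trans (ler_normB _ _) _; rewrite [X in _ <= X]mulrDl; apply: lerD.
    exact: bb3.
  by rewrite -[X in _ <= X]mulrA; apply: bb3 => //; apply: bV; rewrite t0 lexx.
- by move=> y y' By; rewrite (stp1 _ _ By) subrr.
Qed.

(** On the domain, s |-> d (S s x) (S s y) has derivative 0 by skewness. *)
Lemma skew_isometry A S : generates A S -> total A ->
  (forall u u' v v', A (u, u') -> A (v, v') -> d u' v + d u v' = 0) ->
  forall (t : R) x y, 0 <= t -> d (S t x) (S t y) = d x y.
Proof.
move=> gA tA skew t x y t0.
have [C0 _] := gA; have [C C1 [lS bS S0 SD Sc]] := C0_semigroup_on t C0.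
have Cpos : 0 < C by exact: lt_le_trans C1.
have core u u' v v' : A (u, u') -> A (v, v') -> d (S t u) (S t v) = d u v.
  move=> Au Av; rewrite -[in RHS](S0 u) -[in RHS](S0 v).
  apply: (@telescope_eq _ 0 t (fun s => d (S s u) (S s v))) => // e e0.
  pose K := C * C * (`|u'| * (`|v'| + 1) + `|u| + `|v| + 1).
  have K0 : 0 < K by rewrite !mulr_gt0 // ltr_wpDl // !addr_ge0 // mulr_ge0 // addr_ge0.
  have eK : 0 < e / K by exact: divr_gt0.
  have [r1 r10 h1] := (generatorP _ _ gA).1 Au (e / K) eK.
  have [r2 r20 h2] := (generatorP _ _ gA).1 Av (e / K) eK.
  exists (Num.min (Num.min r1 r2) (Num.min (e / K) 1)); first by rewrite !lt_min r10 r20 eK ltr01.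
  move=> s s' s0 ss s't; rewrite !lt_min => /andP[/andP[d1 d2] /andP[d3 d4]].
  move: ss; rewrite le_eqVlt => /predU1P[<-|ss]; first by rewrite !subrr normr0 mulr0.
  pose h := s' - s; have h0 : 0 < h by rewrite subr_gt0.
  have sT : s <= t by apply: le_trans (ltW ss) s't.
  pose a := S h u - u - h *: u'; pose b := S h v - v - h *: v'.
  have inc z z' : S s' z = S s z + (h *: S s z' + S s (S h z - z - h *: z')).
    have -> : s' = s + h by rewrite /h; ring.
    rewrite SD ?(ltW h0) // -(linZ (lS s s0)) -!(linD (lS s s0)).
    by congr (S s _); rewrite addrC [h *: z' + _]addrC subrK subrK.
  have sk := skew _ _ _ _ (generator_orbit gA s0 Au) (generator_orbit gA s0 Av).
  have -> : d (S s' u) (S s' v) - d (S s u) (S s v) =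
      h * d (S s u') (h *: S s v' + S s b) + d (S s a) (S s' v) + d (S s u) (S s b).
    have E1 := inc v v'; have E2 := inc u u'; rewrite -/a -/b in E1 E2.
    have -> : d (S s u) (S s b) = d (S s u) (S s b) + h * (d (S s u') (S s v) + d (S s u) (S s v')).
      by rewrite sk mulr0 addr0.
    rewrite E2 !(ipDl dP) E1 !(ipDr dP) !(ipZl dP) !(ipZr dP); ring.
  have na : `|a| <= e / K * h by apply: h1; rewrite h0.
  have nb : `|b| <= e / K * h by apply: h2; rewrite h0.
  have bd z Z : `|z| <= Z -> `|S s z| <= C * Z.
    move=> zZ; apply: le_trans (bS _ _ _) _; first by rewrite s0.
    by rewrite ler_wpM2l // ltW.
  have bd' z : `|S s' z| <= C * `|z| by apply: bS; rewrite s't andbT (le_trans s0) ?ltW.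
  have cs p q P Q : `|p| <= P -> `|q| <= Q -> `|d p q| <= P * Q.
    by move=> pP qQ; apply: le_trans (CauchySchwarz dP _ _) _; apply: ler_pM.
  have n1 : `|h * d (S s u') (h *: S s v' + S s b)| <=
      h * ((C * `|u'|) * (e / K * (C * `|v'|) + C * (e / K * 1))).
    rewrite normrM (gtr0_norm h0) ler_wpM2l ?(ltW h0) //; apply: cs; first exact: bd.
    apply: le_trans (ler_normD _ _) _; apply: lerD.
      rewrite normrZ (gtr0_norm h0); apply: ler_pM; rewrite ?(ltW h0) ?(ltW d3) //.
      exact: bd.
    by apply: bd; apply: le_trans nb _; rewrite ler_wpM2l ?(ltW eK) // ltW.
  have n2 := cs _ _ _ _ (bd _ _ na) (bd' v); have n3 := cs _ _ _ _ (bd _ _ (lexx `|u|)) (bd _ _ nb).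
  apply: le_trans (ler_normD _ _) _; apply: le_trans (lerD (le_trans (ler_normD _ _) (lerD n1 n2)) n3) _.
  have E : C * C * (`|u'| * (`|v'| + 1) + `|u| + `|v| + 1) * (e / K) * h = e * h.
    by rewrite -/K mulrCA mulfV ?mulr1 // gt_eqF.
  rewrite -/h -E.
  have : 0 <= C * C * (e / K) * h by apply/ltW; rewrite !mulr_gt0 ?invr_gt0.
  move: (e / K) => q; lra.
have cs2 u v : `|d (S t u) (S t v)| <= C * C * `|v| * `|u|.
  apply: le_trans (CauchySchwarz dP _ _) _.
  have -> : C * C * `|v| * `|u| = (C * `|u|) * (C * `|v|) by ring.
  by apply: ler_pM => //; apply: bS; rewrite t0 lexx.
have stp1 v v' : A (v, v') -> forall u, d (S t u) (S t v) = d u v.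
  move=> Av u; apply/eqP; rewrite -subr_eq0; apply/eqP.
  apply: (functional_total (phi := fun u => d (S t u) (S t v) - d u v)
    (C := C * C * `|v| + `|v|) tA).
  - by move=> a p q; rewrite lS // !(ipDl dP) !(ipZl dP); ring.
  - move=> p; apply: le_trans (ler_normB _ _) _; rewrite [X in _ <= X]mulrDl lerD //.
    by rewrite mulrC (CauchySchwarz dP).
  - by move=> p p' Ap; rewrite (core _ _ _ _ Ap Av) subrr.
apply/eqP; rewrite -subr_eq0; apply/eqP.
apply: (functional_total (phi := fun y => d (S t x) (S t y) - d x y)
  (C := C * C * `|x| + `|x|) tA).
- by move=> a p q; rewrite lS // !(ipDr dP) !(ipZr dP); ring.
- move=> p; apply: le_trans (ler_normB _ _) _; rewrite [X in _ <= X]mulrDl lerD //.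
    by rewrite (ipC dP).
  exact: (CauchySchwarz dP).
- by move=> p p' Ap; rewrite (stp1 _ _ Ap) subrr.
Qed.

Lemma generator_at0 A S z : generates A S -> A (0, z) -> z = 0.
Proof.
move=> gA /(generatorP _ _ gA) h; apply/eqP; rewrite -normr_le0; apply/ler_addgt0Pr => e e0.
have [[bS _ _ _] _] := gA; have [r r0 hr] := h e e0; rewrite add0r.
have r2 : 0 < r / 2 by rewrite divr_gt0.
have := hr (r / 2); rewrite r2 => /(_ ltac:(apply/andP; split => //; lra)).
rewrite (lin0 (bS _ (ltW r2)).1) subr0 sub0r normrN normrZ (gtr0_norm r2) mulrC.
by rewrite ler_pM2r.
Qed.

(** A vector z orthogonal to the domain gives a pair (0, z) of the adjoint graph, and a
    generator relates 0 only to 0. *)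
Lemma total_generator A S : generates A S ->
  adjoint_graph d A = A \/ adjoint_graph d A = opp_graph A -> total A.
Proof.
move=> gA cases z hz.
have : adjoint_graph d A (0, z) by move=> x y Axy /=; rewrite (ip0r dP) (hz _ _ Axy).
case: cases => ->; first exact: generator_at0 gA.
by rewrite /opp_graph /= => /(generator_at0 gA)/eqP; rewrite oppr_eq0 => /eqP.
Qed.

(** The adjoints V t of the isometries S t are contractions, whence the strong continuity of V,
    and left inverses of S t. Duality gives one inclusion between the generator of V and the
    adjoint of A; inverting S t gives the other. *)
Lemma generates_opp A S : generates A S -> adjoint_graph d A = opp_graph A ->
  exists V, generates (opp_graph A) V.
Proof.
move=> gA AA; have tA := total_generator gA (or_intror AA).
have adjE u u' v v' : A (u, u') -> A (v, - v') -> d u' v = d u v'.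
  move=> Au Av; have h : adjoint_graph d A (v, v') by rewrite AA.
  exact: h Au.
have iso (t : R) x y : 0 <= t -> d (S t x) (S t y) = d x y.
  apply: (skew_isometry gA tA) => u u' v v' Au Av.
  by rewrite (adjE u u' v (- v')) ?opprK // (ipNr dP) addNr.
have [[bS S0 SD Sc] _] := gA.
have near0 := C0_near0 (gA.1).
pose V (t : R) := adj d (S t).
have VP (t : R) u v : 0 <= t -> d (S t u) v = d u (V t v) by move=> t0; exact/(adjP dP)/bS.
have nV (t : R) x : 0 <= t -> `|V t x| <= `|x|.
  move=> t0; apply: (norm_le_ip dP) => // w; rewrite (ipC dP) -VP //.
  apply: le_trans (ip_le dP _ _) _; rewrite mulrC ler_wpM2l //.
  by rewrite -(@ler_pXn2r _ 2) ?nnegrE // -!(ipxx dP) iso.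
have lV (t : R) : 0 <= t -> linear (V t).
  move=> t0 a u v; apply: (ip_ext dP) => w.
  by rewrite (ipC dP) -VP // !(ipDr dP) !(ipZr dP) !VP // !(ipDl dP) !(ipZl dP) !(ipC dP w).
have VS (t : R) x : 0 <= t -> V t (S t x) = x.
  by move=> t0; apply: (ip_ext dP) => w; rewrite (ipC dP) -VP // iso // (ipC dP).
have nearV x (e : R) : 0 < e -> exists2 r : R, 0 < r & forall t : R, 0 <= t < r -> `|V t x - x| <= e.
  move=> e0; have x1 : 0 < 2 * (`|x| + 1) by rewrite mulr_gt0 // ltr_wpDl.
  have [r r0 hr] := near0 x (e ^+ 2 / (2 * (`|x| + 1))) (divr_gt0 (exprn_gt0 2 e0) x1).
  exists r => // t /andP[t0 tr]; rewrite -(@ler_pXn2r _ 2) ?nnegrE ?(ltW e0) //.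
  rewrite -(ipxx dP) !(ipBl dP) !(ipBr dP) (ipxx dP (V t x)) (ipC dP (V t x)) -VP // (ipxx dP x).
  have := ip_le dP (x - S t x) x; rewrite (ipBl dP) (ipxx dP x) distrC.
  have := hr t; rewrite t0 tr => /(_ isT); rewrite ler_pdivlMr // => h1 h2.
  have h3 : `|V t x| ^+ 2 <= `|x| ^+ 2 by rewrite ler_pXn2r ?nnegrE // nV.
  have := normr_ge0 (S t x - x); have := normr_ge0 x.
  move: h1 h2 h3; set p := `|S t x - x|; set q := `|x| => *; nra.
exists V; split.
  split.
  - move=> t t0; split; first exact: lV.
    by exists 1 => x; rewrite mul1r nV.
  - apply/funext => x; apply: (ip_ext dP) => w; rewrite (ipC dP) -VP // S0 /=.
    by rewrite (ipC dP).
  - move=> s t s0 t0; apply/funext => x; apply: (ip_ext dP) => w /=.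
    rewrite (ipC dP) -VP ?addr_ge0 // addrC SD //= [RHS](ipC dP) -!VP //.
  - move=> x; apply/right_cvgP => e /(nearV x)[r r0 hr]; exists r => // t /andP[t0 tr].
    by apply: hr; rewrite ltW.
apply/seteqP; split => -[x z].
  move=> /generatorE hV; rewrite -AA => u u' Au /=.
  apply/eqP; rewrite -subr_eq0 -normr_le0; apply/ler_addgt0Pr => e e0; rewrite add0r.
  have K0 : 0 < `|u| + `|x| + 1 by rewrite ltr_wpDl // addr_ge0.
  have [r1 r10 h1] := hV _ (divr_gt0 e0 K0).
  have [r2 r20 h2] := (generatorP _ _ gA).1 Au _ (divr_gt0 e0 K0).
  pose t := Num.min r1 r2 / 2.
  have m0 : 0 < Num.min r1 r2 by rewrite lt_min r10.
  have t0 : 0 < t by rewrite divr_gt0.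
  have tm : t < Num.min r1 r2 by rewrite /t; lra.
  move: tm; rewrite lt_min => /andP[tr1 tr2].
  have {}h1 := h1 t; have {}h2 := h2 t; rewrite t0 tr1 in h1; rewrite t0 tr2 in h2.
  have {h1} nb := h1 isT; have {h2} na := h2 isT.
  rewrite -(ler_pM2l t0) -{1}(gtr0_norm t0) -normrM.
  have -> : t * (d u' x - d u z) = d u (V t x - x - t *: z) - d (S t u - u - t *: u') x.
    by rewrite !(ipBl dP) !(ipBr dP) VP ?(ltW t0) // (ipZr dP) (ipZl dP); ring.
  apply: le_trans (ler_normB _ _) _.
  have c1 := CauchySchwarz dP u (V t x - x - t *: z).
  have c2 := CauchySchwarz dP (S t u - u - t *: u') x.
  apply: le_trans (lerD c1 c2) _.
  have E : (`|u| + `|x| + 1) * (e / (`|u| + `|x| + 1) * t) = t * e.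
    by field; rewrite gt_eqF.
  rewrite -E; have q0 : 0 <= e / (`|u| + `|x| + 1) * t by rewrite mulr_ge0 ?divr_ge0 ?ltW.
  have := ler_wpM2l (normr_ge0 u) nb; have := ler_wpM2r (normr_ge0 x) na.
  move: (e / _ * t) q0 => q q0; nra.
rewrite /opp_graph /= => Axz; apply/generatorE => e e0.
have e2 : 0 < e / 2 by rewrite divr_gt0.
have [r1 r10 h1] := (generatorP _ _ gA).1 Axz _ e2.
have [r2 r20 h2] := nearV z _ e2.
exists (Num.min r1 r2); first by rewrite lt_min r10.
move=> t; rewrite lt_min => /andP[t0 /andP[tr1 tr2]].
have -> : V t x - x - t *: z = t *: (V t z - z) - V t (S t x - x - t *: - z).
  have l := lV t (ltW t0).
  rewrite !(linB l) (linZ l) (linN l) VS ?(ltW t0) // scalerBr scalerN opprK.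
  by vec dP.
apply: le_trans (ler_normB _ _) _.
have n1 : `|t *: (V t z - z)| <= t * (e / 2).
  by rewrite normrZ (gtr0_norm t0) ler_wpM2l ?(ltW t0) //; apply: h2; rewrite ltW.
have n2 : `|V t (S t x - x - t *: - z)| <= e / 2 * t.
  by apply: le_trans (nV _ _ (ltW t0)) _; apply: h1; rewrite t0.
apply: le_trans (lerD n1 n2) _; lra.
Qed.

(** In the skew case the dual semigroup is generated by a skew operator as well, hence
    isometric; its adjoint sg A t is therefore its left inverse. *)
Lemma dual_semigroups A : (exists S, generates A S) ->
  adjoint_graph d A = A \/ adjoint_graph d A = opp_graph A ->
  [/\ generates A (sg A), generates (adjoint_graph d A) (sg (adjoint_graph d A)),
      forall (t : R) x w, 0 <= t -> d (sg A t x) w = d x (sg (adjoint_graph d A) t w) &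
      adjoint_graph d A = opp_graph A -> forall (t : R) x, 0 <= t ->
        sg A t (sg (adjoint_graph d A) t x) = x].
Proof.
move=> [S gS] cases.
have gA : generates A (sg A) by apply: (@getPex _ [set S | generates A S]); exists S.
have gB : generates (adjoint_graph d A) (sg (adjoint_graph d A)).
  apply: (@getPex _ [set S | generates (adjoint_graph d A) S]).
  case: (cases) => E; rewrite E; first by exists S.
  exact: generates_opp gS E.
have tA := total_generator gS cases.
have tB : total (adjoint_graph d A).
  case: (cases) => E; rewrite E // => z hz; apply: tA => x y Axy; apply: (hz x (- y)).
  by rewrite /opp_graph /= opprK.
have dual (t : R) x w : 0 <= t -> d (sg A t x) w = d x (sg (adjoint_graph d A) t w).
  apply: (orbit_backward (beta := d) (Cb := 1) gA gB tA tB).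
  - by move=> *; rewrite (ipDl dP) (ipZl dP).
  - by move=> *; rewrite (ipDr dP) (ipZr dP).
  - by move=> u v; rewrite mul1r (CauchySchwarz dP).
  - by move=> u u' v v' Au /(_ _ _ Au).
split => // E t x t0; apply: (ip_ext dP) => w.
rewrite dual //; apply: (skew_isometry gB tB) => // u u' v v' Bu Bv.
have Av : A (v, - v') by move: Bv; rewrite E.
have := Bu _ _ Av => /=; rewrite (ipNl dP) (ipC dP v u') => <-.
by rewrite (ipC dP v' u) addNr.
Qed.

End generators.

(** * Energies along mild orbits *)

Section almost_integrals.
Context {R : realType}.
Implicit Types (T : R) (e phi : R -> R).

(** On short intervals [p, q] the increment of e is the integral of a function n which depends
    on p and q and is uniformly close to phi. Increments of an energy along mild orbits can be
    computed in this form exactly, with no regularity of the orbits. *)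
Definition almost_integral T e phi := forall eps : R, 0 < eps ->
  exists2 r : R, 0 < r & forall p q, 0 <= p -> p <= q -> q <= T -> q - p < r ->
    exists n, integral_is `[p, q]%classic n (e q - e p) /\
      forall s, p <= s <= q -> `|n s - phi s| <= eps.

Lemma almost_integralD T e e' phi phi' :
  almost_integral T e phi -> almost_integral T e' phi' ->
  almost_integral T (fun t => e t + e' t) (fun t => phi t + phi' t).
Proof.
move=> h h' eps eps0; have eps2 : 0 < eps / 2 by rewrite divr_gt0.
have [r r0 hr] := h _ eps2; have [r' r0' hr'] := h' _ eps2.
exists (Num.min r r'); first by rewrite lt_min r0.
move=> p q p0 pq qT; rewrite lt_min => /andP[d1 d2].
have [n [n1 n2]] := hr p q p0 pq qT d1; have [m [m1 m2]] := hr' p q p0 pq qT d2.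
exists (fun s => n s + m s); split.
  have -> : e q + e' q - (e p + e' p) = (e q - e p) + (e' q - e' p) by ring.
  by apply: integral_isD => //; exact: measurable_I.
move=> s spq; have -> : n s + m s - (phi s + phi' s) = (n s - phi s) + (m s - phi' s) by ring.
apply: le_trans (ler_normD _ _) _; have := n2 s spq; have := m2 s spq; lra.
Qed.

Lemma almost_integralZ T c e phi :
  almost_integral T e phi -> almost_integral T (fun t => c * e t) (fun t => c * phi t).
Proof.
move=> h eps eps0; have c1 : 0 < `|c| + 1 by rewrite ltr_wpDl.
have [r r0 hr] := h _ (divr_gt0 eps0 c1); exists r => // p q p0 pq qT d1.
have [n [n1 n2]] := hr p q p0 pq qT d1; exists (fun s => c * n s); split.
  by rewrite -mulrBr; apply: integral_isZ => //; exact: measurable_I.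
move=> s spq; rewrite -mulrBr normrM; have := n2 s spq.
rewrite ler_pdivlMr // => h2; apply: le_trans h2.
by rewrite mulrC ler_wpM2l // lerDl.
Qed.

(** The errors, proportional to the lengths of the intervals, disappear by telescoping. *)
Lemma almost_integral_le T e phi k v : 0 <= T -> almost_integral T e phi ->
  (forall s, 0 <= s <= T -> phi s <= k s) -> integral_is `[0, T]%classic k v ->
  e T - e 0 <= v.
Proof.
move=> T0 h phik kv.
have /choice[K hK] : forall t, exists w, 0 <= t <= T -> integral_is `[0, t]%classic k w.
  move=> t; have [/andP[t0 tT]|h'] := boolP (0 <= t <= T); last by exists 0.
  by have [w hw] := integral_is_sub (lexx 0) tT kv; exists w.
have K0 : K 0 = 0.
  have := hK 0; rewrite lexx T0 => /(_ isT) h0.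
  have := integral_is_cat (lexx 0) (lexx 0) h0 h0.
  by move=> /(integral_is_uniq (measurable_I _ _) h0); lra.
have KT : K T = v.
  have := hK T; rewrite lexx T0 => /(_ isT) h0.
  exact: integral_is_uniq (measurable_I _ _) h0 kv.
have := @telescope_le R 0 T (fun t => e t - K t) T0; rewrite K0 KT subr0.
rewrite lerBlDr lerBlDr addrC; apply => eps eps0.
have [r r0 hr] := h eps eps0; exists r => // p q p0 pq qT d1.
have [n [n1 n2]] := hr p q p0 pq qT d1.
have hp := hK p; have hq := hK q.
rewrite p0 (le_trans pq qT) in hp; rewrite (le_trans p0 pq) qT in hq.
have kpq := integral_is_tail p0 pq (hq isT) (hp isT).
have cpq := integral_is_cst eps pq.
have := integral_is_le (measurable_I p q) _ n1 (integral_isD (measurable_I _ _) kpq cpq).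
have hle s : `[p, q]%classic s -> n s <= k s + eps.
  rewrite /= in_itv /= => spq; have := n2 s spq; rewrite ler_norml => /andP[_].
  have : phi s <= k s by apply: phik; case/andP: spq => *; rewrite (le_trans p0) ?(le_trans _ qT).
  by lra.
move=> /(_ hle); lra.
Qed.

End almost_integrals.

Section energy.
Context {R : realType} {X : completeNormedModType R} {d : X -> X -> R}.
Hypothesis dP : inner_product d.
Variables (T C : R).
Hypotheses (C1 : 1 <= C).
Implicit Types (S : R -> X -> X) (u v F G : R -> X) (L N W : R -> X -> X).

(** An orbit goes from p to q, upward in time if fw holds and downward otherwise; hull p q is
    the interval that it covers. Both equations of the system thus share one formalism. *)
Definition before (fw : bool) (p q : R) := if fw then p <= q else q <= p.
Definition hull (p q : R) : set R := `[Num.min p q, Num.max p q]%classic.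

(** The variation of constants formula between any two times, tested against w. *)
Definition mild fw S u F := forall p q w, 0 <= p <= T -> 0 <= q <= T -> before fw p q ->
  integral_is (hull p q) (fun s => d (S `|q - s| (F s)) w)
    (d (u q) w - d (S `|q - p| (u p)) w).

(** The mild Lyapunov equation tested on orbits of S: N is the formal derivative of L in the
    frame moving with S. *)
Definition lyap fw S L N := forall p q x w, 0 <= p <= T -> 0 <= q <= T -> before fw p q ->
  integral_is (hull p q) (fun s => d (N s (S `|s - p| x)) (S `|s - p| w))
    (d (L q (S `|q - p| x)) (S `|q - p| w) - d (L p x) w).

Definition op_family L := forall t, 0 <= t <= T ->
  linear (L t) /\ forall x, `|L t x| <= C * `|x|.

Definition bounded_by u := forall t, 0 <= t <= T -> `|u t| <= C.

Lemma hull_norm_le p q f (c K : R) :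
  (forall s, Num.min p q <= s <= Num.max p q -> `|f s| <= K) ->
  integral_is (hull p q) f c -> `|c| <= K * `|q - p|.
Proof.
move=> fK fv; have mM : Num.min p q <= Num.max p q.
  by rewrite le_max !ge_min lexx.
have := integral_is_norm_le mM fK fv.
suff -> : Num.max p q - Num.min p q = `|q - p| by [].
have [pq|pq] := leP p q; first by rewrite ger0_norm // subr_ge0.
by rewrite ler0_norm ?opprB // subr_le0 ltW.
Qed.

Lemma hullP fw p q s : before fw p q -> Num.min p q <= s <= Num.max p q ->
  [/\ before fw p s, before fw s q, `|q - p| = `|q - s| + `|s - p| & `|q - s| <= `|q - p|
     /\ `|s - p| <= `|q - p|].
Proof.
rewrite /before; case: fw => pq.
  rewrite min_l // max_r // => /andP[s1 s2].
  rewrite !ger0_norm ?subr_ge0 //; split => //; first ring.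
  by split; lra.
rewrite min_r // max_l // => /andP[s1 s2].
rewrite !(ler0_norm, ger0_norm) ?subr_le0 //; split => //; first ring.
by split; lra.
Qed.

Lemma dist_split fw p s q : before fw p s -> before fw s q -> `|q - p| = `|q - s| + `|s - p|.
Proof.
rewrite /before; case: fw => ps sq.
  by rewrite !ger0_norm ?subr_ge0 // ?(le_trans ps) //; ring.
by rewrite !ler0_norm ?subr_le0 // ?(le_trans sq) //; ring.
Qed.

Lemma in_hull p q s : 0 <= p <= T -> 0 <= q <= T ->
  Num.min p q <= s <= Num.max p q -> 0 <= s <= T.
Proof.
move=> /andP[p0 pT] /andP[q0 qT] /andP[s1 s2]; apply/andP; split.
  by apply: le_trans s1; rewrite le_min p0.
by apply: le_trans s2 _; rewrite ge_max pT.
Qed.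

Lemma dist_le p q : 0 <= p <= T -> 0 <= q <= T -> 0 <= `|q - p| <= T.
Proof.
move=> /andP[p0 pT] /andP[q0 qT]; rewrite normr_ge0 /= ler_norml; apply/andP; split; lra.
Qed.

Lemma ip_bound p q P Q : `|p| <= P -> `|q| <= Q -> `|d p q| <= P * Q.
Proof. by move=> pP qQ; apply: le_trans (CauchySchwarz dP _ _) _; apply: ler_pM. Qed.

Section one_semigroup.
Variable S : R -> X -> X.
Hypothesis SP : semigroup_on T C S.

Lemma semigroup_norm_le t x P : 0 <= t <= T -> `|x| <= P -> `|S t x| <= C * P.
Proof.
have [_ bS _ _ _] := SP; move=> tT xP; apply: le_trans (bS _ _ tT) _.
by rewrite ler_wpM2l // (le_trans _ C1).
Qed.

Lemma op_norm_le L t x P : op_family L -> 0 <= t <= T -> `|x| <= P -> `|L t x| <= C * P.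
Proof.
move=> LP tT xP; have [_ bL] := LP t tT; apply: le_trans (bL _) _.
by rewrite ler_wpM2l // (le_trans _ C1).
Qed.

Lemma mild_close fw u F p q : mild fw S u F -> bounded_by F ->
  0 <= p <= T -> 0 <= q <= T -> before fw p q ->
  `|u q - S `|q - p| (u p)| <= C * C * `|q - p|.
Proof.
move=> mu bF pT qT pq; have C0 : 0 <= C by exact: le_trans C1.
apply: (norm_le_ip dP); first by rewrite !mulr_ge0.
move=> w; rewrite (ipBl dP); apply: le_trans (ler_norm _) _.
rewrite mulrAC; apply: hull_norm_le (mu p q w pT qT pq) => s sI.
have sT := in_hull pT qT sI; apply: ip_bound => //.
by apply: semigroup_norm_le; [exact: dist_le | exact: bF].
Qed.

Lemma lyap_close fw L N p q x w P Q : lyap fw S L N -> op_family N ->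
  0 <= p <= T -> 0 <= q <= T -> before fw p q -> `|x| <= P -> `|w| <= Q ->
  `|d (L q (S `|q - p| x)) (S `|q - p| w) - d (L p x) w| <= C * (C * P) * (C * Q) * `|q - p|.
Proof.
move=> lL NP pT qT pq xP wQ; apply: hull_norm_le (lL p q x w pT qT pq) => s sI.
have sT := in_hull pT qT sI; have h := dist_le pT sT.
by apply: ip_bound; [apply: op_norm_le => //|]; exact: semigroup_norm_le.
Qed.

(** Transporting u, v and L by their integral formulas expresses the increment exactly. The
    integrand n differs from the formal derivative of d (L u) v only in that some of the values
    at s are replaced by values transported from p or towards q, at distance O(q - p). *)
Lemma energy_increment fw u v F G L N : mild fw S u F -> mild fw S v G -> lyap fw S L N ->
  op_family L -> op_family N -> bounded_by u -> bounded_by v -> bounded_by F -> bounded_by G ->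
  forall p q, 0 <= p <= T -> 0 <= q <= T -> before fw p q -> exists n,
    integral_is (hull p q) n (d (L q (u q)) (v q) - d (L p (u p)) (v p)) /\
    forall s, Num.min p q <= s <= Num.max p q ->
      `|n s - (d (N s (u s)) (v s) + d (L s (F s)) (v s) + d (L s (u s)) (G s))|
        <= 6 * C ^+ 6 * `|q - p|.
Proof.
move=> mu mv lL LP NP bu bv bF bG p q pT qT pq; have C0 : 0 <= C by exact: le_trans C1.
have [lS _ _ SD _] := SP.
have [linL bL] := LP q qT.
have bop : bounded_op (L q) by split => //; exists C.
pose h := `|q - p|; have hT : 0 <= h <= T by exact: dist_le.
have h0 : 0 <= h by exact: normr_ge0.
pose w1 := adj d (L q) (v q).
exists (fun s => d (N s (S `|s - p| (u p))) (S `|s - p| (v p)) + d (S `|q - s| (F s)) w1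
   + d (S `|q - s| (G s)) (L q (S h (u p)))); split.
  have mI : measurable (hull p q : set (measurableTypeR R)) by exact: measurable_I.
  have := integral_isD mI (integral_isD mI (lL p q (u p) (v p) pT qT pq) (mu p q w1 pT qT pq))
     (mv p q (L q (S h (u p))) pT qT pq).
  rewrite /w1 -!(adjP dP bop) !(ipC dP _ (L q (S h (u p)))) -/h.
  by congr integral_is; ring.
move=> s sI; have sT := in_hull pT qT sI.
have [ps sq E [hs1 hs2]] := hullP pq sI.
have qsT := dist_le sT qT; have spT := dist_le pT sT.
have [linLs _] := LP s sT; have [linN _] := NP s sT.
have C26 : forall k, (k <= 6)%N -> C ^+ k <= C ^+ 6 by move=> k k6; rewrite ler_weXn2l.
have up := mild_close mu bF pT sT ps; have vp := mild_close mv bG pT sT ps.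
have vq := mild_close mv bG sT qT sq.
have shr (z : X) (k : R) : k <= h -> `|z| <= C * C * k -> `|z| <= C * C * h.
  by move=> kh zk; apply: le_trans zk _; rewrite ler_wpM2l // mulr_ge0.
have {}up := shr _ _ hs2 up; have {}vp := shr _ _ hs2 vp; have {}vq := shr _ _ hs1 vq.
(* 6 is the number of errors of size at most C^6 h, two for each term of the derivative *)
have t1 : `|d (N s (S `|s - p| (u p))) (S `|s - p| (v p)) - d (N s (u s)) (v s)|
    <= C * (C * C * h) * (C * C) + C * C * (C * C * h).
  have -> : d (N s (S `|s - p| (u p))) (S `|s - p| (v p)) - d (N s (u s)) (v s) =
    - (d (N s (u s - S `|s - p| (u p))) (S `|s - p| (v p)) + d (N s (u s)) (v s - S `|s - p| (v p))).
    by rewrite (linB linN) !(ipBl dP) !(ipBr dP); ring.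
  rewrite normrN; apply: le_trans (ler_normD _ _) _; apply: lerD; apply: ip_bound => //.
  - exact: op_norm_le.
  - by apply: semigroup_norm_le => //; exact: bv.
  - by apply: op_norm_le => //; exact: bu.
have lq2 x w P Q := @lyap_close fw L N s q x w P Q lL NP sT qT sq.
have shr2 (z P Q : R) : 0 <= P -> 0 <= Q -> `|z| <= C * (C * P) * (C * Q) * `|q - s| ->
    `|z| <= C * (C * P) * (C * Q) * h.
  by move=> P0 Q0 zk; apply: le_trans zk _; rewrite ler_wpM2l // !mulr_ge0.
have t2 : `|d (S `|q - s| (F s)) w1 - d (L s (F s)) (v s)|
    <= C * (C * C) * (C * C * h) + C * (C * C) * (C * C) * h.
  rewrite /w1 -(adjP dP bop).
  have -> : d (L q (S `|q - s| (F s))) (v q) - d (L s (F s)) (v s) =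
    d (L q (S `|q - s| (F s))) (v q - S `|q - s| (v s)) +
    (d (L q (S `|q - s| (F s))) (S `|q - s| (v s)) - d (L s (F s)) (v s)).
    by rewrite (ipBr dP); ring.
  apply: le_trans (ler_normD _ _) _; apply: lerD.
    by apply: ip_bound => //; apply: op_norm_le => //; apply: semigroup_norm_le => //; exact: bF.
  by apply: shr2 => //; apply: lq2; [exact: bF | exact: bv].
have t3 : `|d (S `|q - s| (G s)) (L q (S h (u p))) - d (L s (u s)) (G s)|
    <= C * C * (C * (C * (C * C * h))) + C * (C * C) * (C * C) * h.
  have Eh : S h (u p) = S `|q - s| (S `|s - p| (u p)) by rewrite -SD // -E.
  have -> : d (S `|q - s| (G s)) (L q (S h (u p))) - d (L s (u s)) (G s) =
    - d (S `|q - s| (G s)) (L q (S `|q - s| (u s - S `|s - p| (u p)))) +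
    (d (L q (S `|q - s| (u s))) (S `|q - s| (G s)) - d (L s (u s)) (G s)).
    rewrite Eh (linB (lS _ _)) ?normr_ge0 // (linB linL) (ipBr dP).
    by rewrite (ipC dP _ (L q (S _ (u s)))); ring.
  apply: le_trans (ler_normD _ _) _; apply: lerD.
    rewrite normrN; apply: ip_bound; first by apply: semigroup_norm_le => //; exact: bG.
    by apply: op_norm_le => //; apply: semigroup_norm_le.
  by apply: shr2 => //; apply: lq2; [exact: bu | exact: bG].
set a1 := d (N s (S _ _)) _ in t1 *; set a2 := d (S _ (F s)) _ in t2 *.
set a3 := d (S _ (G s)) _ in t3 *.
have -> : a1 + a2 + a3 - (d (N s (u s)) (v s) + d (L s (F s)) (v s) + d (L s (u s)) (G s)) =
  (a1 - d (N s (u s)) (v s)) + (a2 - d (L s (F s)) (v s)) + (a3 - d (L s (u s)) (G s)) by ring.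
apply: le_trans (ler_normD _ _) _; apply: le_trans (lerD (ler_normD _ _) (lexx _)) _.
apply: le_trans (lerD (lerD t1 t2) t3) _.
have k4 := ler_wpM2r h0 (C26 4%N isT); have k5 := ler_wpM2r h0 (C26 5%N isT).
rewrite -/h; move: k4 k5; rewrite !exprS expr0; lra.
Qed.

Section symmetric_semigroup.
Hypothesis S_sym : forall (t : R) x w, 0 <= t <= T -> d (S t x) w = d x (S t w).

(** Here u runs forward and v backward under the same self-adjoint semigroup, with which L
    commutes. No semigroup acts on the increments of L, so the error involves the moduli of
    continuity of u and v. *)
Lemma mixed_increment u v F G L W : mild true S u F -> mild false S v G ->
  (forall p q x w, 0 <= p -> p <= q -> q <= T ->
    integral_is `[p, q]%classic (fun s => d (W s x) w) (d (L p x) w - d (L q x) w)) ->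
  (forall t tau x, 0 <= t <= T -> 0 <= tau <= T -> L t (S tau x) = S tau (L t x)) ->
  op_family L -> op_family W -> bounded_by u -> bounded_by v -> bounded_by F -> bounded_by G ->
  forall p q, 0 <= p -> p <= q -> q <= T -> exists n,
    integral_is `[p, q]%classic n (d (L q (u q)) (v q) - d (L p (u p)) (v p)) /\
    forall s, p <= s <= q ->
      `|n s - (d (L s (F s)) (v s) - d (W s (u s)) (v s) - d (L s (u s)) (G s))|
        <= C ^+ 2 * (5 * C ^+ 3 * (q - p) + `|u q - u s| + `|v q - v s|).
Proof.
move=> mu mv hW comm LP WP bu bv bF bG p q p0 pq qT; have C0 : 0 <= C by exact: le_trans C1.
have [lS _ _ SD _] := SP.
have pT : 0 <= p <= T by rewrite p0 (le_trans pq).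
have qT' : 0 <= q <= T by rewrite (le_trans p0).
have [linL bL] := LP q qT'; have [linLp bLp] := LP p pT.
have bop : bounded_op (L q) by split => //; exists C.
pose h := q - p; have h0 : 0 <= h by rewrite subr_ge0.
have hT : 0 <= h <= T by rewrite h0 /h; lra.
have hull1 : hull p q = `[p, q]%classic by rewrite /hull min_l // max_r.
have hull2 : hull q p = `[p, q]%classic by rewrite /hull min_r // max_l.
have dqp : `|q - p| = h by rewrite ger0_norm.
have dpq : `|p - q| = h by rewrite distrC.
pose w1 := adj d (L q) (v q).
exists (fun s => d (S `|q - s| (F s)) w1 - d (W s (S h (u p))) (v q)
   - d (S `|p - s| (G s)) (L p (u p))); split.
  have mI := measurable_I p q.
  have i1 := mu p q w1 pT qT' pq; rewrite hull1 dqp in i1.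
  have i2 := mv q p (L p (u p)) qT' pT pq; rewrite hull2 dpq in i2.
  have := integral_isB mI (integral_isB mI i1 (hW p q (S h (u p)) (v q) p0 pq qT)) i2.
  rewrite /w1 -!(adjP dP bop) (comm p h) // [d (S h (v q)) _]S_sym //.
  rewrite ![d (v _) _](ipC dP) (ipC dP (S h _) (v q)).
  by congr integral_is; rewrite (ipC dP (v q) (S h _)); ring.
move=> s /andP[ps sq]; have sT : 0 <= s <= T by rewrite (le_trans p0) //= (le_trans sq).
have [linLs _] := LP s sT; have [linW _] := WP s sT.
have dqs : `|q - s| = q - s by rewrite ger0_norm // subr_ge0.
have dps : `|p - s| = s - p by rewrite distrC ger0_norm // subr_ge0.
have qsT : 0 <= q - s <= T by rewrite -dqs dist_le.
have psT : 0 <= s - p <= T by rewrite -dps dist_le.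
have hs1 : q - s <= h by rewrite /h; lra.
have hs2 : s - p <= h by rewrite /h; lra.
have up : `|u s - S (s - p) (u p)| <= C * C * h.
  have := mild_close mu bF pT sT ps; rewrite distrC in dps; rewrite dps => h1.
  by apply: le_trans h1 _; rewrite ler_wpM2l // mulr_ge0.
have uq : `|u q - S h (u p)| <= C * C * h.
  by have := mild_close mu bF pT qT' pq; rewrite dqp.
have vq : `|v s - S (q - s) (v q)| <= C * C * h.
  have := mild_close mv bG qT' sT sq; rewrite distrC in dqs; rewrite dqs => h1.
  by apply: le_trans h1 _; rewrite ler_wpM2l // mulr_ge0.
have Lclose a c x w P Q : 0 <= a -> a <= c -> c <= T -> c - a <= h ->
    `|x| <= P -> `|w| <= Q -> `|d (L a x) w - d (L c x) w| <= C * P * Q * h.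
  move=> a0 ac cT cah xP wQ.
  have P0 : 0 <= P by exact: le_trans xP. have Q0 : 0 <= Q by exact: le_trans wQ.
  apply: (@le_trans _ _ (C * P * Q * (c - a))); last by rewrite ler_wpM2l // !mulr_ge0.
  apply: integral_is_norm_le (hW a c x w a0 ac cT) => // t /andP[at0 tc].
  apply: ip_bound => //; apply: op_norm_le => //; rewrite (le_trans a0) //=; exact: le_trans cT.
have t1 : `|d (S `|q - s| (F s)) w1 - d (L s (F s)) (v s)|
    <= C * C * (C * C * h) + C * C * C * h.
  rewrite /w1 -(adjP dP bop) dqs comm // S_sym //.
  have -> : d (L q (F s)) (S (q - s) (v q)) - d (L s (F s)) (v s) =
    - (d (L q (F s)) (v s - S (q - s) (v q)) + (d (L s (F s)) (v s) - d (L q (F s)) (v s))).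
    by rewrite (ipBr dP); ring.
  rewrite normrN; apply: le_trans (ler_normD _ _) _; apply: lerD.
    by apply: ip_bound => //; apply: op_norm_le => //; exact: bF.
  by apply: Lclose; [case/andP: sT| | | |exact: bF|exact: bv].
have t3 : `|d (S `|p - s| (G s)) (L p (u p)) - d (L s (u s)) (G s)|
    <= C * (C * C * h) * C + C * C * C * h.
  rewrite dps S_sym // (ipC dP) -comm //.
  have -> : d (L p (S (s - p) (u p))) (G s) - d (L s (u s)) (G s) =
    - d (L p (u s - S (s - p) (u p))) (G s) + (d (L p (u s)) (G s) - d (L s (u s)) (G s)).
    by rewrite (linB linLp) (ipBl dP); ring.
  apply: le_trans (ler_normD _ _) _; apply: lerD.
    by rewrite normrN; apply: ip_bound; [exact: op_norm_le | exact: bG].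
  by apply: Lclose => //; [exact: le_trans qT | exact: bu | exact: bG].
have t2 : `|d (W s (S h (u p))) (v q) - d (W s (u s)) (v s)|
    <= C * (C * C * h) * C + C * `|u q - u s| * C + C * C * `|v q - v s|.
  have -> : d (W s (S h (u p))) (v q) - d (W s (u s)) (v s) =
    - d (W s (u q - S h (u p))) (v q) + d (W s (u q - u s)) (v q) + d (W s (u s)) (v q - v s).
    by rewrite !(linB linW) !(ipBl dP) (ipBr dP); ring.
  apply: le_trans (ler_normD _ _) _; apply: lerD; last first.
    by apply: ip_bound => //; apply: op_norm_le => //; exact: bu.
  apply: le_trans (ler_normD _ _) _; rewrite normrN.
  by apply: lerD; apply: ip_bound; rewrite ?bv //; exact: op_norm_le.
set a1 := d (S _ (F s)) _ in t1 *; set a2 := d (W s (S _ _)) _ in t2 *.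
set a3 := d (S _ (G s)) _ in t3 *.
have -> : a1 - a2 - a3 - (d (L s (F s)) (v s) - d (W s (u s)) (v s) - d (L s (u s)) (G s)) =
  (a1 - d (L s (F s)) (v s)) - (a2 - d (W s (u s)) (v s)) - (a3 - d (L s (u s)) (G s)) by ring.
apply: le_trans (ler_normB _ _) _; apply: le_trans (lerD (ler_normB _ _) (lexx _)) _.
apply: le_trans (lerD (lerD t1 t2) t3) _.
have k4 : C ^+ 3 * h <= C ^+ 5 * h by rewrite ler_wpM2r // ler_weXn2l.
have k5 : C ^+ 4 * h <= C ^+ 5 * h by rewrite ler_wpM2r // ler_weXn2l.
rewrite -/h; move: k4 k5; rewrite !exprS expr0; lra.
Qed.

End symmetric_semigroup.

End one_semigroup.

Lemma energy_almost_integral fw S u v F G L N : semigroup_on T C S ->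
  mild fw S u F -> mild fw S v G -> lyap fw S L N ->
  op_family L -> op_family N -> bounded_by u -> bounded_by v -> bounded_by F -> bounded_by G ->
  almost_integral T (fun t => d (L t (u t)) (v t))
    (fun s => (if fw then 1 else -1) * (d (N s (u s)) (v s) + d (L s (F s)) (v s) + d (L s (u s)) (G s))).
Proof.
move=> SP mu mv lL LP NP bu bv bF bG e e0; have C0 : 0 < C by exact: lt_le_trans C1.
have K0 : 0 < 6 * C ^+ 6 by rewrite mulr_gt0 // exprn_gt0.
exists (e / (6 * C ^+ 6)); first exact: divr_gt0.
move=> p q p0 pq qT; rewrite ltr_pdivlMr // mulrC => /ltW hpq.
have pT : 0 <= p <= T by rewrite p0 (le_trans pq).
have qT' : 0 <= q <= T by rewrite (le_trans p0).
have inc := energy_increment SP mu mv lL LP NP bu bv bF bG.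
case: fw inc {mu mv lL} => inc.
  have [n [n1 n2]] := inc p q pT qT' pq.
  rewrite /hull min_l // max_r // in n1 n2; exists n; split => // s /n2 h.
  by rewrite mul1r; apply: le_trans h _; rewrite ger0_norm // subr_ge0.
have [n [n1 n2]] := inc q p qT' pT pq.
rewrite /hull min_r // max_l // in n1 n2; exists (fun s => - n s); split.
  have := integral_isN (measurable_I _ _) n1; by rewrite opprB.
move=> s /n2 h; rewrite mulN1r -opprD normrN.
by apply: le_trans h _; rewrite distrC ger0_norm // subr_ge0.
Qed.

Lemma mixed_almost_integral S u v F G L W : semigroup_on T C S ->
  (forall (t : R) x w, 0 <= t <= T -> d (S t x) w = d x (S t w)) ->
  mild true S u F -> mild false S v G ->
  (forall p q x w, 0 <= p -> p <= q -> q <= T ->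
    integral_is `[p, q]%classic (fun s => d (W s x) w) (d (L p x) w - d (L q x) w)) ->
  (forall t tau x, 0 <= t <= T -> 0 <= tau <= T -> L t (S tau x) = S tau (L t x)) ->
  op_family L -> op_family W -> bounded_by u -> bounded_by v -> bounded_by F -> bounded_by G ->
  cont_on 0 T u -> cont_on 0 T v ->
  almost_integral T (fun t => d (L t (u t)) (v t))
    (fun s => d (L s (F s)) (v s) - d (W s (u s)) (v s) - d (L s (u s)) (G s)).
Proof.
move=> SP sym mu mv hW comm LP WP bu bv bF bG cu cv e e0; have C0 : 0 < C by exact: lt_le_trans C1.
pose e' := e / (C ^+ 2 * 3).
have e'0 : 0 < e' by rewrite divr_gt0 // mulr_gt0 // exprn_gt0.
have [r1 r10 h1] := unif_cont_on cu e'0; have [r2 r20 h2] := unif_cont_on cv e'0.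
have K0 : 0 < 5 * C ^+ 3 by rewrite mulr_gt0 // exprn_gt0.
exists (Num.min (e' / (5 * C ^+ 3)) (Num.min r1 r2)).
  by rewrite !lt_min r10 r20 divr_gt0.
move=> p q p0 pq qT; rewrite !lt_min => /andP[d0 /andP[d1 d2]].
have [n [n1 n2]] := mixed_increment SP sym mu mv hW comm LP WP bu bv bF bG p0 pq qT.
exists n; split => // s /[dup] spq /n2 h; apply: le_trans h _.
have /andP[ps sq] := spq.
have sT : 0 <= s <= T by rewrite (le_trans p0) //= (le_trans sq).
have qT' : 0 <= q <= T by rewrite (le_trans p0).
have dqs : `|q - s| = q - s by rewrite ger0_norm // subr_ge0.
have a1 : `|u q - u s| <= e' by apply: h1 => //; rewrite dqs; lra.
have a2 : `|v q - v s| <= e' by apply: h2 => //; rewrite dqs; lra.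
move: d0; rewrite ltr_pdivlMr // mulrC => /ltW d0.
have -> : e = C ^+ 2 * (e' + e' + e') by rewrite /e'; field; rewrite gt_eqF.
by rewrite ler_wpM2l ?exprn_ge0 ?(ltW C0) // !lerD.
Qed.

(** * Integral formulas anchored at one end of the interval *)

Lemma hull_from fw a p q f (c c' : R) : before fw a p -> before fw p q ->
  integral_is (hull a q) f c -> integral_is (hull a p) f c' ->
  integral_is (hull p q) f (c - c').
Proof.
rewrite /before /hull; case: fw => ap pq.
  rewrite !min_l ?max_r ?(le_trans ap pq) //; rewrite ?max_r ?(le_trans ap pq) //.
  exact: integral_is_tail.
rewrite !min_r ?max_l ?(le_trans pq ap) //; rewrite ?max_l ?(le_trans pq ap) //.
exact: integral_is_init.
Qed.

Lemma hull_to fw a p q f (c c' : R) : before fw p q -> before fw q a ->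
  integral_is (hull p a) f c -> integral_is (hull q a) f c' ->
  integral_is (hull p q) f (c - c').
Proof.
rewrite /before /hull; case: fw => pq qa.
  rewrite !min_l ?max_r ?(le_trans pq qa) //; rewrite ?max_r ?(le_trans pq qa) //.
  exact: integral_is_init.
rewrite !min_r ?max_l ?(le_trans qa pq) //; rewrite ?max_l ?(le_trans qa pq) //.
exact: integral_is_tail.
Qed.

(** The semigroup law moves the formula on the hull of a and p to time q, and subtracting it
    from the formula on the hull of a and q leaves the one between p and q. *)
Lemma mild_of_anchor fw S S' u F a x : semigroup_on T C S ->
  (forall (t : R) x w, 0 <= t -> d (S t x) w = d x (S' t w)) ->
  (forall t, 0 <= t <= T -> before fw a t) -> 0 <= a <= T ->
  (forall t w, 0 <= t <= T -> integral_is (hull a t) (fun s => d (S `|t - s| (F s)) w)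
     (d (u t) w - d (S `|t - a| x) w)) -> mild fw S u F.
Proof.
move=> [lS bS S0 SD _] dual aP aT h p q w pT qT pq.
have mI : measurable (hull a p : set (measurableTypeR R)) by exact: measurable_I.
have ap := aP p pT.
have n0 r r' : 0 <= `|r - r' : R| by exact: normr_ge0.
have h1 : integral_is (hull a p) (fun s => d (S `|q - s| (F s)) w)
    (d (S `|q - p| (u p)) w - d (S `|q - a| x) w).
  have := h p (S' `|q - p| w) pT; rewrite -!dual // -SD // -(dist_split ap pq).
  apply: integral_is_eq => // s; rewrite /hull /= in_itv /= => /(hullP ap)[_ sp _ _].
  by rewrite -dual // -SD // -(dist_split sp pq).
have := hull_from ap pq (h q w qT) h1; by congr integral_is; ring.
Qed.

Lemma lyap_of_anchor fw S L N a : semigroup_on T C S ->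
  (forall t, 0 <= t <= T -> before fw t a) ->
  (forall t x w, 0 <= t <= T ->
     integral_is (hull t a) (fun s => d (N s (S `|s - t| x)) (S `|s - t| w))
     (d (L a (S `|a - t| x)) (S `|a - t| w) - d (L t x) w)) -> lyap fw S L N.
Proof.
move=> [lS bS S0 SD _] aP h p q x w pT qT pq.
have mI : measurable (hull q a : set (measurableTypeR R)) by exact: measurable_I.
have qa := aP q qT.
have n0 r r' : 0 <= `|r - r' : R| by exact: normr_ge0.
have h1 : integral_is (hull q a) (fun s => d (N s (S `|s - p| x)) (S `|s - p| w))
    (d (L a (S `|a - p| x)) (S `|a - p| w) - d (L q (S `|q - p| x)) (S `|q - p| w)).
  have := h q (S `|q - p| x) (S `|q - p| w) qT; rewrite -!SD // -(dist_split pq qa).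
  apply: integral_is_eq => // s; rewrite /hull /= in_itv /= => /(hullP qa)[qs _ _ _].
  by rewrite -!SD // -(dist_split pq qs).
have := hull_to pq qa (h p x w pT) h1; by congr integral_is; ring.
Qed.

End energy.

(** * Directional derivatives *)

Section directional.
Context {R : realType}.
Implicit Types (U V W : normedModType R).

Definition dir_deriv {U V} (f : U -> V) (x v : U) (l : V) := forall e : R, 0 < e ->
  exists2 r : R, 0 < r & forall s : R, 0 < `|s| < r ->
    `|f (x + s *: v) - f x - s *: l| <= e * `|s|.

Lemma diff_dir_deriv {U V} (f : U -> V) x v : differentiable f x ->
  dir_deriv f x v ('d f x v).
Proof.
move=> df e e0.
have c : (fun h => h^-1 *: ((f \o shift x) (h *: v) - f x)) h @[h --> 0^'] --> 'd f x v.
  by rewrite -(deriveE v df); exact: diff_derivable.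
have /cvgrPdist_le/(_ e e0) := c.
rewrite /dnbhs near_withinE => /nbhs_ballP[r /= r0 hr]; exists r => // s /andP[s0 sr].
have sn0 : s != 0 by rewrite -normr_gt0.
have := hr s; rewrite -ball_normE /ball_ /= sub0r normrN => /(_ sr sn0) h.
have -> : f (x + s *: v) - f x - s *: 'd f x v =
    - (s *: ('d f x v - s^-1 *: (f (s *: v + x) - f x))).
  by rewrite scalerBr scalerA mulfV // scale1r opprB (addrC x).
by rewrite normrN normrZ mulrC ler_wpM2r.
Qed.

Lemma dir_deriv_uniq {U V} (f : U -> V) x v l l' :
  dir_deriv f x v l -> dir_deriv f x v l' -> l = l'.
Proof.
move=> h h'; apply/eqP; rewrite -subr_eq0 -normr_le0; apply/ler_addgt0Pr => e e0; rewrite add0r.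
have e2 : 0 < e / 2 by rewrite divr_gt0.
have [r r0 hr] := h _ e2; have [r' r0' hr'] := h' _ e2.
pose s := Num.min r r' / 2; have m0 : 0 < Num.min r r' by rewrite lt_min r0.
have s0 : 0 < s by rewrite divr_gt0.
have : s < Num.min r r' by rewrite /s; lra.
rewrite lt_min => /andP[s1 s2].
have := hr s; have := hr' s; rewrite gtr0_norm // s0 s1 s2 => /(_ isT) a /(_ isT) b.
rewrite -(ler_pM2l s0) -{1}(gtr0_norm s0) -normrZ.
have -> : s *: (l - l') = (f (x + s *: v) - f x - s *: l') - (f (x + s *: v) - f x - s *: l).
  by rewrite scalerBr opprB [RHS]addrC addrA subrK.
apply: le_trans (ler_normB _ _) _; apply: le_trans (lerD a b) _; lra.
Qed.

Lemma dir_deriv_lip {U V} (f : U -> V) x v l (L : R) : 0 <= L ->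
  (forall x', `|f x' - f x| <= L * `|x' - x|) -> dir_deriv f x v l -> `|l| <= L * `|v|.
Proof.
move=> L0 lip h; apply/ler_addgt0Pr => e e0; have [r r0 hr] := h e e0.
pose s := r / 2; have s0 : 0 < s by rewrite divr_gt0.
have := hr s; rewrite gtr0_norm // s0 => /(_ ltac:(rewrite /s /=; lra)) a.
have := lip (x + s *: v); rewrite addrAC subrr add0r normrZ gtr0_norm // => b.
rewrite -(ler_pM2l s0) -{1}(gtr0_norm s0) -normrZ.
have -> : s *: l = (f (x + s *: v) - f x) - (f (x + s *: v) - f x - s *: l).
  by rewrite opprB addrC subrK.
apply: le_trans (ler_normB _ _) _; apply: le_trans (lerD b a) _; lra.
Qed.

(** A vector-valued map obeys the mean value theorem after composition with a functional. *)
Lemma mvt_functional {U V} (f : U -> V) (phi : V -> R) (C : R) x v (D : U -> V) :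
  (forall (a : R) p q, phi (a *: p + q) = a * phi p + phi q) ->
  (forall w, `|phi w| <= C * `|w|) ->
  (forall c, dir_deriv f (x + c *: v) v (D (x + c *: v))) ->
  exists c : R, phi (f (x + v) - f x) = phi (D (x + c *: v)).
Proof.
move=> lphi bphi dD; pose k (s : R) : R := phi (f (x + s *: v)).
have phiB p q : phi (p - q) = phi p - phi q by rewrite -scaleN1r addrC lphi mulN1r addrC.
have phiZ (a : R) p : phi (a *: p) = a * phi p.
  by rewrite -[a *: p]addr0 lphi -(subrr 0) phiB subrr addr0.
have der c : is_derive (c : R) 1 k (phi (D (x + c *: v))).
  have cv : (fun h => h^-1 *: ((k \o shift c) (h *: 1) - k c)) h @[h --> (0 : R)^'] -->
      phi (D (x + c *: v)).
    apply/cvgrPdist_le => e e0; have C1 : 0 < `|C| + 1 by rewrite ltr_wpDl.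
    have [r r0 hr] := dD c _ (divr_gt0 e0 C1).
    rewrite /dnbhs near_withinE; apply/nbhs_ballP; exists r => //= s.
    rewrite -ball_normE /ball_ /= sub0r normrN => sr sn0.
    have ns : 0 < `|s| by rewrite normr_gt0.
    have := hr s; rewrite ns sr => /(_ isT) hs.
    rewrite /k /shift /= /GRing.scale /= mulr1 -(ler_pM2l ns) -normrM.
    have -> : s * (phi (D (x + c *: v)) - s^-1 * (phi (f (x + (s + c) *: v)) - phi (f (x + c *: v))))
       = - phi (f (x + c *: v + s *: v) - f (x + c *: v) - s *: D (x + c *: v)).
      rewrite !phiB phiZ mulrBr mulrA mulfV // mul1r scalerDl (addrC (s *: v)) addrA; ring.
    rewrite normrN; apply: le_trans (bphi _) _.
    apply: (@le_trans _ _ ((`|C| + 1) * (e / (`|C| + 1) * `|s|))).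
      apply: le_trans (ler_wpM2l (ltW C1) hs).
      by rewrite ler_wpM2r // (le_trans (ler_norm C)) // lerDl.
    by rewrite mulrA mulrCA mulfV ?gt_eqF // mulr1 mulrC.
  by apply: DeriveDef; [apply/cvg_ex; eexists; exact: cv | exact: cvg_lim cv].
have [|c _ E] := @MVT_segment R k (fun c => phi (D (x + c *: v))) 0 1 ler01 (fun c _ => der c).
  apply: derivable_within_continuous => z _; by have [] := der z.
exists c; move: E; rewrite /k scale1r scale0r addr0 subr0 mulr1 => <-.
by rewrite phiB.
Qed.

End directional.
Section partial_derivatives.
Context {R : realType} {X : normedModType R}.

Lemma differentiable_fst {U V : normedModType R} (z : U * V) : differentiable (fst : U * V -> U) z.
Proof.
apply: (@linear_differentiable _ _ _ (GRing.Linear.clone _ _ _ _ (fst : U * V -> U) _)).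
by move=> ?; exact: cvg_fst.
Qed.

Lemma differentiable_snd {U V : normedModType R} (z : U * V) : differentiable (snd : U * V -> V) z.
Proof.
apply: (@linear_differentiable _ _ _ (GRing.Linear.clone _ _ _ _ (snd : U * V -> V) _)).
by move=> ?; exact: cvg_snd.
Qed.

Lemma differentiable_pairl (y psi : X) : differentiable (fun y' : X => (y', psi)) y.
Proof.
apply: (@differentiable_pair _ _ _ _ id (fun=> psi)) => //; exact: differentiable_cst.
Qed.

Lemma differentiable_pairr (y psi : X) : differentiable (fun p' : X => (y, p')) psi.
Proof.
apply: (@differentiable_pair _ _ _ _ (fun=> y) id) => //; exact: differentiable_cst.
Qed.

Lemma partial_diff {V : normedModType R} (F : X * X -> V) y psi eta zeta :
  differentiable F (y, psi) ->
  'd F (y, psi) (eta, zeta) = 'd (fun y' => F (y', psi)) y eta + 'd (fun p' => F (y, p')) psi zeta.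
Proof.
move=> dF.
have d1 : differentiable (fun y' => F (y', psi)) y.
  apply: (@differentiable_comp _ _ _ _ (fun y' => (y', psi)) F); [exact: differentiable_pairl | exact: dF].
have d2 : differentiable (fun p' => F (y, p')) psi.
  apply: (@differentiable_comp _ _ _ _ (fun p' => (y, p')) F); [exact: differentiable_pairr | exact: dF].
have e1 : 'd (fun y' => F (y', psi)) y eta = 'd F (y, psi) (eta, 0).
  apply: (dir_deriv_uniq (diff_dir_deriv _ d1)) => e e0.
  have [r r0 hr] := diff_dir_deriv (eta, 0) dF e0; exists r => // s /hr.
  by have -> : (y, psi) + s *: (eta, 0) = (y + s *: eta, psi)
    by [congr (_, _); rewrite /= scaler0 addr0].
have e2 : 'd (fun p' => F (y, p')) psi zeta = 'd F (y, psi) (0, zeta).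
  apply: (dir_deriv_uniq (diff_dir_deriv _ d2)) => e e0.
  have [r r0 hr] := diff_dir_deriv (0, zeta) dF e0; exists r => // s /hr.
  by have -> : (y, psi) + s *: (0, zeta) = (y, psi + s *: zeta)
    by [congr (_, _); rewrite /= scaler0 addr0].
rewrite e1 e2 -linearD; congr ('d _ _ _); congr (_, _); by rewrite /= ?addr0 ?add0r.
Qed.

Section coefficients.
Variables (b g : R -> X -> X -> X) (h : X -> X) (t : R).
Hypothesis cd : continuously_differentiable (Defs.coef_map b g h t).

Lemma b_differentiable z : differentiable (fun z => b t z.1 z.2) z.
Proof.
apply: (@differentiable_comp _ _ _ _ (Defs.coef_map b g h t) (fst \o fst)); first exact: cd.1.
by apply: differentiable_comp; exact: differentiable_fst.
Qed.

Lemma g_differentiable z : differentiable (fun z => g t z.1 z.2) z.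
Proof.
apply: (@differentiable_comp _ _ _ _ (Defs.coef_map b g h t) (snd \o fst)); first exact: cd.1.
by apply: differentiable_comp; [exact: differentiable_fst | exact: differentiable_snd].
Qed.

Lemma h_differentiable y : differentiable h y.
Proof.
apply: (@differentiable_comp _ _ _ _ (fun y => Defs.coef_map b g h t (y, 0)) snd).
  apply: (@differentiable_comp _ _ _ _ (fun y : X => (y, 0)) (Defs.coef_map b g h t)).
    exact: differentiable_pairl.
  exact: cd.1.
exact: differentiable_snd.
Qed.

Lemma b_dir_deriv z v : dir_deriv (fun z => b t z.1 z.2) z v
  (d_y b t z.1 z.2 v.1 + d_psi b t z.1 z.2 v.2).
Proof.
case: z v => y psi [eta zeta]; have dF := b_differentiable (y, psi).
by have := diff_dir_deriv (eta, zeta) dF; rewrite partial_diff.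
Qed.

Lemma g_dir_deriv z v : dir_deriv (fun z => g t z.1 z.2) z v
  (d_y g t z.1 z.2 v.1 + d_psi g t z.1 z.2 v.2).
Proof.
case: z v => y psi [eta zeta]; have dF := g_differentiable (y, psi).
by have := diff_dir_deriv (eta, zeta) dF; rewrite partial_diff.
Qed.

End coefficients.

Lemma partial_bounds (f : X -> X -> X) (L : R) y psi : 0 <= L ->
  differentiable (fun z : X * X => f z.1 z.2) (y, psi) ->
  (forall y psi y' psi', `|f y psi - f y' psi'| <= L * `|y - y'| + L * `|psi - psi'|) ->
  (forall eta, `|'d (fun y' => f y' psi) y eta| <= L * `|eta|) /\
  (forall zeta, `|'d (fun p' => f y p') psi zeta| <= L * `|zeta|).
Proof.
move=> L0 dF lip; split => eta.
  apply: (@dir_deriv_lip _ _ _ (fun y' => f y' psi) y eta) => //.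
    by move=> x'; have := lip x' psi y psi; rewrite subrr normr0 mulr0 addr0.
  apply: diff_dir_deriv.
  apply: (@differentiable_comp _ _ _ _ (fun y' => (y', psi)) (fun z : X * X => f z.1 z.2)).
    exact: differentiable_pairl.
  exact: dF.
apply: (@dir_deriv_lip _ _ _ (fun p' => f y p') psi eta) => //.
  by move=> x'; have := lip y x' y psi; rewrite subrr normr0 mulr0 add0r.
apply: diff_dir_deriv.
apply: (@differentiable_comp _ _ _ _ (fun p' => (y, p')) (fun z : X * X => f z.1 z.2)).
  exact: differentiable_pairr.
exact: dF.
Qed.

End partial_derivatives.

(** * Lyapunov conditions on increments *)

Section lyapunov_pointwise.
Context {R : realType} {X : completeNormedModType R} {d : X -> X -> R}.
Hypothesis dP : inner_product d.

(** For fixed e the left-hand side is affine in w, so it lets a functional see the square of the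
    excess of |w| over c; e is chosen to make it as large as possible. *)
Lemma test_vector (w : X) (c : R) : 0 <= c -> exists e : X,
  2 * d w e - `|e| ^+ 2 - 2 * c * `|e| = Num.max 0 (`|w| - c) ^+ 2.
Proof.
move=> c0; have [h|h] := leP (`|w| - c) 0.
  by exists 0; rewrite (ip0r dP) normr0 !(mulr0, expr0n) !subr0.
have w0 : 0 < `|w| by rewrite (le_lt_trans c0) // -subr_gt0.
exists (((`|w| - c) / `|w|) *: w); rewrite (ipZr dP) (ipxx dP) normrZ ger0_norm; last first.
  by rewrite divr_ge0 // ltW.
by field; rewrite gt_eqF.
Qed.

Lemma adj_bounded (f : X -> X) (C : R) : linear f -> (forall x, `|f x| <= C * `|x|) ->
  linear (adj d f) /\ forall x, `|adj d f x| <= C * `|x|.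
Proof.
move=> lf fC; have bf : bounded_op f by split => //; exists C.
have [C0|C0] := leP 0 C; last first.
  have z x : x = 0 :> X.
    apply/eqP; rewrite -normr_le0; have := le_trans (normr_ge0 _) (fC x).
    by rewrite nmulr_rge0.
  split => [a u v|x]; first by rewrite !(z (adj d f _)) scaler0 addr0.
  by rewrite [adj _ _ _]z [x]z normr0 mulr0.
have adjE := adjP dP bf.
split=> [a u v|x].
  apply: (ip_ext dP) => w; rewrite (ipC dP) -adjE !(ipDl dP, ipDr dP) !(ipZl dP, ipZr dP).
  by rewrite !adjE !(ipC dP w).
apply: (norm_le_ip dP); first by rewrite mulr_ge0.
move=> w; rewrite (ipC dP) -adjE; apply: le_trans (ip_le dP _ _) _.
by rewrite mulrAC ler_wpM2r.
Qed.

Lemma adj_bounded_op (f : X -> X) : bounded_op f -> bounded_op (adj d f).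
Proof. by move=> [lf [C fC]]; have [l b] := adj_bounded lf fC; split => //; exists C. Qed.

Lemma pdotC (z w : X * X) : pdot d z w = pdot d w z.
Proof. by rewrite /pdot !(ipC dP w.1) (ipC dP w.2). Qed.

Lemma pdotDl (z w v : X * X) : pdot d (z + w) v = pdot d z v + pdot d w v.
Proof. by rewrite /pdot /= !(ipDl dP); ring. Qed.
Lemma pdotNl (z v : X * X) : pdot d (- z) v = - pdot d z v.
Proof. by rewrite /pdot /= !(ipNl dP); ring. Qed.
Lemma pdotZl a (z v : X * X) : pdot d (a *: z) v = a * pdot d z v.
Proof. by rewrite /pdot /= !(ipZl dP); ring. Qed.
Lemma pdotDr (z w v : X * X) : pdot d v (z + w) = pdot d v z + pdot d v w.
Proof. by rewrite !(pdotC v) pdotDl. Qed.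

Lemma adj_pdotP (f f' : X * X -> X * X) :
  (forall u v, pdot d (f u) v = pdot d u (f' v)) ->
  forall u v, pdot d (f u) v = pdot d u (adj (pdot d) f v).
Proof.
move=> h u v; rewrite /adj; case: xgetP => [w _ hw|/(_ (f' v)) []]; first exact: hw.
by move=> /= ?; exact: h.
Qed.

Lemma adj_blockop (L11 L12 L21 L22 : X -> X) : bounded_op L11 -> bounded_op L12 ->
  bounded_op L21 -> bounded_op L22 -> forall u v,
  pdot d (blockop L11 L12 L21 L22 u) v =
  pdot d u (adj (pdot d) (blockop L11 L12 L21 L22) v).
Proof.
move=> h11 h12 h21 h22; apply: (adj_pdotP
  (f' := blockop (adj d L11) (adj d L21) (adj d L12) (adj d L22))) => u v.
rewrite /pdot /= !(ipDl dP) !(ipDr dP) (adjP dP h11) (adjP dP h12) (adjP dP h21) (adjP dP h22).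
ring.
Qed.

Lemma bounded_op0 : bounded_op (0 : X -> X).
Proof.
split; first by move=> a u v; rewrite /= scaler0 addr0.
by exists 0 => x; rewrite /= normr0 mul0r.
Qed.

Lemma bounded_opN (f : X -> X) : bounded_op f -> bounded_op (- f).
Proof.
move=> [lf [C fC]]; split; last by exists C => x; rewrite normrN.
by move=> a u v; rewrite /= opprfctE lf opprD scalerN.
Qed.

Lemma young u v : 2 * d u v <= `|u| ^+ 2 + `|v| ^+ 2.
Proof.
have := sqr_ge0 `|u - v|; rewrite -(ipxx dP (u - v)) (ipBl dP) !(ipBr dP) (ipC dP v u).
rewrite (ipxx dP u) (ipxx dP v).
by move: (d u v) (`|u| ^+ 2) (`|v| ^+ 2) => p q r; lra.
Qed.

Section data.
Variables (b g : R -> X -> X -> X) (h : X -> X) (T : R).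
Variables (Pi : R -> X * X -> X * X) (M Mb Theta Q0 Qb : R -> X -> X).

(** The part of the quadratic form of the running condition that the coefficients b and g do not
    enter. *)
Definition rest t z := 2 * pdot d (Pi t z) (MM d M Mb t z) - pdot d (QQ d Theta Q0 Qb t z) z.

(** The running conditions of both types at once, on the vectors (z, 0): m1 weighs the
    derivative of g in y and m2 that of b in psi. Type I gives m2 = 0 and type II gives m1 = 0. *)
Definition running (m1 m2 : R) := forall t y psi rho z, 0 <= t <= T -> 0 <= rho <= 1 ->
  2 * rho * pdot d (Pi t z) (BB b g t y psi z) + rest t z
    + m1 * `|d_y g t y psi z.1| ^+ 2 + m2 * `|d_psi b t y psi z.2| ^+ 2 <= 0.

(** The terminal conditions of both types at once; type II gives m1 = 0. *)
Definition terminal (m1 K : R) := forall y rho eta h0, 0 <= rho <= 1 ->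
  0 <= pdot d (Pi T (eta, rho *: d_h h y eta + h0)) (eta, rho *: d_h h y eta + h0)
       - m1 * `|d_h h y eta| ^+ 2 + K * `|h0| ^+ 2.

Hypothesis G2P : G2 T b g h.
Hypothesis G3P : G3 T b g h.
Hypothesis saP : strongly_continuous_sa T d Pi.
Hypotheses (mM : bounded_measurable T M) (mMb : bounded_measurable T Mb).

Lemma linear_diff (f : X -> X) (x : X) : linear ('d f x : X -> X).
Proof. by move=> a u v; rewrite linearP. Qed.

Lemma bounded_measurable_op (N : R -> X -> X) t : bounded_measurable T N -> 0 <= t <= T ->
  bounded_op (N t).
Proof. by move=> [lN [C hC] _] tT; split; [exact: lN | exists C => x; exact: hC]. Qed.

Lemma d_bounded t y psi : 0 <= t <= T ->
  [/\ bounded_op (d_y b t y psi), bounded_op (d_psi b t y psi),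
      bounded_op (d_y g t y psi) & bounded_op (d_psi g t y psi)].
Proof.
move=> tT; have [_ [L [L0 _ lb lg _]]] := G2P; have [_ _ /(_ t tT) cd] := G3P.
have [b1 b2] := partial_bounds (ltW L0) (b_differentiable cd (y, psi))
   (fun y p y' p' => lb t y p y' p' tT).
have [g1 g2] := partial_bounds (ltW L0) (g_differentiable cd (y, psi))
   (fun y p y' p' => lg t y p y' p' tT).
exact: (And4 (conj (linear_diff (fun y' => b t y' psi) y) (ex_intro _ L b1))
  (conj (linear_diff (fun p' => b t y p') psi) (ex_intro _ L b2))
  (conj (linear_diff (fun y' => g t y' psi) y) (ex_intro _ L g1))
  (conj (linear_diff (fun p' => g t y p') psi) (ex_intro _ L g2))).
Qed.

Lemma dh_bounded y : 0 <= T -> bounded_op (d_h h y).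
Proof.
move=> T0; have [_ [L [L0 _ _ _ lh]]] := G2P; have [_ _ cd] := G3P.
have {}cd := cd 0 _; rewrite lexx T0 in cd; have {}cd := cd isT.
split; first exact: linear_diff.
exists L => x; apply: (dir_deriv_lip (f := h) (x := y)) (ltW L0) _ _; first by move=> x'; exact: lh.
exact: diff_dir_deriv (h_differentiable cd y).
Qed.

Lemma running_core K E m1 m2 :
  lyapunov_running T d b g M Mb Theta Q0 Qb E K Pi ->
  (forall t y psi z, 0 <= t <= T -> pdot d (E t y psi z) z =
     m1 * `|d_y g t y psi z.1| ^+ 2 + m2 * `|d_psi b t y psi z.2| ^+ 2) ->
  running m1 m2.
Proof.
move=> run EE t y psi rho z tT rT; have := run t y psi rho tT rT (z, 0).
have [[lPi _] sPi] := saP.1 t tT.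
have [by_ bp gy gp] := d_bounded y psi tT.
have bM := bounded_measurable_op mM tT.
have bMb := bounded_opN (adj_bounded_op (bounded_measurable_op mMb tT)).
set A := (_ - _ + _ : X * X -> X * X).
have -> : pdot (pdot d) (blockop A (Pi t) (Pi t) (- K *: idfun) (z, 0)) (z, 0) = pdot d (A z) z.
  have lPi0 : Pi t 0 = 0 by exact: lin0 lPi.
  by rewrite /pdot /blockop /= lPi0 !(ip0r dP) !addr0.
have -> : A z = rho *: (Pi t (BB b g t y psi z) + adj (pdot d) (BB b g t y psi) (Pi t z))
   + Pi t (MM d M Mb t z) + adj (pdot d) (MM d M Mb t) (Pi t z)
   - QQ d Theta Q0 Qb t z + E t y psi z by [].
rewrite !(pdotDl, pdotNl, pdotZl) EE //.
have BE : pdot d (adj (pdot d) (BB b g t y psi) (Pi t z)) z = pdot d (Pi t z) (BB b g t y psi z).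
  rewrite pdotC -adj_blockop //; [exact: pdotC|exact: bounded_opN|exact: bounded_opN].
have ME : pdot d (adj (pdot d) (MM d M Mb t) (Pi t z)) z = pdot d (Pi t z) (MM d M Mb t z).
  by rewrite pdotC -adj_blockop //; [exact: pdotC|exact: bounded_op0|exact: bounded_op0].
have sw w : pdot d (Pi t w) z = pdot d (Pi t z) w by rewrite sPi pdotC.
rewrite BE ME !sw /rest => hh; apply: le_trans hh; rewrite le_eqVlt; apply/orP; left; apply/eqP; ring.
Qed.

Lemma running_I mu K : lyapunov_running T d b g M Mb Theta Q0 Qb
    (fun t y psi => mu *: blockop (adj d (d_y g t y psi) \o d_y g t y psi) 0 0 0) K Pi ->
  running mu 0.
Proof.
move=> run; apply: (running_core run) => t y psi z tT; have [_ _ gy _] := d_bounded y psi tT.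
rewrite mul0r addr0 -(ipxx dP) [in RHS](adjP dP gy) (ipC dP) /pdot /=.
by rewrite -[LHS]/(d (mu *: (_ + 0)) z.1 + d (mu *: (0 + 0)) z.2) addr0 addr0 scaler0 (ip0l dP) addr0 (ipZl dP).
Qed.

Lemma running_II mu K : lyapunov_running T d b g M Mb Theta Q0 Qb
    (fun t y psi => mu *: blockop 0 0 0 (adj d (d_psi b t y psi) \o d_psi b t y psi)) K Pi ->
  running 0 mu.
Proof.
move=> run; apply: (running_core run) => t y psi z tT; have [_ bp _ _] := d_bounded y psi tT.
rewrite mul0r add0r -(ipxx dP) [in RHS](adjP dP bp) (ipC dP) /pdot /=.
by rewrite -[LHS]/(d (mu *: (0 + 0)) z.1 + d (mu *: (0 + _)) z.2) addr0 add0r scaler0 (ip0l dP) add0r (ipZl dP).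
Qed.

Lemma terminal_core K m1 (D : X -> X * X -> X * X) : 0 <= T ->
  lyapunov_terminal d h D (Pi T) ->
  (forall y eta h0, pdot d (D y (eta, h0)) (eta, h0) =
     - (m1 * `|d_h h y eta| ^+ 2) + K * `|h0| ^+ 2) -> terminal m1 K.
Proof.
move=> T0 ter DE y rho eta h0 rT; have := ter y rho rT (eta, h0).
have bh := dh_bounded y T0.
set f := (_ \o _ : X * X -> X * X).
rewrite -[(f + D y) _]/(f (eta, h0) + D y (eta, h0)) pdotDl DE addrA.
suff -> : pdot d (f (eta, h0)) (eta, h0) =
  pdot d (Pi T (eta, rho *: d_h h y eta + h0)) (eta, rho *: d_h h y eta + h0) by [].
rewrite /f [(_ \o _) (eta, h0)]/=.
have -> : blockop idfun 0 (rho *: d_h h y) idfun (eta, h0) = (eta, rho *: d_h h y eta + h0).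
  by rewrite /blockop /= -[0 h0]/(0 : X) addr0.
set v := (eta, _); set w := Pi T v.
rewrite /pdot /=.
rewrite -[LHS]/(d (w.1 + rho *: adj d (d_h h y) w.2) eta + d (0 + w.2) h0).
rewrite add0r (ipDl dP) (ipZl dP) (ipDr dP) (ipZr dP) (ipC dP (adj _ _ _)) -(adjP dP bh).
by rewrite (ipC dP (d_h h y eta)); ring.
Qed.

Lemma terminal_I mu K : 0 <= T -> lyapunov_terminal d h
   (fun y => blockop ((- mu) *: (adj d (d_h h y) \o d_h h y)) 0 0 (K *: idfun)) (Pi T) ->
  terminal mu K.
Proof.
move=> T0 ter; apply: (terminal_core T0 ter) => y eta h0; have bh := dh_bounded y T0.
rewrite /pdot -[LHS]/(d ((- mu) *: adj d (d_h h y) (d_h h y eta) + 0) eta + d (0 + K *: h0) h0).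
rewrite addr0 add0r !(ipZl dP) (ipC dP (adj _ _ _)) -(adjP dP bh) !(ipxx dP); ring.
Qed.

Lemma terminal_II K : 0 <= T ->
  lyapunov_terminal d h (fun=> blockop 0 0 0 (K *: idfun)) (Pi T) -> terminal 0 K.
Proof.
move=> T0 ter; apply: (terminal_core T0 ter) => y eta h0.
rewrite /pdot -[LHS]/(d (0 + 0) eta + d (0 + K *: h0) h0).
by rewrite addr0 add0r (ip0l dP) (ipZl dP) (ipxx dP) mul0r oppr0.
Qed.

(** The running condition constrains derivatives. The mean value theorem along the segment, for
    the pairing of (b, -g) with Pi z plus test vectors that recover the norms of the increments
    of g and b, turns it into a condition on increments. *)
Lemma running_increment m1 m2 L : 0 <= m1 -> 0 <= m2 -> 0 <= L -> running m1 m2 ->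
  (forall t y psi y' psi', 0 <= t <= T ->
      `|b t y psi - b t y' psi'| <= L * `|y - y'| + L * `|psi - psi'|) ->
  (forall t y psi y' psi', 0 <= t <= T ->
      `|g t y psi - g t y' psi'| <= L * `|y - y'| + L * `|psi - psi'|) ->
  forall t rho y psi eta zeta (z := (eta, zeta)), 0 <= t <= T -> 0 <= rho <= 1 ->
  forall Db Dg, Db = b t (y + eta) (psi + zeta) - b t y psi ->
  Dg = g t (y + eta) (psi + zeta) - g t y psi ->
  2 * rho * pdot d (Pi t z) (Db, - Dg) + rest t z
    + m1 * Num.max 0 (`|Dg| - L * `|zeta|) ^+ 2
    + m2 * Num.max 0 (`|Db| - L * `|eta|) ^+ 2 <= 0.
Proof.
move=> m10 m20 L0 run lb lg t rho y psi eta zeta z tT rT Db Dg DbE DgE.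
have [_ _ /(_ t tT) cd] := G3P.
have [e1 he1] := test_vector Dg (mulr_ge0 L0 (normr_ge0 zeta)).
have [e2 he2] := test_vector Db (mulr_ge0 L0 (normr_ge0 eta)).
rewrite -he1 -he2.
pose p1 := (Pi t z).1; pose p2 := (Pi t z).2.
pose l1 := 2 * rho *: p1 + 2 * m2 *: e2; pose l2 := 2 * m1 *: e1 - 2 * rho *: p2.
pose phi (p : X * X) := d p.1 l1 + d p.2 l2.
pose F (w : X * X) : X * X := (b t w.1 w.2, g t w.1 w.2).
pose D (w : X * X) : X * X := (d_y b t w.1 w.2 z.1 + d_psi b t w.1 w.2 z.2,
                      d_y g t w.1 w.2 z.1 + d_psi g t w.1 w.2 z.2).
have [|p|c|c E] := @mvt_functional _ _ _ F phi (`|l1| + `|l2|) (y, psi) z D.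
- by move=> a p q; rewrite /phi /= !(ipDl dP) !(ipZl dP); ring.
- rewrite /phi; apply: le_trans (ler_normD _ _) _; rewrite mulrDl.
  have n1 : `|p.1| <= `|p| by rewrite prod_normE le_max lexx.
  have n2 : `|p.2| <= `|p| by rewrite prod_normE le_max lexx orbT.
  apply: lerD; apply: le_trans (CauchySchwarz dP _ _) _; by rewrite mulrC ler_wpM2l.
- move=> e e0; set w := (y, psi) + c *: z.
  have [r1 r10 h1] := b_dir_deriv cd w z e0; have [r2 r20 h2] := g_dir_deriv cd w z e0.
  exists (Num.min r1 r2); first by rewrite lt_min r10.
  move=> s; rewrite lt_min => /andP[s0 /andP[s1 s2]].
  rewrite prod_normE ge_max; apply/andP; split; [apply: h1|apply: h2]; by rewrite s0.
set w := (y, psi) + c *: z in E.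
have phiDelta : phi (F ((y, psi) + z) - F (y, psi)) = d Db l1 + d Dg l2 by rewrite DbE DgE.
rewrite phiDelta {phiDelta} /phi /D /= in E.
have := run t w.1 w.2 rho z tT rT.
have [by_ bp gy gp] := d_bounded w.1 w.2 tT.
have [b1 b2] := partial_bounds L0 (b_differentiable cd (w.1, w.2))
   (fun y p y' p' => lb t y p y' p' tT).
have [g1 g2] := partial_bounds L0 (g_differentiable cd (w.1, w.2))
   (fun y p y' p' => lg t y p y' p' tT).
have {}b1 : `|d_y b t w.1 w.2 eta| <= L * `|eta| := b1 eta.
have {}g2 : `|d_psi g t w.1 w.2 zeta| <= L * `|zeta| := g2 zeta.
rewrite /pdot /BB /blockop /=.
rewrite -[(- d_y g t w.1 w.2) eta]/(- (d_y g t w.1 w.2 eta)).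
rewrite -[(- d_psi g t w.1 w.2) zeta]/(- (d_psi g t w.1 w.2 zeta)).
rewrite -/p1 -/p2.
move: E b1 g2; rewrite /l1 /l2.
move: (d_y b t w.1 w.2 eta) (d_psi b t w.1 w.2 zeta) => by1 bp1.
move: (d_y g t w.1 w.2 eta) (d_psi g t w.1 w.2 zeta) => gy1 gp1.
move: (rest t z) => rt; rewrite !(ipDl dP, ipDr dP) !(ipNl dP, ipNr dP) !(ipZl dP, ipZr dP).
move=> E b1 g2.
have q1 := young gy1 e1.
have q2 := young bp1 e2.
have q3 : d gp1 e1 <= L * `|zeta| * `|e1|.
  by apply: le_trans (ip_le dP _ _) _; rewrite ler_wpM2r.
have q4 : d by1 e2 <= L * `|eta| * `|e2|.
  by apply: le_trans (ip_le dP _ _) _; rewrite ler_wpM2r.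
move: E; rewrite (ipC dP _ p1) (ipC dP Dg p2) (ipC dP by1 p1) (ipC dP bp1 p1).
rewrite (ipC dP gy1 p2) (ipC dP gp1 p2) => E.
have r1 := ler_wpM2l m10 (lerD q1 (lerD q3 q3)).
have r2 := ler_wpM2l m20 (lerD q2 (lerD q4 q4)).
rewrite -subr_le0 in r1; rewrite -subr_le0 in r2.
move: E => /eqP; rewrite -subr_eq0 => /eqP E hrun.
have := lerD hrun (lerD r1 r2); rewrite !addr0.
rewrite -[X in X <= 0 -> _]addr0 -E => hh; apply: le_trans hh; rewrite le_eqVlt; apply/orP; left.
apply/eqP; ring.
Qed.

(** Where the lower right block of Pi T is nonpositive, the terminal quadratic form is concave
    in its second argument, so the tangent at the increment of h dominates it; the mean value
    theorem then replaces the derivative of h by its increment. *)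
Lemma terminal_increment m1 K : 0 <= T -> 0 <= m1 -> terminal m1 K ->
  (forall w, d (Pi T (0, w)).2 w <= 0) ->
  forall rho y eta h0, 0 <= rho <= 1 ->
  forall Dh, Dh = h (y + eta) - h y ->
  m1 * `|Dh| ^+ 2 - K * `|h0| ^+ 2 <= pdot d (Pi T (eta, rho *: Dh + h0)) (eta, rho *: Dh + h0).
Proof.
move=> T0 m10 ter hconc rho y eta h0 rT Dh DhE.
have T00 : 0 <= T <= T by rewrite T0 lexx.
have [[lPi _] sPi] := saP.1 T T00.
have [_ _ cd] := G3P; have {}cd := cd 0 _; rewrite lexx T0 in cd; have {}cd := cd isT.
pose c := (Pi T (eta, rho *: Dh + h0)).2.
pose l := 2 * m1 *: Dh - 2 * rho *: c.
have [|p|r|r E] := @mvt_functional _ _ _ h (fun p => d p l) `|l| y eta (fun y => d_h h y eta).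
- by move=> a p q; rewrite (ipDl dP) (ipZl dP).
- by rewrite mulrC (CauchySchwarz dP).
- exact: diff_dir_deriv (h_differentiable cd _).
set H := d_h h _ eta in E.
have := ter (y + r *: eta) rho eta h0 rT; rewrite -/H.
pose v0 : X * X := (eta, rho *: Dh + h0); pose dl : X * X := (0, rho *: (H - Dh)).
have -> : (eta, rho *: H + h0) = v0 + dl :> X * X.
  congr (_, _); rewrite /= ?addr0 // scalerBr; by rewrite addrAC addrCA addrA addrK addrC.
rewrite -/v0 (linD lPi) !(pdotDl, pdotDr).
have -> : pdot d (Pi T dl) v0 = pdot d (Pi T v0) dl by rewrite sPi pdotC.
have -> : pdot d (Pi T v0) dl = rho * (d c H - d c Dh).
  by rewrite /pdot /= (ip0r dP) add0r (ipZr dP) (ipBr dP).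
have hc : pdot d (Pi T dl) dl <= 0.
  by rewrite /pdot /= (ip0r dP) add0r; exact: hconc.
move: E; rewrite -DhE /l !(ipBr dP) !(ipZr dP) (ipxx dP) (ipC dP Dh c) (ipC dP H c) => E.
have := sqr_ge0 `|H - Dh|; rewrite -(ipxx dP (H - Dh)) !(ipBl dP) !(ipBr dP) !(ipxx dP) (ipC dP Dh) => sq.
have := mulr_ge0 m10 sq; lra.
Qed.

End data.

End lyapunov_pointwise.

(** * The blocks of the Lyapunov operator *)

Section blocks.
Context {R : realType} {X : completeNormedModType R} {d : X -> X -> R}.
Hypothesis dP : inner_product d.
Variables (T : R) (Pi : R -> X * X -> X * X).
Hypothesis saP : strongly_continuous_sa T d Pi.

Lemma pair_normE {U V : normedModType R} (z : U * V) : `|z| = Num.max `|z.1| `|z.2|.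
Proof. by rewrite prod_normE. Qed.

(** Each orbit t |-> Pi t z is bounded by continuity, and the uniform boundedness principle is
    applied to the restrictions of Pi t to the two factors of X * X. *)
Lemma Pi_bounded : exists C : R, forall t z, 0 <= t <= T -> `|Pi t z| <= C * `|z|.
Proof.
have half (j : X -> X * X) : linear j -> (forall x, `|j x| <= `|x|) ->
    exists C, 0 <= C /\ forall t x, 0 <= t <= T -> `|Pi t (j x)| <= C * `|x|.
  move=> lj nj; pose F : set (X -> X * X) := [set fun x => Pi t (j x) | t in [set t | 0 <= t <= T]].
  have Flin f : F f -> bounded_fun_norm f /\ linear f.
    move=> [t tT <-]; have [[lPi [C hC]] _] := saP.1 t tT; split.
      move=> r; exists (`|C| * r) => x xr; apply: le_trans (hC _) _.
      apply: (@le_trans _ _ (`|C| * `|j x|)); first by rewrite ler_wpM2r // ler_norm.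
      by rewrite ler_wpM2l // (le_trans (nj x)).
    by move=> a u v; rewrite lj lPi.
  have Fpt : pointwise_bounded F.
    move=> x; have [C [_ hC]] := cont_on_bounded ((within_contP _ _ _).1 (saP.2 (j x))).
    by exists C => _ [t tT <-]; exact: hC.
  have [M hM] := Banach_Steinhauss Flin Fpt 1.
  exists (`|M|); split => // t x tT; have Ft : F (fun x => Pi t (j x)) by exists t.
  have [_ lf] := Flin _ Ft; apply: le_trans (linear_norm_le lf (hM _ Ft) x) _.
  by rewrite ler_wpM2r // ler_norm.
have [|x|C1 [C10 h1]] := half (fun x => (x, 0)).
- by move=> a u v; congr (_, _); rewrite /= scaler0 addr0.
- by rewrite pair_normE /= normr0 max_l.
have [|x|C2 [C20 h2]] := half (fun x => (0, x)).
- by move=> a u v; congr (_, _); rewrite /= scaler0 addr0.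
- by rewrite pair_normE /= normr0 max_r.
exists (C1 + C2) => t z tT; have [[lPi _] _] := saP.1 t tT.
have -> : z = (z.1, 0) + (0, z.2) by case: z => u v; congr (_, _); rewrite /= ?addr0 ?add0r.
rewrite (linD lPi) [X in _ <= X]mulrDl; apply: le_trans (ler_normD _ _) _.
have E : (z.1, 0) + (0, z.2) = z by case: z => u v; congr (_, _); rewrite /= ?addr0 ?add0r.
rewrite E pair_normE; apply: lerD.
  by apply: le_trans (h1 t _ tT) _; rewrite ler_wpM2l // le_max lexx.
by apply: le_trans (h2 t _ tT) _; rewrite ler_wpM2l // le_max lexx orbT.
Qed.

Lemma block_bounds (C : R) : (forall t z, 0 <= t <= T -> `|Pi t z| <= C * `|z|) ->
  [/\ op_family T C (fun t => block11 (Pi t)), op_family T C (fun t => block21 (Pi t)) &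
      op_family T C (fun t => block22 (Pi t))].
Proof.
move=> hC; have l0 a (u v : X) : (a *: u + v, 0) = a *: (u, 0) + (v, 0) :> X * X.
  by congr (_, _); rewrite /= scaler0 addr0.
have r0 a (u v : X) : (0, a *: u + v) = a *: (0, u) + (0, v) :> X * X.
  by congr (_, _); rewrite /= scaler0 addr0.
have n1 (w : X * X) : `|w.1| <= `|w| by rewrite pair_normE le_max lexx.
have n2 (w : X * X) : `|w.2| <= `|w| by rewrite pair_normE le_max lexx orbT.
have ln (x : X) : `|(x, 0 : X)| = `|x| by rewrite pair_normE /= normr0 max_l.
have rn (x : X) : `|(0 : X, x)| = `|x| by rewrite pair_normE /= normr0 max_r.
split=> t tT; have [[lPi _] _] := saP.1 t tT; split.
- by move=> a u v; rewrite /block11 l0 lPi.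
- by move=> x; have := le_trans (n1 _) (hC t (x, 0) tT); rewrite ln.
- by move=> a u v; rewrite /block21 l0 lPi.
- by move=> x; have := le_trans (n2 _) (hC t (x, 0) tT); rewrite ln.
- by move=> a u v; rewrite /block22 r0 lPi.
- by move=> x; have := le_trans (n2 _) (hC t (0, x) tT); rewrite rn.
Qed.

Lemma Pi_blocks t y psi : 0 <= t <= T ->
  [/\ (Pi t (y, psi)).1 = block11 (Pi t) y + (Pi t (0, psi)).1,
      (Pi t (y, psi)).2 = block21 (Pi t) y + block22 (Pi t) psi &
      forall x, d (Pi t (0, psi)).1 x = d psi (block21 (Pi t) x)].
Proof.
move=> tT; have [[lPi _] sPi] := saP.1 t tT.
have E : (y, psi) = (y, 0) + (0, psi) :> X * X by congr (_, _); rewrite /= ?addr0 ?add0r.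
split; try by rewrite {1}E (linD lPi).
move=> x; have := sPi (0, psi) (x, 0); rewrite /pdot /= (ip0r dP) (ip0l dP) addr0 add0r => ->.
by [].
Qed.

Lemma Pi_quad t y psi : 0 <= t <= T -> pdot d (Pi t (y, psi)) (y, psi) =
  d (block11 (Pi t) y) y + 2 * d (block21 (Pi t) y) psi + d (block22 (Pi t) psi) psi.
Proof.
move=> tT; have [E1 E2 E3] := Pi_blocks y psi tT.
rewrite /pdot E1 E2 /= !(ipDl dP) E3 (ipC dP psi); ring.
Qed.

End blocks.

Section lyapunov_forms.
Context {R : realType} {X : completeNormedModType R} {d : X -> X -> R}.
Hypothesis dP : inner_product d.
Variables (T : R) (A : set (X * X)) (Pi : R -> X * X -> X * X).
Variables (M Mb Theta Q0 Qb : R -> X -> X).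
Let As := adjoint_graph d A.
Let S := sg A.
Let S' := sg As.
Let P t := block11 (Pi t).
Let Gamma t := block21 (Pi t).
Let Pb t := block22 (Pi t).
Hypothesis dual : forall (t : R) x w, 0 <= t -> d (S t x) w = d x (S' t w).
Hypothesis lyapM : lyapunov_mild T d A Pi M Mb Theta Q0 Qb.

(** The blocks of Pi (MM) + (MM)^* Pi - QQ, with the signs with which they occur in the mild
    Lyapunov equation. *)
Definition N11 t : X -> X := ((P t \o M t) + (adj d (M t) \o P t)) - Q0 t.
Definition N22 t : X -> X := (Pb t \o adj d (Mb t)) + (Mb t \o Pb t) + Qb t.
Definition N21 t : X -> X := (Mb t \o Gamma t) - (Gamma t \o M t) + Theta t.

Lemma dual_sym (t : R) x w : 0 <= t -> d (S' t x) w = d x (S t w).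
Proof. by move=> t0; rewrite (ipC dP) -dual // (ipC dP). Qed.

Lemma bochner_weak a b (f : R -> X) v w : a <= b ->
  has_bochner_integral `[a, b]%classic f v ->
  integral_is `[a, b]%classic (fun s => d (f s) w) (d v w).
Proof.
move=> ab fv; apply: (bochner_functional (phi := fun u => d u w) (C := `|w|) _ _ fv).
- exact: measurable_I.
- by rewrite [X in (X < _)%E](mu_I ab) ltry.
- by move=> c u z; rewrite (ipDl dP) (ipZl dP).
- by move=> u; rewrite mulrC (CauchySchwarz dP).
Qed.

Lemma hull_up (t a : R) : t <= a -> hull t a = `[t, a]%classic.
Proof. by move=> ta; rewrite /hull min_l // max_r. Qed.
Lemma hull_down (t a : R) : a <= t -> hull t a = `[a, t]%classic.
Proof. by move=> ta; rewrite /hull min_r // max_l. Qed.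

Lemma lyap_P C : semigroup_on T C S -> lyap (d := d) T true S P N11.
Proof.
move=> SP; apply: (lyap_of_anchor (a := T) SP) => [t /andP[]//|t x w tT].
have [t0 tT'] := andP tT.
have [h1 _ _ _] := lyapM; have := bochner_weak w tT' (h1 t x tT).
rewrite hull_up // (ger0_norm (x := T - t)) ?subr_ge0 //.
rewrite (ipBl dP) dual_sym ?subr_ge0 //.
apply: integral_is_eq; first exact: measurable_I.
move=> s; rewrite /= in_itv /= => /andP[ts sT].
by rewrite dual_sym ?subr_ge0 // ger0_norm // subr_ge0.
Qed.

Lemma lyap_Pb C : semigroup_on T C S' -> lyap (d := d) T false S' Pb N22.
Proof.
move=> SP; apply: (lyap_of_anchor (a := 0) SP) => [t /andP[]//|t x w tT].
have [t0 tT'] := andP tT.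
have [_ h2 _ _] := lyapM; have := bochner_weak w t0 (h2 t x tT).
rewrite hull_down // sub0r normrN (ger0_norm t0) (ipBl dP) dual //.
apply: integral_is_eq; first exact: measurable_I.
move=> s; rewrite /= in_itv /= => /andP[s0 st].
by rewrite dual ?subr_ge0 // distrC ger0_norm // subr_ge0.
Qed.

(** If A^* = - A, both sides of Gamma are transported by S, as for the upper left block. *)
Lemma lyap_Gamma_skew C : As = opp_graph A -> semigroup_on T C S ->
  lyap (d := d) T true S Gamma (fun t => - N21 t).
Proof.
move=> E SP; apply: (lyap_of_anchor (a := T) SP) => [t /andP[]//|t x w tT].
have [t0 tT'] := andP tT.
have [_ _ _ h4] := lyapM; have := bochner_weak w tT' (h4 E t x tT).
rewrite -E -/As -/S' hull_up // (ger0_norm (x := T - t)) ?subr_ge0 //.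
rewrite (ipBl dP) dual_sym ?subr_ge0 // => h.
have := integral_isN (measurable_I _ _) h; rewrite opprB.
apply: integral_is_eq; first exact: measurable_I.
move=> s; rewrite /= in_itv /= => /andP[ts sT].
rewrite dual_sym ?subr_ge0 // ger0_norm ?subr_ge0 // -(ipNl dP) //.
Qed.

Lemma Gamma_symmetric : As = A ->
  (forall p q x w, 0 <= p -> p <= q -> q <= T ->
    integral_is `[p, q]%classic (fun s => d (N21 s x) w) (d (Gamma p x) w - d (Gamma q x) w)) /\
  (forall t z w, 0 <= t <= T -> A (z, w) -> A (Gamma t z, Gamma t w)).
Proof.
move=> E; have [_ _ h3 _] := lyapM; split; last by move=> t z w tT; have [_] := h3 E t tT; apply.
move=> p q x w p0 pq qT.
have [hp _] := h3 E p (introT andP (conj p0 (le_trans pq qT))).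
have [hq _] := h3 E q (introT andP (conj (le_trans p0 pq) qT)).
have ip := bochner_weak w (le_trans pq qT) (hp x); have iq := bochner_weak w qT (hq x).
have := integral_is_init pq qT ip iq.
by congr integral_is; rewrite !(ipBl dP); ring.
Qed.

End lyapunov_forms.

(** * The energy identity *)

Section energy_identity.
Context {R : realType} {X : completeNormedModType R} {d : X -> X -> R}.
Hypothesis dP : inner_product d.

Lemma almost_integral_eq (T : R) (e e' phi phi' : R -> R) :
  (forall t, 0 <= t <= T -> e t = e' t) -> (forall t, 0 <= t <= T -> phi t = phi' t) ->
  almost_integral T e phi -> almost_integral T e' phi'.
Proof.
move=> ee pp h eps eps0; have [r r0 hr] := h eps eps0; exists r => // p q p0 pq qT pqr.
have [n [n1 n2]] := hr p q p0 pq qT pqr; exists n; split.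
  by rewrite -!ee // ?p0 ?qT ?(le_trans pq) // (le_trans p0).
by move=> s spq; rewrite -pp ?n2 //; case/andP: spq => ps sq; rewrite (le_trans p0) ?(le_trans sq).
Qed.

Lemma semigroup_on_mono (T C C' : R) (S : R -> X -> X) : C <= C' ->
  semigroup_on T C S -> semigroup_on T C' S.
Proof.
move=> CC [h1 h2 h3 h4 h5]; split => // t x tT.
by apply: le_trans (h2 t x tT) _; rewrite ler_wpM2r.
Qed.

Lemma op_family_mono (T C C' : R) (L : R -> X -> X) : C <= C' ->
  op_family T C L -> op_family T C' L.
Proof.
move=> CC h t tT; have [h1 h2] := h t tT; split => // x.
by apply: le_trans (h2 x) _; rewrite ler_wpM2r.
Qed.

Lemma bounded_by_mono (T C C' : R) (u : R -> X) : C <= C' ->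
  bounded_by T C u -> bounded_by T C' u.
Proof. by move=> CC h t tT; apply: le_trans (h t tT) _. Qed.

Lemma bounded_measurable_family (T : R) (N : R -> X -> X) : bounded_measurable T N ->
  exists2 C : R, 0 <= C & op_family T C N.
Proof.
move=> [lN [C hC] _]; exists `|C| => // t tT; split; first exact: lN.
by move=> x; apply: le_trans (hC _ _ tT) _; rewrite ler_wpM2r // ler_norm.
Qed.

Lemma op_familyD (T C C' : R) (L L' : R -> X -> X) : op_family T C L -> op_family T C' L' ->
  op_family T (C + C') (fun t => L t + L' t).
Proof.
move=> h h' t tT; have [h1 h2] := h t tT; have [h1' h2'] := h' t tT; split.
  move=> a u v; rewrite -[(L t + L' t) _]/(L t (a *: u + v) + L' t (a *: u + v)).
  by rewrite h1 h1' -[(L t + L' t) u]/(L t u + L' t u) scalerDr addrACA.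
move=> x; rewrite mulrDl; apply: le_trans (ler_normD _ _) _; exact: lerD.
Qed.

Lemma op_familyN (T C : R) (L : R -> X -> X) : op_family T C L ->
  op_family T C (fun t => - L t).
Proof.
move=> h t tT; have [h1 h2] := h t tT; split; last by move=> x; rewrite normrN.
by move=> a u v; rewrite opprfctE h1 opprD scalerN.
Qed.

Lemma op_family_comp (T C C' : R) (L L' : R -> X -> X) : 0 <= C ->
  op_family T C L -> op_family T C' L' -> op_family T (C * C') (fun t => L t \o L' t).
Proof.
move=> C0 h h' t tT; have [h1 h2] := h t tT; have [h1' h2'] := h' t tT; split.
  by move=> a u v /=; rewrite h1' h1.
by move=> x /=; apply: le_trans (h2 _) _; rewrite -mulrA ler_wpM2l.
Qed.

Lemma op_family_adj (T C : R) (L : R -> X -> X) : op_family T C L ->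
  op_family T C (fun t => adj d (L t)).
Proof. by move=> h t tT; have [h1 h2] := h t tT; exact: adj_bounded. Qed.

Variables (T : R) (A : set (X * X)) (Pi : R -> X * X -> X * X).
Variables (M Mb Theta Q0 Qb : R -> X -> X).
Let As := adjoint_graph d A.
Let S := sg A.
Let S' := sg As.
Local Notation P t := (block11 (Pi t)).
Local Notation Gamma t := (block21 (Pi t)).
Local Notation Pb t := (block22 (Pi t)).
Hypothesis A_generator : exists S : R -> X -> X, generates A S.
Hypothesis A_cases : As = A \/ As = opp_graph A.
Hypothesis saP : strongly_continuous_sa T d Pi.
Hypothesis dataP : lyapunov_data T d A Pi M Mb Theta Q0 Qb.

Lemma rest_blocks t y psi : 0 <= t <= T ->
  rest (d := d) Pi M Mb Theta Q0 Qb t (y, psi) =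
  d (N11 (d := d) Pi M Q0 t y) y - 2 * d (N21 Pi M Mb Theta t y) psi
    - d (N22 (d := d) Pi Mb Qb t psi) psi.
Proof.
move=> tT; have [mM mMb mTh [_ _ _ _]] := dataP.
have bM := bounded_measurable_op mM tT; have bMb := bounded_measurable_op mMb tT.
have bTh := bounded_measurable_op mTh tT.
have [E1 E2 E3] := Pi_blocks dP saP y psi tT.
have [_ sPi] := saP.1 t tT.
have sP u v : d (P t u) v = d u (P t v).
  by have := sPi (u, 0) (v, 0); rewrite /pdot /= !(ip0r dP) !(ip0l dP) !addr0.
have sPb u v : d (Pb t u) v = d u (Pb t v).
  by have := sPi (0, u) (0, v); rewrite /pdot /= !(ip0r dP) !(ip0l dP) !add0r.
have -> : d (N11 (d := d) Pi M Q0 t y) y = d (P t (M t y)) y + d (adj d (M t) (P t y)) y - d (Q0 t y) y.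
  by rewrite -(ipDl dP) -(ipBl dP).
have -> : d (N22 (d := d) Pi Mb Qb t psi) psi =
    d (Pb t (adj d (Mb t) psi)) psi + d (Mb t (Pb t psi)) psi + d (Qb t psi) psi.
  by rewrite -!(ipDl dP).
have -> : d (N21 Pi M Mb Theta t y) psi =
    d (Mb t (Gamma t y)) psi - d (Gamma t (M t y)) psi + d (Theta t y) psi.
  by rewrite -(ipBl dP) -(ipDl dP).
have -> : rest (d := d) Pi M Mb Theta Q0 Qb t (y, psi) =
    2 * (d (Pi t (y, psi)).1 (M t y) - d (Pi t (y, psi)).2 (adj d (Mb t) psi))
    - (d (Q0 t y) y + d (adj d (Theta t) psi) y + d (Theta t y) psi + d (Qb t psi) psi).
  rewrite /rest; congr (2 * _ - _).
    rewrite -(ipNr dP) -[LHS]/(d _ (M t y + 0) + d _ (0 + - adj d (Mb t) psi)).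
    by rewrite addr0 add0r.
  by rewrite -(ipDl dP) -addrA -(ipDl dP).
rewrite E1 E2 !(ipDl dP) E3.
rewrite (ipC dP (adj d (M t) _)) -(adjP dP bM) (sP (M t y)).
rewrite (ipC dP (adj d (Theta t) _)) -(adjP dP bTh) !(adjP dP bMb) !sPb.
rewrite (ipC dP _ (Pb t psi)) (ipC dP (P t y)) !(ipC dP psi).
have -> : d (Pb t psi) (adj d (Mb t) psi) = d (Pb t (adj d (Mb t) psi)) psi.
  by rewrite sPb (ipC dP).
ring.
Qed.

(** The three blocks of Pi contribute separately. The upper left one is transported along y, the
    lower right one along psi with time reversed. For Gamma, if A^* = - A, then psi is also a
    forward orbit of S, with force - G, and Gamma behaves like the upper left block; if A^* = A,
    then y and psi run in opposite directions under one semigroup, with which Gamma commutes. *)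
Lemma energy_identity y psi F G :
  mild (d := d) T true S y F -> mild (d := d) T false S' psi G ->
  cont_on 0 T y -> cont_on 0 T psi ->
  (exists C : R, bounded_by T C F) -> (exists C : R, bounded_by T C G) ->
  almost_integral T (fun t => pdot d (Pi t (y t, psi t)) (y t, psi t))
    (fun s => rest (d := d) Pi M Mb Theta Q0 Qb s (y s, psi s)
       + 2 * pdot d (Pi s (y s, psi s)) (F s, - G s)).
Proof.
move=> my mpsi cy cpsi [CF bF] [CG bG].
have [gA gB dual inv] := dual_semigroups dP A_generator A_cases.
have [mM mMb mTh [mQ0 mQb _ lyapM]] := dataP.
have [CS CS1 SP] := C0_semigroup_on T gA.1.
have [CS' CS1' SP'] := C0_semigroup_on T gB.1.
have [CPi hPi] := Pi_bounded saP.
have hPi' t z : 0 <= t <= T -> `|Pi t z| <= `|CPi| * `|z|.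
  by move=> tT; apply: le_trans (hPi t z tT) _; rewrite ler_wpM2r // ler_norm.
have [fP fG fPb] := block_bounds saP hPi'.
have nPi : 0 <= `|CPi| by [].
have [CM CM0 fM] := bounded_measurable_family mM.
have [CMb CMb0 fMb] := bounded_measurable_family mMb.
have [CTh CTh0 fTh] := bounded_measurable_family mTh.
have [CQ CQ0 fQ] := bounded_measurable_family mQ0.
have [CQb CQb0 fQb] := bounded_measurable_family mQb.
have [Cy [Cy0 by_]] := cont_on_bounded cy; have [Cp [Cp0 bp]] := cont_on_bounded cpsi.
have f11 := op_familyD (op_familyD (op_family_comp nPi fP fM)
   (op_family_comp CM0 (op_family_adj fM) fP)) (op_familyN fQ).
have f22 := op_familyD (op_familyD (op_family_comp nPi fPb (op_family_adj fMb))
   (op_family_comp CMb0 fMb fPb)) fQb.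
have f21 := op_familyD (op_familyD (op_family_comp CMb0 fMb fG)
   (op_familyN (op_family_comp nPi fG fM))) fTh.
set C11 := _ + CQ in f11; set C22 := _ + CQb in f22; set C21 := _ + CTh in f21.
pose C := CS + CS' + `|CPi| + C11 + C22 + C21 + Cy + Cp + `|CF| + `|CG|.
have p11 : 0 <= C11 by rewrite !addr_ge0 ?mulr_ge0.
have p22 : 0 <= C22 by rewrite !addr_ge0 ?mulr_ge0.
have p21 : 0 <= C21 by rewrite !addr_ge0 ?mulr_ge0.
have pF := normr_ge0 CF; have pG := normr_ge0 CG.
have lF := ler_norm CF; have lG := ler_norm CG.
have C1 : 1 <= C by rewrite /C; lra.
have [cS cS' cPi] : [/\ CS <= C, CS' <= C & `|CPi| <= C] by rewrite /C; split; lra.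
have [c11 c22 c21] : [/\ C11 <= C, C22 <= C & C21 <= C] by rewrite /C; split; lra.
have [cy' cp'] : Cy <= C /\ Cp <= C by rewrite /C; split; lra.
have [cF cG] : CF <= C /\ CG <= C by rewrite /C; split; lra.
have {}SP := semigroup_on_mono cS SP; have {}SP' := semigroup_on_mono cS' SP'.
have {}fP := op_family_mono cPi fP; have {}fG := op_family_mono cPi fG.
have {}fPb := op_family_mono cPi fPb; have {}f11 := op_family_mono c11 f11.
have {}f22 := op_family_mono c22 f22; have {}f21 := op_family_mono c21 f21.
have {}by_ := bounded_by_mono cy' by_; have {}bp := bounded_by_mono cp' bp.
have {}bF := bounded_by_mono cF bF; have {}bG := bounded_by_mono cG bG.
have a1 := energy_almost_integral dP C1 SP my my (lyap_P dP dual lyapM SP)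
  fP f11 by_ by_ bF bF.
have a3 := energy_almost_integral dP C1 SP' mpsi mpsi (lyap_Pb dP dual lyapM SP')
  fPb f22 bp bp bG bG.
have a2 : almost_integral T (fun t => d (Gamma t (y t)) (psi t))
   (fun s => d (Gamma s (F s)) (psi s) - d (N21 Pi M Mb Theta s (y s)) (psi s)
      - d (Gamma s (y s)) (G s)).
  case: A_cases => E.
    have [hW hA] := Gamma_symmetric dP lyapM E.
    have SS : S' = S by rewrite /S' E.
    have sym (t : R) x w : 0 <= t <= T -> d (S t x) w = d x (S t w).
      by move=> /andP[t0 _]; rewrite dual // -/As -/S' SS.
    rewrite SS in mpsi; apply: (mixed_almost_integral dP C1 SP sym my mpsi hW) => //.
    move=> t tau x tT /andP[tau0 _]; apply: (ip_ext dP) => w.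
    have [lG' bG'] := fG t tT.
    have tA := total_generator dP gA A_cases.
    rewrite (orbit_backward dP (beta := fun u v => d (Gamma t u) v) (Cb := C) gA gA tA tA) //.
    - by rewrite [RHS]dual // -/As -/S' SS.
    - by move=> w' a u v; rewrite lG' (ipDl dP) (ipZl dP).
    - by move=> w' a u v; rewrite (ipDr dP) (ipZr dP).
    - by move=> u v; apply: le_trans (CauchySchwarz dP _ _) _; rewrite ler_wpM2r.
    - move=> u u' v v' Au Av; have : As (v, v') by rewrite E.
      by move=> /(_ _ _ (hA t _ _ tT Au)).
  have mpsi' : mild (d := d) T true S psi (fun s => - G s).
    move=> p q w pT qT pq; have := mpsi q p (S' `|q - p| w) qT pT pq.
    rewrite {1}/hull minC maxC -/(hull p q) -!dual ?normr_ge0 //.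
    rewrite (distrC p q) inv ?normr_ge0 // => h.
    have mI : measurable (hull p q : set (measurableTypeR R)) by exact: measurable_I.
    have := integral_isN mI h; rewrite opprB; apply: integral_is_eq => // s.
    rewrite /hull /= in_itv /= => /(hullP (fw := true) pq)[ps sq Eq _].
    have [lS _ _ SD _] := SP.
    by rewrite -dual ?normr_ge0 // Eq SD ?normr_ge0 // (distrC p s) inv ?normr_ge0 // /S (linN (lS _ (normr_ge0 _))) (ipNl dP).
  have bG' : bounded_by T C (fun s => - G s) by move=> s sT; rewrite normrN; exact: bG.
  have fN21 := op_familyN f21.
  have := energy_almost_integral dP C1 SP my mpsi' (lyap_Gamma_skew dP dual lyapM E SP)
    fG fN21 by_ bp bF bG'.
  apply: almost_integral_eq => // t tT; rewrite mul1r (ipNr dP).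
  rewrite -[(- N21 _ _ _ _ t) (y t)]/(- (N21 Pi M Mb Theta t (y t))) (ipNl dP); ring.
have := almost_integralD (almost_integralD a1 (almost_integralZ 2 a2)) a3.
apply: almost_integral_eq => t tT; first by rewrite (Pi_quad dP saP).
have [E1 E2 E3] := Pi_blocks dP saP (y t) (psi t) tT.
have [_ sPi] := saP.1 t tT.
have sP u v : d (P t u) v = d u (P t v).
  by have := sPi (u, 0) (v, 0); rewrite /pdot /= !(ip0r dP) !(ip0l dP) !addr0.
have sPb u v : d (Pb t u) v = d u (Pb t v).
  by have := sPi (0, u) (0, v); rewrite /pdot /= !(ip0r dP) !(ip0l dP) !add0r.
rewrite rest_blocks // {1}/pdot E1 E2 /= !(ipDl dP) E3 !(ipNr dP) (sP (F t)) (sPb (G t)).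
rewrite (ipC dP (F t)) (ipC dP (G t)) (ipC dP (psi t) (Gamma t _)).
ring.
Qed.

End energy_identity.

(** * Continuous paths *)

Section continuity.
Context {R : realType}.
Implicit Types (a b : R).

Lemma cont_onP {V W : normedModType R} a b (f : R -> V) (k : V -> W) :
  continuous k -> cont_on a b f -> cont_on a b (k \o f).
Proof.
move=> ck /within_contP cf; apply/within_contP => x.
by apply: (@continuous_comp (subspace `[a, b]%classic) V W f k x); [exact: cf | exact: ck].
Qed.

Lemma cont_on_pair {V W : normedModType R} a b (f : R -> V) (g : R -> W) :
  cont_on a b f -> cont_on a b g -> cont_on a b (fun t => (f t, g t)).
Proof.
move=> cf cg x xab e e0; have [r r0 hr] := cf x xab e e0; have [r' r0' hr'] := cg x xab e e0.
exists (Num.min r r'); first by rewrite lt_min r0.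
move=> t tab; rewrite lt_min => /andP[t1 t2]; rewrite prod_normE ge_max.
by rewrite hr // hr'.
Qed.

Lemma cont_onD {V : normedModType R} a b (f g : R -> V) :
  cont_on a b f -> cont_on a b g -> cont_on a b (fun t => f t + g t).
Proof.
move=> /within_contP cf /within_contP cg; apply/within_contP => x.
by apply: (@continuousD R V (subspace `[a, b]%classic) f g x); [exact: cf | exact: cg].
Qed.

Lemma cont_onZ {V : normedModType R} a b (c : R) (f : R -> V) :
  cont_on a b f -> cont_on a b (fun t => c *: f t).
Proof. by move=> cf; apply: (cont_onP (k := fun v => c *: v)) cf; exact: scaler_continuous. Qed.

Lemma cont_onB {V : normedModType R} a b (f g : R -> V) :
  cont_on a b f -> cont_on a b g -> cont_on a b (fun t => f t - g t).
Proof.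
move=> cf cg; apply: cont_onD => //.
by apply: (cont_onP (k := -%R)) cg; exact: opp_continuous.
Qed.

Lemma cont_on_norm {V : normedModType R} a b (f : R -> V) :
  cont_on a b f -> cont_on a b (fun t => `|f t|).
Proof. by move=> cf; apply: (cont_onP (k := fun v => `|v|)) cf; exact: norm_continuous. Qed.

Lemma cont_on_cst {V : normedModType R} a b (c : V) : cont_on a b (fun=> c).
Proof. by move=> x _ e e0; exists 1 => // t _ _; rewrite subrr normr0 ltW. Qed.

Lemma cont_on_excess a b (f g : R -> R) :
  cont_on a b f -> cont_on a b g -> cont_on a b (fun t => Num.max 0 (f t - g t)).
Proof.
move=> cf cg; apply: (cont_onP (k := fun v : R => Num.max 0 v)) (cont_onB cf cg).
by move=> x; apply: continuous_max; [exact: cvg_cst | exact: cvg_id].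
Qed.

Lemma cont_on_sqr a b (f : R -> R) : cont_on a b f -> cont_on a b (fun t => f t ^+ 2).
Proof. by move=> cf; apply: (cont_onP (k := fun v : R => v ^+ 2)) cf; exact: exprn_continuous. Qed.

Lemma cont_on_eq {V : normedModType R} a b (f g : R -> V) :
  (forall t, a <= t <= b -> f t = g t) -> cont_on a b f -> cont_on a b g.
Proof.
move=> fg cf x xab e e0; have [r r0 hr] := cf x xab e e0; exists r => // t tab tx.
by rewrite -!fg // hr.
Qed.

Lemma cont_on_integral a b (f : R -> R) : cont_on a b f -> exists v, integral_is `[a, b]%classic f v.
Proof. by move=> /within_contP cf; eexists; exact: integral_is_cont. Qed.

Lemma cont_on_max {V : normedModType R} a b (f : R -> V) : a <= b -> cont_on a b f ->
  exists Z : R, [/\ 0 <= Z, forall t, a <= t <= b -> `|f t| <= Z &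
    forall B : R, (forall t, a <= t <= b -> `|f t| <= B) -> Z <= B].
Proof.
move=> ab /cont_on_norm /within_contP cf; have [c] := EVT_max ab cf.
rewrite in_itv /= => cab h; exists `|f c|; split => [|t tab|B].
- exact: normr_ge0.
- by apply: h; rewrite in_itv.
- exact.
Qed.

Lemma cont_on_path {X : normedModType R} T (f : R -> X -> X -> X) (y psi : R -> X) :
  jointly_continuous T f -> cont_on 0 T y -> cont_on 0 T psi ->
  cont_on 0 T (fun t => f t (y t) (psi t)).
Proof.
move=> cf cy cp x xT e e0.
move/subspace_continuousP: cf => /(_ (x, (y x, psi x)) xT) /cvgrPdist_le/(_ e e0).
rewrite near_withinE => /nbhs_ballP[r /= r0 h].
have [s s0 hs] := cont_on_pair cy cp xT (divr_gt0 r0 (ltr0n _ 2)).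
exists (Num.min r s); first by rewrite lt_min r0.
move=> t tT; rewrite lt_min => /andP[t1 t2]; rewrite distrC.
apply: (h (t, (y t, psi t))) => //.
have := hs t tT t2; rewrite prod_normE ge_max => /andP[h1 h2].
split => /=; first by rewrite -ball_normE /ball_ /= distrC.
split; rewrite -ball_normE /ball_ /= distrC; apply: le_lt_trans; try eassumption; lra.
Qed.

End continuity.

Section weak_integral_complements.
Context {R : realType}.

Lemma integral_is_subset (a b a' b' : R) f v : a <= a' -> a' <= b' -> b' <= b ->
  (forall s, a <= s <= b -> 0 <= f s) -> integral_is `[a, b]%classic f v ->
  exists2 w, integral_is `[a', b']%classic f w & w <= v.
Proof.
move=> aa' ab' bb' f0 fv.
have ge0 p q w : a <= p -> p <= q -> q <= b -> integral_is `[p, q]%classic f w -> 0 <= w.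
  move=> ap pq qb fw; have := integral_is_le (measurable_I p q) _ (integral_is_cst 0 pq) fw.
  rewrite mul0r; apply => s; rewrite /= in_itv /= => /andP[ps sq]; apply: f0.
  by rewrite (le_trans ap) //= (le_trans sq).
have [w hw] := integral_is_sub aa' bb' fv; exists w => //.
have [l hl] := integral_is_sub (lexx a) (le_trans ab' bb') fv.
have [r hr] := integral_is_sub (le_trans aa' ab') (lexx b) fv.
have h1 := integral_is_cat (le_trans aa' ab') bb' (integral_is_cat aa' ab' hl hw) hr.
have := integral_is_uniq (measurable_I _ _) fv h1.
have := ge0 _ _ _ (lexx a) aa' (le_trans ab' bb') hl.
have := ge0 _ _ _ (le_trans aa' ab') bb' (lexx b) hr; lra.
Qed.

(** The integral of (f - c)^2 is nonnegative for c the mean of f. *)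
Lemma integral_is_sqr (a b : R) f (v w : R) : a <= b -> integral_is `[a, b]%classic f v ->
  integral_is `[a, b]%classic (fun s => f s ^+ 2) w -> v ^+ 2 <= (b - a) * w.
Proof.
move=> ab fv fw; have mI := measurable_I a b.
have key (c : R) : 0 <= w - 2 * c * v + c ^+ 2 * (b - a).
  have := integral_isD mI (integral_isB mI fw (integral_isZ (2 * c) mI fv)) (integral_is_cst (c ^+ 2) ab).
  have := integral_is_cst 0 ab; rewrite mul0r; apply: integral_is_le => // s _.
  by have -> : f s ^+ 2 - 2 * c * f s + c ^+ 2 = (f s - c) ^+ 2 by [ring]; exact: sqr_ge0.
have [E|ba] := eqVneq (b - a) 0.
  have [->|v0] := eqVneq v 0; first by rewrite E mul0r expr0n.
  have := key ((w + 1) / (2 * v)); rewrite E mulr0 addr0.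
  by have -> : w - 2 * ((w + 1) / (2 * v)) * v = - 1 by [field]; lra.
have h0 : 0 < b - a by rewrite lt_neqAle eq_sym ba subr_ge0.
have := ler_wpM2l (ltW h0) (key (v / (b - a))); rewrite mulr0.
have -> : (b - a) * (w - 2 * (v / (b - a)) * v + (v / (b - a)) ^+ 2 * (b - a)) = (b - a) * w - v ^+ 2.
  by field.
by rewrite subr_ge0.
Qed.

End weak_integral_complements.

(** * Gronwall estimates *)

Section gronwall.
Context {R : realType} {X : completeNormedModType R} {d : X -> X -> R}.
Hypothesis dP : inner_product d.

Definition growth (k : R) : R := 2 ^+ (Num.truncn (2 * k)).+1.

(** Over a stretch with l * |q - p| <= 1 / 2 the function at most doubles, and growth counts the
    stretches. The argument is blind to the direction of time. *)
Lemma gronwall_doubling (T l : R) fw (Phi : R -> R) : 0 <= l ->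
  (forall t, 0 <= t <= T -> 0 <= Phi t) ->
  (forall p q, 0 <= p <= T -> 0 <= q <= T -> before fw p q ->
     Phi q - Phi p <= l * `|q - p| * Phi q) ->
  forall p q, 0 <= p <= T -> 0 <= q <= T -> before fw p q ->
    Phi q <= growth (l * T) * Phi p.
Proof.
move=> l0 Phi0 h p q pT qT pq.
have half m k : 0 <= m <= T -> 0 <= k <= T -> before fw m k -> 2 * (l * `|k - m|) <= 1 ->
    Phi k <= 2 * Phi m.
  move=> mT kT mk small; have := h m k mT kT mk; have := Phi0 k kT.
  have := ler_wpM2r (Phi0 k kT) small; move: (l * _) => a; lra.
have key (k : nat) : forall q, 0 <= q <= T -> before fw p q -> 2 * (l * `|q - p|) <= k%:R ->
    Phi q <= 2 ^+ k * Phi p.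
  elim: k => [|k IH] {qT pq q} q qT pq.
    move=> small; have := h p q pT qT pq.
    have -> : l * `|q - p| = 0.
      by apply/eqP; rewrite eq_le mulr_ge0 // andbT; move: small; move: (l * _) => a; lra.
    by rewrite mul0r expr0 mul1r subr_le0.
  move=> small; pose c : R := k%:R / k.+1%:R; pose m := p + (q - p) * c.
  have k1 : 0 < k.+1%:R :> R by rewrite ltr0n.
  have c0 : 0 <= c by rewrite divr_ge0.
  have c1 : 1 - c = k.+1%:R^-1 by rewrite /c -natr1; field; rewrite natr1 gt_eqF.
  have c1' : 0 <= 1 - c by rewrite c1 invr_ge0.
  have [pm mq] : before fw p m /\ before fw m q.
    rewrite /m /before; move: pq; case: (fw) => /= pq; split; rewrite -subr_ge0.
    - by rewrite addrC addKr mulr_ge0 // subr_ge0.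
    - by have -> : q - (p + (q - p) * c) = (q - p) * (1 - c) by [ring]; rewrite mulr_ge0 // subr_ge0.
    - by have -> : p - (p + (q - p) * c) = (p - q) * c by [ring]; rewrite mulr_ge0 // subr_ge0.
    - by have -> : p + (q - p) * c - q = (p - q) * (1 - c) by [ring]; rewrite mulr_ge0 // subr_ge0.
  have mT : 0 <= m <= T.
    move: pm mq pT qT; rewrite /before; case: (fw) => a1 a2 /andP[b1 b2] /andP[b3 b4].
      by rewrite (le_trans b1) ?(le_trans a2).
    by rewrite (le_trans b3) ?(le_trans a1).
  have dm : `|m - p| = `|q - p| * c by rewrite /m addrC addKr normrM (ger0_norm c0).
  have dq : `|q - m| = `|q - p| * (1 - c).
    have -> : q - m = (q - p) * (1 - c) by rewrite /m; ring.
    by rewrite normrM (ger0_norm c1').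
  have s1 : 2 * (l * `|q - m|) <= 1.
    have := ler_wpM2r c1' small; rewrite dq {2}c1 divff ?gt_eqF //.
    by move: `|q - p| => a; lra.
  have s2 : 2 * (l * `|m - p|) <= k%:R.
    have := ler_wpM2r c0 small; have -> : k.+1%:R * c = k%:R by rewrite mulrC divfK // gt_eqF.
    by rewrite dm; move: `|q - p| => a; lra.
  apply: le_trans (half m q mT qT mq s1) _; rewrite exprS -mulrA.
  by rewrite ler_wpM2l // IH.
apply: key => //; have dT := andP (dist_le pT qT).
apply: (@le_trans _ _ (2 * (l * T))); first by rewrite ler_wpM2l // ler_wpM2l // dT.2.
by apply: ltW; have /truncn_itv/andP[_] : 0 <= 2 * (l * T) by
  rewrite !mulr_ge0 // (le_trans (normr_ge0 _) dT.2).
Qed.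

Variables (T C : R).
Hypotheses (C1 : 1 <= C).

(** The doubling argument applies to the initial value plus the total forcing plus l times the
    integral of |u| so far, which dominates |u|. *)
Lemma mild_gronwall fw (S : R -> X -> X) u F (o l alpha : R) (a : R -> R) :
  semigroup_on T C S -> mild (d := d) T fw S u F -> cont_on 0 T u ->
  0 <= o <= T -> (forall t, 0 <= t <= T -> before fw o t) -> 0 <= l ->
  (forall s, 0 <= s <= T -> 0 <= a s) ->
  (forall s, 0 <= s <= T -> `|F s| <= l * `|u s| + a s) ->
  integral_is `[0, T]%classic a alpha ->
  forall t, 0 <= t <= T -> `|u t| <= growth (C * l * T) * C * (`|u o| + alpha).
Proof.
move=> SP mu cu oT ob l0 a0 Fa ia t tT; have C0 : 0 <= C by exact: le_trans C1.
have T0 : 0 <= T by case/andP: oT => h1; exact: le_trans h1.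
have [w0 hw0] := cont_on_integral (cont_on_norm cu).
have hb p q : 0 <= p <= T -> 0 <= q <= T ->
  [/\ 0 <= Num.min p q, Num.min p q <= Num.max p q & Num.max p q <= T].
  move=> /andP[p0 pT] /andP[q0 qT]; split; first by rewrite le_min p0.
    by rewrite le_max !ge_min lexx.
  by rewrite ge_max pT.
have /choice[J hJ] : forall p, exists w, 0 <= p <= T -> integral_is (hull o p) (fun s => `|u s|) w.
  move=> p; have [pT|_] := boolP (0 <= p <= T); last by exists 0.
  have [h1 h2 h3] := hb o p oT pT.
  by have [w hw _] := integral_is_subset h1 h2 h3 (fun s _ => normr_ge0 (u s)) hw0; exists w.
have J0 p : 0 <= p <= T -> 0 <= J p.
  move=> pT; have [h1 h2 h3] := hb o p oT pT.
  have := integral_is_le (measurable_I _ _) _ (integral_is_cst 0 h2) (hJ p pT).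
  by rewrite mul0r; apply => s _.
have al0 : 0 <= alpha.
  have := integral_is_le (measurable_I _ _) _ (integral_is_cst 0 T0) ia.
  by rewrite mul0r; apply => s; rewrite /= in_itv /= => /a0.
pose Phi p := C * (`|u o| + alpha) + C * l * J p.
have Phi0 p : 0 <= p <= T -> 0 <= Phi p by move=> pT; rewrite addr_ge0 ?mulr_ge0 ?addr_ge0 ?J0.
have uPhi p : 0 <= p <= T -> `|u p| <= Phi p.
  move=> pT; have [h1 h2 h3] := hb o p oT pT; apply: (norm_le_ip dP); first exact: Phi0.
  move=> w; have m := mu o p w oT pT (ob p pT).
  have [al hal al_le] := integral_is_subset h1 h2 h3 a0 ia.
  have mI : measurable (hull o p : set (measurableTypeR R)) by exact: measurable_I.
  have hw := integral_is_le mI _ m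
    (integral_isZ (C * `|w|) mI (integral_isD mI (integral_isZ l mI (hJ p pT)) hal)).
  have e1 : d (S `|p - o| (u o)) w <= C * `|u o| * `|w|.
    apply: le_trans (ip_le dP _ _) _; rewrite ler_wpM2r //.
    by have [_ bS _ _ _] := SP; apply: bS; exact: dist_le.
  have {}hw : d (u p) w - d (S `|p - o| (u o)) w <= C * `|w| * (l * J p + al).
    apply: hw => s sI; have sT : 0 <= s <= T by move: sI; rewrite /hull /= in_itv /= => /(in_hull oT pT).
    apply: le_trans (ip_le dP _ _) _; rewrite mulrAC ler_wpM2r //.
    have [_ bS _ _ _] := SP; apply: le_trans (bS _ _ (dist_le sT pT)) _.
    by rewrite ler_wpM2l // Fa.
  have e2 := ler_wpM2l (mulr_ge0 C0 (normr_ge0 w)) al_le.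
  rewrite /Phi; move: e1 hw e2; move: (d (u p) w) (d _ w) `|u o| `|w| (J p) => x1 x2 x3 x4 x5.
  by lra.
have mono p q : 0 <= p <= T -> 0 <= q <= T -> before fw p q ->
    Phi q - Phi p <= C * l * `|q - p| * Phi q.
  move=> pT qT pq; have hpq := hull_from (ob p pT) pq (hJ q qT) (hJ p pT).
  have -> : Phi q - Phi p = C * l * (J q - J p) by rewrite /Phi; ring.
  rewrite -!mulrA !ler_wpM2l // mulrC; apply: le_trans (ler_norm _) _.
  apply: hull_norm_le hpq => s sI; have sT := in_hull pT qT sI.
  rewrite normr_id; apply: le_trans (uPhi s sT) _.
  rewrite /Phi lerD2l ler_wpM2l ?mulr_ge0 // -subr_ge0.
  have [ps sq _ _] := hullP pq sI.
  have := hull_from (ob s sT) sq (hJ q qT) (hJ s sT) => hsq.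
  have [h1 h2 h3] := hb s q sT qT.
  have := integral_is_le (measurable_I _ _) _ (integral_is_cst 0 h2) hsq.
  by rewrite mul0r; apply => r _.
apply: le_trans (uPhi t tT) _.
have := gronwall_doubling (mulr_ge0 C0 l0) Phi0 mono oT tT (ob t tT).
have J00 : J o = 0.
  have h := hJ o oT; rewrite /hull minxx maxxx in h.
  have := integral_is_cat (lexx o) (lexx o) h h.
  by move=> /(integral_is_uniq (measurable_I _ _) h); lra.
by rewrite {2}/Phi J00 mulr0 addr0 mulrA.
Qed.

End gronwall.

(** * Stability of the coupled system *)

Section self_bound.
Context {R : realType}.

(** Z enters its own bound only through the square root of Z * D, and is therefore at most a
    multiple of D. *)
Lemma self_bound (Z D q c1 c3 : R) : 0 <= D -> 0 <= c1 -> 0 <= c3 -> Z <= c1 * (D + q) ->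
  q ^+ 2 <= c3 * (D ^+ 2 + Z * D) -> Z <= (2 * c1 + 1 + c1 ^+ 2 * c3) * D.
Proof.
move=> D0 c10 c30 Zq qq; rewrite leNgt; apply/negP => Zbig.
pose W := Z - c1 * D; pose k := c1 ^+ 2 * c3.
have k0 : 0 <= k by rewrite mulr_ge0 // sqr_ge0.
have mD : 0 <= (k + 1 + c1) * D by rewrite mulr_ge0 // !addr_ge0.
have Wbig : (k + 1 + c1) * D < W by move: Zbig; rewrite /W /k; lra.
have W0 : 0 < W by exact: le_lt_trans Wbig.
have Wq : W <= c1 * q by rewrite /W; lra.
have W2 : W ^+ 2 <= k * ((1 + c1) * D ^+ 2 + W * D).
  have -> : (1 + c1) * D ^+ 2 + W * D = D ^+ 2 + Z * D by rewrite /W; ring.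
  apply: (@le_trans _ _ ((c1 * q) ^+ 2)).
    by apply: lerXn2r; rewrite ?nnegrE // ?(ltW W0) // (le_trans _ Wq) // ltW.
  by rewrite exprMn /k -mulrA ler_wpM2l // sqr_ge0.
have : W * ((k + 1 + c1) * D) < W * W by rewrite ltr_pM2l.
have : (1 + c1) * D * ((k + 1 + c1) * D) <= (1 + c1) * D * W.
  by rewrite ler_wpM2l // ?(ltW Wbig) // mulr_ge0 // addr_ge0.
have : 0 <= (1 + c1) * (1 + c1) * D ^+ 2.
  by rewrite mulr_ge0 ?sqr_ge0 // mulr_ge0 // addr_ge0.
by move: W2; clearbody W k; lra.
Qed.

End self_bound.

Section stability.
Context {R : realType} {X : completeNormedModType R} {d : X -> X -> R}.
Hypothesis dP : inner_product d.
Variables (T : R) (A : set (X * X)).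
Let As := adjoint_graph d A.
Let S := sg A.
Let S' := sg As.
Hypothesis T0 : 0 <= T.
Hypothesis A_generator : exists S : R -> X -> X, generates A S.
Hypothesis A_cases : As = A \/ As = opp_graph A.
Variables (b g : R -> X -> X -> X) (h : X -> X).
Variables (Pi : R -> X * X -> X * X) (M Mb Theta Q0 Qb : R -> X -> X).
Hypothesis G2P : G2 T b g h.
Hypothesis G3P : G3 T b g h.
Hypothesis saP : strongly_continuous_sa T d Pi.
Hypothesis dataP : lyapunov_data T d A Pi M Mb Theta Q0 Qb.
Variables (m1 m2 K : R).
Hypotheses (m10 : 0 <= m1) (m20 : 0 <= m2) (K0 : 0 < K).
Hypothesis run : running (d := d) b g T Pi M Mb Theta Q0 Qb m1 m2.
Hypothesis ter : terminal (d := d) h T Pi m1 K.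
Hypothesis ini : lyapunov_initial d K (Pi 0).

Lemma initial_bound z : pdot d (Pi 0 z) z <= K * `|z.1| ^+ 2.
Proof.
have := ini z; rewrite -[(_ + _) z]/(Pi 0 z + (- K *: z.1 + 0, 0 + 0)).
rewrite (pdotDl dP) /pdot /= addr0 addr0 (ip0l dP) addr0 (ipZl dP) (ipxx dP).
by move: (`|z.1| ^+ 2) (d _ _ + d _ _) => a c; lra.
Qed.

(** By the initial condition this block is nonpositive at time 0, and by the running condition
    with rho = 0 and z = (0, psi) it only decreases along the orbits of S' up to time T. *)
Lemma terminal_block_le0 w : d (Pi T (0, w)).2 w <= 0.
Proof.
have [gA gB dual inv] := dual_semigroups dP A_generator A_cases.
have [_ _ _ [_ _ _ lyapM]] := dataP.
have [CS' CS1' SP'] := C0_semigroup_on T gB.1.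
have TT : 0 <= T <= T by rewrite T0 lexx.
have OT : 0 <= (0 : R) <= T by rewrite lexx T0.
have := lyap_Pb dP dual lyapM SP' w w TT OT T0; rewrite sub0r normrN (ger0_norm T0).
rewrite hull_down // => hi.
have := integral_is_le (measurable_I _ _) _ (integral_is_cst 0 T0) hi.
rewrite mul0r subr_ge0 => hle.
have N0 s psi : 0 <= s <= T -> 0 <= d (N22 (d := d) Pi Mb Qb s psi) psi.
  move=> sT; have r01 : 0 <= (0 : R) <= 1 by rewrite lexx ler01.
  have := run 0 0 (0, psi) sT r01.
  rewrite (rest_blocks dP saP dataP) // /= mulr0 mul0r add0r.
  have -> : d_y g s 0 0 0 = 0 by exact: linear0.
  rewrite normr0 expr0n mulr0 (ip0r dP).
  have -> : N21 Pi M Mb Theta s 0 = 0.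
    have [[lPi _] _] := saP.1 s sT; have [mM mMb mTh _] := dataP.
    have l0 : linear (block21 (Pi s)).
      have [C hC] := Pi_bounded saP; have [_ f21 _] := block_bounds saP hC; exact: (f21 s sT).1.
    rewrite -[N21 _ _ _ _ _ _]/(Mb s (block21 (Pi s) 0) - block21 (Pi s) (M s 0) + Theta s 0).
    rewrite (lin0 (bounded_measurable_op mM sT).1) (lin0 l0).
    rewrite (lin0 (bounded_measurable_op mMb sT).1) (lin0 (bounded_measurable_op mTh sT).1).
    by rewrite subr0 addr0.
  rewrite (ip0l dP) => hrun; have := mulr_ge0 m20 (sqr_ge0 `|d_psi b s 0 0 psi|).
  by move: hrun; move: (m2 * _) (d (N22 _ _ _ _ _) _) => a c; lra.
have {}hle : d (Pi T (0, w)).2 w <= d (block22 (Pi 0) (S' T w)) (S' T w).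
  apply: hle => s; rewrite /= in_itv /= => sT; exact: N0.
apply: le_trans hle _; have := initial_bound (0, S' T w).
by rewrite /pdot /= normr0 expr0n mulr0 (ip0r dP) add0r.
Qed.

(** Coupling of strength rho, with forcing f1, f2 and h0: the two equations are independent of
    each other at rho = 0, and at rho = 1 with no forcing this is the forward-backward equation. *)
Definition solves (rho : R) (f1 f2 : R -> X) (h0 x : X) (y psi : R -> X) :=
  [/\ cont_on 0 T y /\ cont_on 0 T psi,
      mild (d := d) T true S y (fun s => rho *: b s (y s) (psi s) + f1 s),
      mild (d := d) T false S' psi (fun s => rho *: g s (y s) (psi s) + f2 s),
      y 0 = x & psi T = rho *: h (y T) + h0].

(** One constant for all the strengths rho of the coupling, as the continuation in rho requires. *)
Definition stable (c : R) :=
  forall rho f1 f2 h0 x y psi f1' f2' h0' x' y' psi', 0 <= rho <= 1 ->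
    cont_on 0 T f1 -> cont_on 0 T f2 -> cont_on 0 T f1' -> cont_on 0 T f2' ->
    solves rho f1 f2 h0 x y psi -> solves rho f1' f2' h0' x' y' psi' ->
  forall N D, integral_is `[0, T]%classic (fun s => `|f1' s - f1 s| + `|f2' s - f2 s|) N ->
    `|x' - x| <= D -> `|h0' - h0| <= D -> N <= D ->
  forall t, 0 <= t <= T -> `|(y' t - y t, psi' t - psi t)| <= c * D.

Lemma mild_sub fw (V : R -> X -> X) C u u' F F' : semigroup_on T C V ->
  mild (d := d) T fw V u F -> mild (d := d) T fw V u' F' ->
  mild (d := d) T fw V (fun t => u' t - u t) (fun s => F' s - F s).
Proof.
move=> [lV _ _ _ _] mu mu' p q w pT qT pq.
have mI : measurable (hull p q : set (measurableTypeR R)) by exact: measurable_I.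
have := integral_isB mI (mu' p q w pT qT pq) (mu p q w pT qT pq).
rewrite (linB (lV _ (normr_ge0 _))) !(ipBl dP).
have -> : forall p q r s : R, p - q - (r - s) = p - r - (q - s) by move=> *; ring.
by apply: integral_is_eq => // s _; rewrite (linB (lV _ (normr_ge0 _))) (ipBl dP).
Qed.

Lemma mild_eq fw (V : R -> X -> X) u F F' : (forall s, 0 <= s <= T -> F s = F' s) ->
  mild (d := d) T fw V u F -> mild (d := d) T fw V u F'.
Proof.
move=> FF mu p q w pT qT pq; have mI : measurable (hull p q : set (measurableTypeR R)) by exact: measurable_I.
apply: integral_is_eq (mu p q w pT qT pq) => // s; rewrite /hull /= in_itv /= => /(in_hull pT qT) sT.
by rewrite FF.
Qed.

Variables (L CPi : R).
Hypotheses (L0 : 0 <= L) (CPi0 : 0 <= CPi).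
Hypothesis PiC : forall t z, 0 <= t <= T -> `|Pi t z| <= CPi * `|z|.
Hypothesis lb : forall t y psi y' psi', 0 <= t <= T ->
  `|b t y psi - b t y' psi'| <= L * `|y - y'| + L * `|psi - psi'|.
Hypothesis lg : forall t y psi y' psi', 0 <= t <= T ->
  `|g t y psi - g t y' psi'| <= L * `|y - y'| + L * `|psi - psi'|.
Hypothesis lh : forall y y', `|h y - h y'| <= L * `|y - y'|.

(** The part of the increment of f that the Lipschitz dependence on e does not explain. *)
Definition excess (f : R -> X -> X -> X) (y psi y' psi' e : R -> X) (s : R) : R :=
  Num.max 0 (`|f s (y' s) (psi' s) - f s (y s) (psi s)| - L * `|e s|).

Section two_solutions.
Variables (rho : R) (f1 f2 f1' f2' : R -> X) (h0 h0' x x' : X) (y psi y' psi' : R -> X).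
Hypothesis rho01 : 0 <= rho <= 1.
Hypothesis sol : solves rho f1 f2 h0 x y psi.
Hypothesis sol' : solves rho f1' f2' h0' x' y' psi'.
Hypotheses (cf1 : cont_on 0 T f1) (cf2 : cont_on 0 T f2).
Hypotheses (cf1' : cont_on 0 T f1') (cf2' : cont_on 0 T f2').
Let eta t := y' t - y t.
Let zeta t := psi' t - psi t.
Let Db s := b s (y' s) (psi' s) - b s (y s) (psi s).
Let Dg s := g s (y' s) (psi' s) - g s (y s) (psi s).
Let n s := `|f1' s - f1 s| + `|f2' s - f2 s|.
Let r1 := excess g y psi y' psi' zeta.
Let r2 := excess b y psi y' psi' eta.

Lemma cont_differences : [/\ cont_on 0 T eta /\ cont_on 0 T zeta,
  cont_on 0 T Db /\ cont_on 0 T Dg & cont_on 0 T r1 /\ cont_on 0 T r2].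
Proof.
have [[cy cp] _ _ _ _] := sol; have [[cy' cp'] _ _ _ _] := sol'.
have [[cb cg _] _] := G2P.
have c1 : cont_on 0 T eta by exact: cont_onB.
have c2 : cont_on 0 T zeta by exact: cont_onB.
have c3 : cont_on 0 T Db by apply: cont_onB; exact: cont_on_path.
have c4 : cont_on 0 T Dg by apply: cont_onB; exact: cont_on_path.
have cx (f e : R -> X) : cont_on 0 T f -> cont_on 0 T e ->
    cont_on 0 T (fun s => Num.max 0 (`|f s| - L * `|e s|)).
  move=> cf ce; apply: cont_on_excess; first exact: cont_on_norm.
  exact: (cont_onZ L (cont_on_norm ce)).
by split; split => //; exact: cx.
Qed.

Lemma mild_eta : mild (d := d) T true S eta (fun s => rho *: Db s + (f1' s - f1 s)).
Proof.
have [gA gB dual inv] := dual_semigroups dP A_generator A_cases.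
have [C _ SP] := C0_semigroup_on T gA.1.
have [_ my _ _ _] := sol; have [_ my' _ _ _] := sol'.
apply: mild_eq (mild_sub SP my my') => s sT.
by rewrite /Db scalerBr opprD addrACA.
Qed.

Lemma mild_zeta : mild (d := d) T false S' zeta (fun s => rho *: Dg s + (f2' s - f2 s)).
Proof.
have [gA gB dual inv] := dual_semigroups dP A_generator A_cases.
have [C _ SP] := C0_semigroup_on T gB.1.
have [_ _ mp _ _] := sol; have [_ _ mp' _ _] := sol'.
apply: mild_eq (mild_sub SP mp mp') => s sT.
by rewrite /Dg scalerBr opprD addrACA.
Qed.

(** The energy decreases up to the work of the difference of the forcings; it is bounded above
    at 0 by the initial condition and below at T by the terminal one. *)
Lemma energy_estimate Z N D : (forall t, 0 <= t <= T -> `|(eta t, zeta t)| <= Z) ->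
  integral_is `[0, T]%classic n N -> `|x' - x| <= D -> `|h0' - h0| <= D -> N <= D ->
  exists p1 p2 q1 q2 : R,
    [/\ integral_is `[0, T]%classic r1 p1, integral_is `[0, T]%classic r2 p2,
        p1 ^+ 2 <= T * q1, p2 ^+ 2 <= T * q2 &
        m1 * `|h (y' T) - h (y T)| ^+ 2 + m1 * q1 + m2 * q2
          <= 2 * K * D ^+ 2 + 2 * CPi * Z * D].
Proof.
move=> hZ hN xD hD ND; have [[ceta czeta] [cDb cDg] [cr1 cr2]] := cont_differences.
have TT : 0 <= T <= T by rewrite T0 lexx.
have Z0 : 0 <= Z by exact: le_trans (normr_ge0 _) (hZ T TT).
have [p1 hp1] := cont_on_integral cr1; have [p2 hp2] := cont_on_integral cr2.
have [q1 hq1] := cont_on_integral (cont_on_sqr cr1).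
have [q2 hq2] := cont_on_integral (cont_on_sqr cr2).
exists p1, p2, q1, q2; split => //.
- by have := integral_is_sqr T0 hp1 hq1; rewrite subr0.
- by have := integral_is_sqr T0 hp2 hq2; rewrite subr0.
have cbnd (f : R -> X) : cont_on 0 T f -> exists C : R, bounded_by T C f.
  by move=> /cont_on_bounded[C [_ hC]]; exists C.
have en := energy_identity dP A_generator A_cases saP dataP mild_eta mild_zeta ceta czeta
  (cbnd _ (cont_onD (cont_onZ rho cDb) (cont_onB cf1' cf1)))
  (cbnd _ (cont_onD (cont_onZ rho cDg) (cont_onB cf2' cf2))).
have mI := measurable_I 0 T.
have ik := integral_isB mI (integral_isB mI (integral_isZ (2 * CPi * Z) mI hN)
  (integral_isZ m1 mI hq1)) (integral_isZ m2 mI hq2).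
have pt s : 0 <= s <= T ->
    rest (d := d) Pi M Mb Theta Q0 Qb s (eta s, zeta s)
      + 2 * pdot d (Pi s (eta s, zeta s))
           (rho *: Db s + (f1' s - f1 s), - (rho *: Dg s + (f2' s - f2 s)))
    <= 2 * CPi * Z * n s - m1 * r1 s ^+ 2 - m2 * r2 s ^+ 2.
  move=> sT; have Eb : Db s = b s (y s + eta s) (psi s + zeta s) - b s (y s) (psi s).
    by rewrite /eta /zeta !(addrC _ (_ - _)) !subrK.
  have Eg : Dg s = g s (y s + eta s) (psi s + zeta s) - g s (y s) (psi s).
    by rewrite /eta /zeta !(addrC _ (_ - _)) !subrK.
  have := running_increment dP G2P G3P m10 m20 L0 run lb lg sT rho01 Eb Eg.
  rewrite -/(excess _ _ _ _ _ _ _) -/(r1 s) -/(r2 s).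
  rewrite -[Num.max 0 (_ - L * `|zeta s|)]/(r1 s) -[Num.max 0 (_ - L * `|eta s|)]/(r2 s).
  have e1 : `|(Pi s (eta s, zeta s)).1| <= CPi * Z.
    apply: (@le_trans _ _ `|Pi s (eta s, zeta s)|); first by rewrite pair_normE le_max lexx.
    by apply: le_trans (PiC _ sT) _; rewrite ler_wpM2l // hZ.
  have e2 : `|(Pi s (eta s, zeta s)).2| <= CPi * Z.
    apply: (@le_trans _ _ `|Pi s (eta s, zeta s)|); first by rewrite pair_normE le_max lexx orbT.
    by apply: le_trans (PiC _ sT) _; rewrite ler_wpM2l // hZ.
  have := ip_le dP (Pi s (eta s, zeta s)).1 (f1' s - f1 s).
  have := ip_le dP (Pi s (eta s, zeta s)).2 (- (f2' s - f2 s)).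
  rewrite normrN.
  have := ler_wpM2r (normr_ge0 (f1' s - f1 s)) e1.
  have := ler_wpM2r (normr_ge0 (f2' s - f2 s)) e2.
  rewrite /n; move: (f1' s - f1 s) (f2' s - f2 s) => v1 v2.
  move: {Eb Eg} (Db s) (Dg s) => w1 w2.
  rewrite /pdot /= (ipNr dP _ v2) !(ipNr dP, ipDr dP) !(ipZr dP).
  move: (Pi s (eta s, zeta s)).1 (Pi s (eta s, zeta s)).2 => u v.
  move: (rest _ _ _ _ _ _ _ _) (m1 * r1 s ^+ 2) (m2 * r2 s ^+ 2) => R0 Q1 Q2.
  move: (d u w1) (d v w2) (d u v1) (d v v2) => a1 a2 a3 a4.
  move: `|v1| `|v2| `|u| `|v| => a5 a6 a7 a8.
  by lra.
have hE := almost_integral_le T0 en pt ik.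
have Ex : eta 0 = x' - x by rewrite /eta; have [_ _ _ -> _] := sol; have [_ _ _ -> _] := sol'.
have Ep : zeta T = rho *: (h (y' T) - h (y T)) + (h0' - h0).
  rewrite /zeta; have [_ _ _ _ ->] := sol; have [_ _ _ _ ->] := sol'.
  by rewrite scalerBr opprD addrACA.
have Eh : h (y' T) - h (y T) = h (y T + eta T) - h (y T) by rewrite /eta (addrC (y T)) subrK.
have := terminal_increment dP G3P saP T0 m10 ter terminal_block_le0 (h0' - h0) rho01 Eh.
rewrite -Ep; have := initial_bound (eta 0, zeta 0); rewrite /= Ex => hi ht.
rewrite /= Ex in hE.
have D0 : 0 <= D by exact: le_trans (normr_ge0 _) xD.
have s1 : K * `|x' - x| ^+ 2 <= K * D ^+ 2 by rewrite ler_pM2l // lerXn2r ?nnegrE.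
have s2 : K * `|h0' - h0| ^+ 2 <= K * D ^+ 2 by rewrite ler_pM2l // lerXn2r ?nnegrE.
have s3 : CPi * Z * N <= CPi * Z * D by rewrite ler_wpM2l // mulr_ge0.
move: hE hi ht s1 s2 s3.
move: (pdot _ _ _) => E1; move: (pdot _ _ _) => E2.
move: (K * `|_| ^+ 2) (K * `|_| ^+ 2) (m1 * `|_| ^+ 2) => k1 k2 k3.
move: (m1 * q1) (m2 * q2) => k4 k5.
by lra.
Qed.

Section growth_bounds.
Variables (C N D : R).
Hypotheses (C1 : 1 <= C) (SP : semigroup_on T C S) (SP' : semigroup_on T C S').
Hypotheses (hN : integral_is `[0, T]%classic n N) (ND : N <= D).
Hypotheses (xD : `|x' - x| <= D) (hD : `|h0' - h0| <= D).
Let G := growth (C * L * T) * C.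

Lemma growth_ge0 : 0 <= G.
Proof. by rewrite mulr_ge0 ?exprn_ge0 // (le_trans _ C1). Qed.

Let n0 s : 0 <= n s. Proof. by rewrite addr_ge0. Qed.
Let rho_norm (v : X) : `|rho *: v| <= `|v|.
Proof. by rewrite normrZ; case/andP: rho01 => r0 r1'; rewrite ger0_norm // ler_piMl. Qed.
Let excess0 f e s : 0 <= excess f y psi y' psi' e s.
Proof. by rewrite le_max lexx. Qed.
Let TT : 0 <= T <= T. Proof. by rewrite T0 lexx. Qed.
Let OT : 0 <= (0 : R) <= T. Proof. by rewrite lexx T0. Qed.

Let eta_start : `|eta 0| <= D.
Proof. by rewrite /eta; have [_ _ _ -> _] := sol; have [_ _ _ -> _] := sol'. Qed.
Let zeta_end : `|zeta T| <= `|h (y' T) - h (y T)| + D.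
Proof.
have -> : zeta T = rho *: (h (y' T) - h (y T)) + (h0' - h0).
  rewrite /zeta; have [_ _ _ _ ->] := sol; have [_ _ _ _ ->] := sol'.
  by rewrite scalerBr opprD addrACA.
by apply: le_trans (ler_normD _ _) _; apply: lerD.
Qed.

Lemma eta_growth a alpha : (forall s, 0 <= s <= T -> 0 <= a s) ->
  (forall s, 0 <= s <= T -> `|Db s| <= L * `|eta s| + a s) ->
  integral_is `[0, T]%classic a alpha ->
  forall t, 0 <= t <= T -> `|eta t| <= G * (2 * D + alpha).
Proof.
move=> a0 Da ia t tT; have [[ceta _] _ _] := cont_differences.
have ia' := integral_isD (measurable_I _ _) ia hN.
have := mild_gronwall dP C1 SP mild_eta ceta OT (fun s => fun h => proj1 (andP h)) L0 _ _ ia' tT.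
rewrite -/G => hg; apply: le_trans (hg _ _) _.
- by move=> s sT; rewrite addr_ge0 // a0.
- move=> s sT; apply: le_trans (ler_normD _ _) _; have := rho_norm (Db s); have := Da s sT.
  by rewrite /n; have := normr_ge0 (f2' s - f2 s);
    move: `|_ - _| `|_ - _| `|Db s| `|rho *: Db s| (L * _) => *; lra.
- rewrite ler_wpM2l ?growth_ge0 //; have := lerD eta_start ND.
  move: `|eta 0| => e0.
  lra.
Qed.

Lemma zeta_growth a alpha : (forall s, 0 <= s <= T -> 0 <= a s) ->
  (forall s, 0 <= s <= T -> `|Dg s| <= L * `|zeta s| + a s) ->
  integral_is `[0, T]%classic a alpha ->
  forall t, 0 <= t <= T -> `|zeta t| <= G * (`|h (y' T) - h (y T)| + 2 * D + alpha).
Proof.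
move=> a0 Da ia t tT; have [[_ czeta] _ _] := cont_differences.
have ia' := integral_isD (measurable_I _ _) ia hN.
have := mild_gronwall dP C1 SP' mild_zeta czeta TT (fun s => fun h => proj2 (andP h)) L0 _ _ ia' tT.
rewrite -/G => hg; apply: le_trans (hg _ _) _.
- by move=> s sT; rewrite addr_ge0 // a0.
- move=> s sT; apply: le_trans (ler_normD _ _) _; have := rho_norm (Dg s); have := Da s sT.
  by rewrite /n; have := normr_ge0 (f1' s - f1 s);
    move: `|_ - _| `|_ - _| `|Dg s| `|rho *: Dg s| (L * _) => *; lra.
- rewrite ler_wpM2l ?growth_ge0 //; have := lerD zeta_end ND.
  by move: `|zeta T| `|_ - _| => e0 e1; lra.
Qed.

(** For type I, the energy controls what zeta does not explain in the increment of g. Hence zeta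
    is estimated first, backward from T, and then serves as a forcing for eta. *)
Lemma difference_bound_I p1 : integral_is `[0, T]%classic r1 p1 -> forall t, 0 <= t <= T ->
  `|(eta t, zeta t)| <= 2 * G * (2 + G * L * (1 + T)) * (D + (`|h (y' T) - h (y T)| + p1)).
Proof.
move=> ip1; set q := `|_ - _| + p1; pose U := G * (q + 2 * D).
have G0 := growth_ge0.
have z t : 0 <= t <= T -> `|zeta t| <= U.
  have -> : U = G * (`|h (y' T) - h (y T)| + 2 * D + p1) by rewrite /U /q; ring.
  apply: zeta_growth ip1 t => s sT; first exact: excess0.
  rewrite addrC -lerBlDr /r1 /excess -/(Dg s); first by rewrite le_max lexx orbT.
have e t : 0 <= t <= T -> `|eta t| <= G * (2 * D + L * U * (T - 0)).
  have U0 : 0 <= U by exact: le_trans (z T TT).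
  apply: eta_growth (integral_is_cst (L * U) T0) t => s sT; first by rewrite mulr_ge0.
  have := lb (y' s) (psi' s) (y s) (psi s) sT.
  rewrite -/(Db s) -/(eta s) -/(zeta s) => h1; apply: le_trans h1 _.
  by rewrite lerD2l ler_wpM2l // z.
have D0 : 0 <= D by exact: le_trans (normr_ge0 _) xD.
have q0 : 0 <= q.
  rewrite addr_ge0 //; have := integral_is_le (measurable_I _ _) _ (integral_is_cst 0 T0) ip1.
  by rewrite mul0r; apply => s _; exact: excess0.
have GL : 0 <= G * L * (1 + T) by apply: mulr_ge0; [exact: mulr_ge0 | exact: addr_ge0].
have U0 : 0 <= U by rewrite mulr_ge0 // addr_ge0 // mulr_ge0.
have GU : G * L * T * U <= G * L * (1 + T) * U.
  by apply: ler_wpM2r => //; apply: ler_wpM2l; [exact: mulr_ge0 | rewrite lerDr].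
have u1 : U <= 2 * G * (D + q) by rewrite /U -mulrA mulrCA ler_wpM2l //; lra.
have d1 : 2 * G * D <= 2 * G * (D + q)  by apply: ler_wpM2l; [exact: mulr_ge0 | rewrite lerDl].
have gu := ler_wpM2l GL u1; have gq : 0 <= 2 * G * (D + q) by exact: le_trans u1.
have W : U + G * (2 * D + L * U * (T - 0)) <= 2 * G * (2 + G * L * (1 + T)) * (D + q).
  by move: GU u1 d1 gu; clearbody U q; lra.
move=> t tT; rewrite pair_normE ge_max /=; apply/andP; split; apply: le_trans W.
  by apply: le_trans (e t tT) _; rewrite lerDr.
by apply: le_trans (z t tT) _; rewrite lerDl (le_trans _ (e t tT)).
Qed.

(** For type II, the energy controls what eta does not explain in the increment of b. Hence eta
    is estimated first, forward from 0, and then zeta, whose final value is controlled by eta T. *)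
Lemma difference_bound_II p2 : integral_is `[0, T]%classic r2 p2 -> forall t, 0 <= t <= T ->
  `|(eta t, zeta t)| <= 2 * G * (2 + G * L * (1 + T)) * (D + p2).
Proof.
move=> ip2; pose U := G * (2 * D + p2); have G0 := growth_ge0.
have e t : 0 <= t <= T -> `|eta t| <= U.
  apply: eta_growth ip2 t => s sT; first exact: excess0.
  rewrite addrC -lerBlDr /r2 /excess -/(Db s); first by rewrite le_max lexx orbT.
have U0 : 0 <= U by exact: le_trans (e T TT).
have z t : 0 <= t <= T -> `|zeta t| <= G * (L * U + 2 * D + L * U * (T - 0)).
  move=> tT.
  have h1 : `|h (y' T) - h (y T)| <= L * U.
    by apply: le_trans (lh _ _) _; rewrite ler_wpM2l // e.
  have h2 : `|zeta t| <= G * (`|h (y' T) - h (y T)| + 2 * D + L * U * (T - 0)).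
    apply: zeta_growth (integral_is_cst (L * U) T0) t tT => s sT; first by rewrite mulr_ge0.
    have := lg (y' s) (psi' s) (y s) (psi s) sT.
    rewrite -/(Dg s) -/(eta s) -/(zeta s) => h3; apply: le_trans h3 _.
    by rewrite addrC lerD2l ler_wpM2l // e.
  by apply: le_trans h2 _; rewrite ler_wpM2l // !lerD2r.
have D0 : 0 <= D by exact: le_trans (normr_ge0 _) xD.
have q0 : 0 <= p2.
  have := integral_is_le (measurable_I _ _) _ (integral_is_cst 0 T0) ip2.
  by rewrite mul0r; apply => s _; exact: excess0.
have GL : 0 <= G * L * (1 + T) by apply: mulr_ge0; [exact: mulr_ge0 | exact: addr_ge0].
have u1 : U <= 2 * G * (D + p2) by rewrite /U -mulrA mulrCA ler_wpM2l //; lra.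
have d1 : 2 * G * D <= 2 * G * (D + p2) by apply: ler_wpM2l; [exact: mulr_ge0 | rewrite lerDl].
have gu := ler_wpM2l GL u1; have gq : 0 <= 2 * G * (D + p2) by exact: le_trans u1.
have W : U + G * (L * U + 2 * D + L * U * (T - 0)) <= 2 * G * (2 + G * L * (1 + T)) * (D + p2).
  by move: u1 d1 gu; clearbody U; lra.
move=> t tT; rewrite pair_normE ge_max /=; apply/andP; split; apply: le_trans W.
  by apply: le_trans (e t tT) _; rewrite lerDl (le_trans _ (z t tT)).
by apply: le_trans (z t tT) _; rewrite lerDr.
Qed.

End growth_bounds.
End two_solutions.

Hypothesis Tpos : 0 < T.

(** Let Z be the maximum of |(eta, zeta)| and q the quantity controlled by the energy. The
    Gronwall bounds give Z <= c1 (D + q), and the energy gives q^2 <= c3 (D^2 + Z D), whence Z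
    <= c D by self_bound. *)
Lemma stability_estimate : 0 < m1 \/ 0 < m2 -> exists2 c : R, 0 < c & stable c.
Proof.
move=> mpos.
have [gA gB dual inv] := dual_semigroups dP A_generator A_cases.
have [Ca Ca1 SPa] := C0_semigroup_on T gA.1; have [Cb Cb1 SPb] := C0_semigroup_on T gB.1.
pose C := Num.max Ca Cb; have C1 : 1 <= C by rewrite le_max Ca1.
have SP : semigroup_on T C S by apply: semigroup_on_mono SPa; rewrite le_max lexx.
have SP' : semigroup_on T C S' by apply: semigroup_on_mono SPb; rewrite le_max lexx orbT.
have [m mp hm] : exists2 m : R, 0 < m & (m = m1 \/ m = m2).
  by case: mpos => hmp; [exists m1 => //; left | exists m2 => //; right].
pose c1 := 2 * (growth (C * L * T) * C) * (2 + growth (C * L * T) * C * L * (1 + T)).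
pose c3 := 4 * (1 + T) * (K + CPi) / m.
have c10 : 0 <= c1.
  have G0 := growth_ge0 C1; rewrite /c1; apply: mulr_ge0; first exact: mulr_ge0.
  by rewrite addr_ge0 //; apply: mulr_ge0; [exact: mulr_ge0 | exact: addr_ge0].
have KC : 0 <= K + CPi by rewrite addr_ge0 // ltW.
have c30 : 0 <= c3 by rewrite divr_ge0 ?(ltW mp) // mulr_ge0 // mulr_ge0 // addr_ge0.
exists (2 * c1 + 1 + c1 ^+ 2 * c3).
  by have := mulr_ge0 (sqr_ge0 c1) c30; move: c10; clearbody c1 c3; lra.
move=> rho f1 f2 h0 x y psi f1' f2' h0' x' y' psi' r01 cf1 cf2 cf1' cf2' sol sol' N D hN xD hD ND.
have D0 : 0 <= D by exact: le_trans (normr_ge0 _) xD.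
have [[ceta czeta] _ _] := cont_differences sol sol'.
have [Z [Z0 hZ Zmin]] := cont_on_max T0 (cont_on_pair ceta czeta).
have [p1 [p2 [q1 [q2 [i1 i2 pq1 pq2 en]]]]] :=
  energy_estimate r01 sol sol' cf1 cf2 cf1' cf2' hZ hN xD hD ND.
have q10 : 0 <= q1 by rewrite -(pmulr_rge0 _ Tpos) (le_trans _ pq1) ?sqr_ge0.
have q20 : 0 <= q2 by rewrite -(pmulr_rge0 _ Tpos) (le_trans _ pq2) ?sqr_ge0.
have B : 2 * K * D ^+ 2 + 2 * CPi * Z * D <= 2 * (K + CPi) * (D ^+ 2 + Z * D).
  have a1 : 0 <= K * (Z * D) by rewrite mulr_ge0 ?(ltW K0) // mulr_ge0.
  have a2 : 0 <= CPi * D ^+ 2 by rewrite mulr_ge0 // sqr_ge0.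
  by move: a1 a2; lra.
have [q Zq qq] : exists2 q, Z <= c1 * (D + q) & m * q ^+ 2 <= 2 * (1 + T) * (2 * K * D ^+ 2 + 2 * CPi * Z * D).
  move: en; set e := 2 * K * _ + _; set H := `|h _ - h _| => en.
  have H0 : 0 <= H ^+ 2 by exact: sqr_ge0.
  have mq1 := mulr_ge0 m10 q10; have mq2 := mulr_ge0 m20 q20; have mH := mulr_ge0 m10 H0.
  have e0 : 0 <= e by move: en mq1 mq2 mH; clearbody e H; lra.
  have Te : 0 <= T * e by exact: mulr_ge0.
  case: hm => mE.
    exists (H + p1).
      apply: Zmin; apply: (difference_bound_I r01 sol sol' C1 SP SP' hN ND xD hD i1).
    have h1 : (H + p1) ^+ 2 <= 2 * H ^+ 2 + 2 * (T * q1).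
      have := sqr_ge0 (H - p1); move: pq1; clearbody H; lra.
    have h2 : m1 * (H + p1) ^+ 2 <= 2 * (m1 * H ^+ 2) + 2 * (T * (m1 * q1)).
      by have := ler_wpM2l m10 h1; clearbody H; lra.
    have h3 : T * (m1 * q1) <= T * e.
      by rewrite ler_wpM2l //; move: en mq2 mH; clearbody e H; lra.
    rewrite mE; move: h2 h3 en mq1 mq2; clearbody e H; lra.
  exists p2; first by apply: Zmin; apply: (difference_bound_II r01 sol sol' C1 SP SP' hN ND xD hD i2).
  have h2 : m2 * p2 ^+ 2 <= T * (m2 * q2) by rewrite (mulrCA T); apply: ler_wpM2l.
  have h3 : T * (m2 * q2) <= T * e.
    by rewrite ler_wpM2l //; move: en mq1 mH; clearbody e H; lra.
  rewrite mE; move: h2 h3 e0 Te; clearbody e H; lra.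
have qq' : q ^+ 2 <= c3 * (D ^+ 2 + Z * D).
  rewrite /c3 mulrAC ler_pdivlMr // mulrC; apply: le_trans qq _.
  have -> : 4 * (1 + T) * (K + CPi) * (D ^+ 2 + Z * D) =
     2 * (1 + T) * (2 * (K + CPi) * (D ^+ 2 + Z * D)) by ring.
  by apply: ler_wpM2l => //; rewrite mulr_ge0 // addr_ge0.
move=> t tT; apply: le_trans (hZ t tT) _; exact: self_bound D0 c10 c30 Zq qq'.
Qed.

End stability.

(** * Existence of mild orbits *)

Section mild_existence.
Context {R : realType} {X : completeNormedModType R} {d : X -> X -> R}.
Hypothesis dP : inner_product d.
Variables (T C : R).
Hypotheses (T0 : 0 <= T) (C1 : 1 <= C).
Variables (S S' : R -> X -> X).
Hypothesis SP : semigroup_on T C S.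
Hypothesis dual : forall (t : R) x w, 0 <= t -> d (S t x) w = d x (S' t w).

Lemma orbit_cont x : cont_on 0 T (S ^~ x).
Proof.
move=> s sT e e0; have [lS bS S0 SD c] := SP; have C0 : 0 < C by exact: lt_le_trans C1.
have [r r0 hr] := c x (e / C) (divr_gt0 e0 C0); exists r => // t tT ts.
have key p q : 0 <= p -> p <= q -> q <= T -> q - p < r -> `|S q x - S p x| <= e.
  move=> p0 pq qT qpr; have -> : S q x - S p x = S p (S (q - p) x - x).
    by rewrite (linB (lS _ p0)) -SD ?subr_ge0 // (addrC p) subrK.
  apply: le_trans (bS _ _ _) _; first by rewrite p0 (le_trans pq).
  by rewrite mulrC -ler_pdivlMr // hr // subr_ge0 pq.
move: sT tT => /andP[s0 sT] /andP[t0 tT]; have [st|st] := leP s t.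
  by apply: key => //; rewrite -(ger0_norm (x := t - s)) ?subr_ge0.
rewrite distrC; apply: key => //; first exact: ltW.
by rewrite -(gtr0_norm (x := s - t)) ?subr_gt0 // distrC.
Qed.

Lemma convolution_cont F (t a b : R) : 0 <= t <= T -> 0 <= a -> b <= T -> cont_on 0 T F ->
  cont_on a b (fun s => S `|t - s| (F s)).
Proof.
move=> tT a0 bT cF s /andP[as_ sb] e e0; have [lS bS _ _ _] := SP.
have sT : 0 <= s <= T by rewrite (le_trans a0) ?(le_trans sb).
have C0 : 0 < C by exact: lt_le_trans C1.
have e2 : 0 < e / 2 by rewrite divr_gt0.
have [r1 r10 h1] := orbit_cont (F s) (dist_le sT tT) e2.
have [r2 r20 h2] := cF s sT _ (divr_gt0 e2 C0).
exists (Num.min r1 r2); first by rewrite lt_min r10.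
move=> q /andP[aq qb]; rewrite lt_min => /andP[q1 q2].
have qT : 0 <= q <= T by rewrite (le_trans a0) ?(le_trans qb).
have qtT := dist_le qT tT.
have -> : S `|t - q| (F q) - S `|t - s| (F s) =
    S `|t - q| (F q - F s) + (S `|t - q| (F s) - S `|t - s| (F s)).
  by rewrite (linB (lS _ (normr_ge0 _))) addrA subrK.
apply: le_trans (ler_normD _ _) _; rewrite [leRHS]splitr; apply: lerD.
  by apply: le_trans (bS _ _ qtT) _; rewrite mulrC -ler_pdivlMr // h2.
apply: h1 => //; apply: le_lt_trans q1.
by apply: le_trans (ler_dist_dist _ _) _; rewrite opprB addrCA addrAC subrr add0r distrC.
Qed.

(** The formula between two times expresses the later value by the earlier one. Continuity at s
    from the earlier side therefore uses a common starting time m before s and t. *)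
Lemma mild_cont fw u F o : mild (d := d) T fw S u F -> bounded_by T C F ->
  0 <= o <= T -> (forall t, 0 <= t <= T -> before fw o t) -> cont_on 0 T u.
Proof.
move=> mu bF oT ob s sT e e0; have C0 : 0 < C by exact: lt_le_trans C1.
(* u s and u t are both close to the orbit of u m under S, for m slightly before s *)
have e4 : 0 < e / (4 * C * C) by rewrite divr_gt0 // mulr_gt0 // mulr_gt0.
have eE : C * C * (e / (4 * C * C)) = e / 4 by field; rewrite gt_eqF.
have e2 : 0 < e / 4 by rewrite divr_gt0.
have [m [mT ms dms [r r0 hr]]] : exists m, [/\ 0 <= m <= T, before fw m s,
    `|s - m| <= e / (4 * C * C) & exists2 r : R, 0 < r & forall t, 0 <= t <= T ->
      `|t - s| < r -> before fw m t].
  have [so|so] := eqVneq s o.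
    exists o; rewrite so subrr normr0; split=> //; [exact: ob | exact: ltW|].
    by exists 1 => // t tT _; exact: ob.
  pose k := Num.min 1 (e / (4 * C * C) / (T + 1)).
  have T1 : 0 < T + 1 by rewrite ltr_wpDl.
  have k0 : 0 < k by rewrite lt_min ltr01 divr_gt0.
  have k1 : k <= 1 by rewrite ge_min lexx.
  have kT : k * T <= e / (4 * C * C).
    have : k <= e / (4 * C * C) / (T + 1) by rewrite ge_min lexx orbT.
    by rewrite ler_pdivlMr //; have := T0; lra.
  have dos := dist_le oT sT; have {}ob := ob s sT.
  have abs0 : 0 < `|s - o| by rewrite normr_gt0 subr_eq0.
  have kd : k * `|s - o| <= k * T by apply: ler_wpM2l; [exact: ltW | case/andP: dos].
  have kd1 : k * `|s - o| <= `|s - o| by rewrite ler_piMl.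
  have kd0 : 0 < k * `|s - o| by rewrite mulr_gt0.
  have le_ab : forall p q : R, p <= q -> `|q - p| = q - p.
    by move=> p q pq; rewrite ger0_norm // subr_ge0.
  move: ob oT sT => /= ob /andP[p0 oT] /andP[s0 sT].
  exists (if fw then s - k * `|s - o| else s + k * `|s - o|).
  case: (fw) ob => /= ob.
    rewrite !(le_ab _ _ ob) in kd kd1 kd0 *; split.
    - by apply/andP; split; lra.
    - by rewrite lerBlDr lerDl ltW.
    - by rewrite opprB addrC subrK ger0_norm ?(ltW kd0) // (le_trans kd).
    - by exists (k * (s - o)) => // t _; rewrite ltr_norml => /andP[]; lra.
  rewrite distrC (le_ab _ _ ob) in kd kd1 kd0 *; split.
  - by apply/andP; split; lra.
  - by rewrite lerDl ltW.
  - by rewrite opprD addrA subrr sub0r normrN ger0_norm ?(ltW kd0) // (le_trans kd).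
  - by exists (k * (o - s)) => // t _; rewrite ltr_norml => /andP[]; lra.
have [r' r'0 hr'] := orbit_cont (u m) (dist_le mT sT) e2.
exists (Num.min r (Num.min r' (e / (4 * C * C)))); first by rewrite !lt_min r0 r'0.
move=> t tT; rewrite !lt_min => /and3P[t1 t2 t3].
have mt := hr t tT t1.
have c1 := mild_close dP C1 SP mu bF mT sT ms; have c2 := mild_close dP C1 SP mu bF mT tT mt.
have CC : 0 <= C * C by rewrite mulr_ge0 // ltW.
have a1 : C * C * `|s - m| <= e / 4 by rewrite -eE ler_wpM2l.
have a2 : C * C * `|t - m| <= e / 4 + e / 4.
  rewrite -eE -mulrDr; apply: ler_wpM2l => //.
  have -> : t - m = (t - s) + (s - m) by rewrite addrA subrK.
  by apply: le_trans (ler_normD _ _) _; apply: lerD => //; exact: ltW.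
have a3 : `|S `|t - m| (u m) - S `|s - m| (u m)| <= e / 4.
  apply: hr'; first exact: dist_le.
  by apply: le_lt_trans t2; apply: le_trans (ler_dist_dist _ _) _; rewrite opprB addrA subrK.
have -> : u t - u s = (u t - S `|t - m| (u m)) + (S `|t - m| (u m) - S `|s - m| (u m))
    - (u s - S `|s - m| (u m)) by rewrite addrA subrK opprB addrA subrK.
apply: le_trans (ler_normB _ _) _; apply: le_trans (lerD (ler_normD _ _) (lexx _)) _.
apply: le_trans (lerD (lerD (le_trans c2 a2) a3) (le_trans c1 a1)) _; lra.
Qed.

Lemma mild_bochner fw o F x : 0 <= o <= T -> (forall t, 0 <= t <= T -> before fw o t) ->
  cont_on 0 T F -> exists v : R -> X,
  (forall t, 0 <= t <= T -> has_bochner_integral (hull o t) (fun s => S `|t - s| (F s)) (v t)) /\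
  mild (d := d) T fw S (fun t => S `|t - o| x + v t) F.
Proof.
move=> oT ob cF.
have /choice[v hv] : forall t, exists v, 0 <= t <= T ->
    has_bochner_integral (hull o t) (fun s => S `|t - s| (F s)) v.
  move=> t; have [tT|_] := boolP (0 <= t <= T); last by exists 0.
  have h2 : Num.min o t <= Num.max o t by rewrite le_max !ge_min lexx.
  have h1 : 0 <= Num.min o t by rewrite le_min; case/andP: oT => ->; case/andP: tT.
  have h3 : Num.max o t <= T by rewrite ge_max; case/andP: oT => _ ->; case/andP: tT.
  by have [v hv] := cont_bochner dP h2 (convolution_cont tT h1 h3 cF); exists v.
exists v; split => //; apply: (mild_of_anchor (a := o) (x := x) SP dual) => // t w tT.
rewrite (ipDl dP) addrAC subrr add0r; apply: (bochner_weak dP) (hv t tT).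
by rewrite le_max !ge_min lexx.
Qed.

End mild_existence.

Lemma mild_exists {R : realType} {X : completeNormedModType R} {d : X -> X -> R}
  (dP : inner_product d) (T C : R) (S S' : R -> X -> X) fw o F x :
  1 <= C -> semigroup_on T C S -> (forall (t : R) x w, 0 <= t -> d (S t x) w = d x (S' t w)) ->
  0 <= o <= T -> (forall t, 0 <= t <= T -> before fw o t) ->
  cont_on 0 T F -> exists u, [/\ cont_on 0 T u, mild (d := d) T fw S u F & u o = x].
Proof.
move=> C1 SP dual oT ob cF; have T0 : 0 <= T by case/andP: oT => h; exact: le_trans h.
have [v [hv mv]] := mild_bochner dP C1 SP dual x oT ob cF.
exists (fun t => S `|t - o| x + v t); split => //.
  have [CF [_ hF]] := cont_on_bounded cF.
  have C1' : 1 <= Num.max C CF by rewrite le_max C1.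
  have SP' : semigroup_on T (Num.max C CF) S by apply: semigroup_on_mono SP; rewrite le_max lexx.
  apply: (mild_cont dP T0 C1' SP' mv _ oT ob) => t tT.
  by rewrite le_max hF // orbT.
have [_ _ S0 _ _] := SP; rewrite subrr normr0 S0 -[RHS]addr0; congr (_ + _).
apply: (ip_ext dP) => w; rewrite (ip0l dP).
have h : integral_is `[o, o]%classic (fun s => d (S `|o - s| (F s)) w) (d (v o) w).
  by apply: (bochner_weak dP) => //; have := hv o oT; rewrite /hull minxx maxxx.
have := integral_is_cat (lexx o) (lexx o) h h.
by move=> /(integral_is_uniq (measurable_I _ _) h); lra.
Qed.

(** * Continuation in the strength of the coupling *)

Section continuation.
Context {R : realType} {X : completeNormedModType R} {d : X -> X -> R}.
Hypothesis dP : inner_product d.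
Variables (T : R) (A : set (X * X)).
Let As := adjoint_graph d A.
Let S := sg A.
Let S' := sg As.
Hypothesis T0 : 0 <= T.
Hypothesis A_generator : exists S : R -> X -> X, generates A S.
Hypothesis A_cases : As = A \/ As = opp_graph A.
Variables (b g : R -> X -> X -> X) (h : X -> X) (L c : R).
Hypotheses (cb : jointly_continuous T b) (cg : jointly_continuous T g).
Hypotheses (L0 : 0 <= L) (c0 : 0 < c).
Hypothesis lb : forall t y psi y' psi', 0 <= t <= T ->
  `|b t y psi - b t y' psi'| <= L * `|y - y'| + L * `|psi - psi'|.
Hypothesis lg : forall t y psi y' psi', 0 <= t <= T ->
  `|g t y psi - g t y' psi'| <= L * `|y - y'| + L * `|psi - psi'|.
Hypothesis lh : forall y y', `|h y - h y'| <= L * `|y - y'|.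
Local Notation solves := (solves (d := d) T A b g h).
Hypothesis stab : stable (d := d) T A b g h c.

Definition solvable (rho : R) := forall f1 f2 h0 x, cont_on 0 T f1 -> cont_on 0 T f2 ->
  exists y psi, solves rho f1 f2 h0 x y psi.

Let TT : 0 <= T <= T. Proof. by rewrite T0 lexx. Qed.
Let OT : 0 <= (0 : R) <= T. Proof. by rewrite lexx T0. Qed.

Lemma solvable0 : solvable 0.
Proof.
move=> f1 f2 h0 x cf1 cf2.
have [gA gB dual inv] := dual_semigroups dP A_generator A_cases.
have [Ca Ca1 SPa] := C0_semigroup_on T gA.1; have [Cb Cb1 SPb] := C0_semigroup_on T gB.1.
have [y [cy my y0]] := mild_exists dP (fw := true) (o := 0) x Ca1 SPa dual OT
  (fun s hs => proj1 (andP hs)) cf1.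
have [psi [cp mp pT]] := mild_exists dP (fw := false) (o := T) h0 Cb1 SPb (dual_sym dP dual) TT
  (fun s hs => proj2 (andP hs)) cf2.
exists y, psi; split => //.
- by apply: mild_eq my => s sT; rewrite scale0r add0r.
- by apply: mild_eq mp => s sT; rewrite scale0r add0r.
- by rewrite scale0r add0r.
Qed.

Section step.
Variables (rho e : R).
Hypotheses (rho0 : 0 <= rho) (e0 : 0 <= e) (rho1 : rho + e <= 1).
Hypothesis small : 2 * (c * (e * (L * (4 * T + 1)))) <= 1.
Variables (f1 f2 : R -> X) (h0 x : X).
Hypotheses (cf1 : cont_on 0 T f1) (cf2 : cont_on 0 T f2).

(** One Picard iteration from rho to rho + e: the additional coupling, of strength e, is
    evaluated along z. *)
Definition picard (z w : R -> X * X) :=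
  solves rho (fun s => f1 s + e *: b s (z s).1 (z s).2) (fun s => f2 s + e *: g s (z s).1 (z s).2)
    (h0 + e *: h (z T).1) x (fun t => (w t).1) (fun t => (w t).2).

Let cont_fst (z : R -> X * X) : cont_on 0 T z -> cont_on 0 T (fun t => (z t).1).
Proof. by apply: (cont_onP (k := fst)) => p; exact: cvg_fst. Qed.
Let cont_snd (z : R -> X * X) : cont_on 0 T z -> cont_on 0 T (fun t => (z t).2).
Proof. by apply: (cont_onP (k := snd)) => p; exact: cvg_snd. Qed.

Let forced_cont (f : R -> X) (k : R -> X -> X -> X) (z : R -> X * X) : jointly_continuous T k -> cont_on 0 T f -> cont_on 0 T z ->
  cont_on 0 T (fun s => f s + e *: k s (z s).1 (z s).2).
Proof.
move=> ck cf cz; apply: cont_onD => //; apply: cont_onZ.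
by apply: cont_on_path => //; [exact: cont_fst | exact: cont_snd].
Qed.

Lemma picard_cont z w : picard z w -> cont_on 0 T w.
Proof.
move=> [[c1 c2] _ _ _ _]; apply: cont_on_eq (cont_on_pair c1 c2) => t _.
by case: (w t).
Qed.

(** Replacing z by z' changes the forcing by a multiple of e |z' - z|, and stability turns this
    into at most half of |z' - z|. *)
Lemma picard_contraction z z' w w' B : cont_on 0 T z -> cont_on 0 T z' ->
  picard z w -> picard z' w' -> (forall t, 0 <= t <= T -> `|z' t - z t| <= B) ->
  forall t, 0 <= t <= T -> `|w' t - w t| <= B / 2.
Proof.
move=> cz cz' pw pw' zB t tT; have B0 : 0 <= B by exact: le_trans (normr_ge0 _) (zB T TT).
have r01 : 0 <= rho <= 1 by rewrite rho0 /= (le_trans _ rho1) // lerDl.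
have cN : cont_on 0 T (fun s => `|f1 s + e *: b s (z' s).1 (z' s).2 - (f1 s + e *: b s (z s).1 (z s).2)|
    + `|f2 s + e *: g s (z' s).1 (z' s).2 - (f2 s + e *: g s (z s).1 (z s).2)|).
  by apply: cont_onD; apply: cont_on_norm; apply: cont_onB; exact: forced_cont.
have [N hN] := cont_on_integral cN.
have comp s : 0 <= s <= T -> `|(z' s).1 - (z s).1| <= B /\ `|(z' s).2 - (z s).2| <= B.
  by move=> sT; have := zB s sT; rewrite pair_normE ge_max => /andP.
have frz (k : R -> X -> X -> X) (f : R -> X) s : 0 <= s <= T ->
   (forall t y psi y' psi', 0 <= t <= T ->
      `|k t y psi - k t y' psi'| <= L * `|y - y'| + L * `|psi - psi'|) ->
   `|f s + e *: k s (z' s).1 (z' s).2 - (f s + e *: k s (z s).1 (z s).2)| <= e * (2 * L * B).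
  move=> sT lk; rewrite opprD addrACA subrr add0r -scalerBr normrZ (ger0_norm e0).
  rewrite ler_wpM2l //; apply: le_trans (lk _ _ _ _ _ sT) _.
  have [h1 h2] := comp s sT; have := ler_wpM2l L0 h1; have := ler_wpM2l L0 h2.
  by move: (L * `|_|) (L * `|_|) => a1 a2; lra.
pose D := e * (L * (4 * T + 1)) * B.
have eLB : 0 <= e * L * B by rewrite !mulr_ge0.
have eLBT : 0 <= e * L * B * T by rewrite mulr_ge0.
have ND : N <= D.
  have hcst := integral_is_cst (e * (2 * L * B) + e * (2 * L * B)) T0.
  have := integral_is_le (measurable_I _ _) _ hN hcst.
  have hp s : `[0, T]%classic s ->
    `|f1 s + e *: b s (z' s).1 (z' s).2 - (f1 s + e *: b s (z s).1 (z s).2)|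
    + `|f2 s + e *: g s (z' s).1 (z' s).2 - (f2 s + e *: g s (z s).1 (z s).2)|
     <= e * (2 * L * B) + e * (2 * L * B).
    by rewrite /= in_itv /= => sT; apply: lerD; exact: frz.
  by move=> /(_ hp) h1; apply: le_trans h1 _; move: eLB; rewrite /D; lra.
have hD : `|h0 + e *: h (z' T).1 - (h0 + e *: h (z T).1)| <= D.
  rewrite opprD addrACA subrr add0r -scalerBr normrZ (ger0_norm e0).
  have := lh (z' T).1 (z T).1; have [h1 _] := comp T TT => h2.
  have := ler_wpM2l e0 (le_trans h2 (ler_wpM2l L0 h1)) => h3.
  by apply: le_trans h3 _; move: eLBT; rewrite /D; lra.
have D0 : 0 <= D by rewrite !mulr_ge0 // addr_ge0 // mulr_ge0.
have xD : `|x - x| <= D by rewrite subrr normr0.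
have := stab r01 (forced_cont cb cf1 cz) (forced_cont cg cf2 cz) (forced_cont cb cf1 cz')
  (forced_cont cg cf2 cz') pw pw' hN xD hD ND tT.
have -> : ((w' t).1 - (w t).1, (w' t).2 - (w t).2) = w' t - w t by case: (w' t) (w t) => ? ? [].
move=> h1; apply: le_trans h1 _; have := ler_wpM2r B0 small; rewrite /D.
by move: (e * (L * _)) => q; lra.
Qed.

(** The iterates converge uniformly to some w. That Phi w = w follows from the contraction, both
    being close to the iterates, so no limit is taken in the integral formulas. *)
Lemma picard_fixpoint (z : R -> X * X) : cont_on 0 T z -> solvable rho ->
  exists y psi, solves (rho + e) f1 f2 h0 x y psi.
Proof.
move=> cz sv.
have /choice[Phi hPhi] : forall z : R -> X * X, exists w, cont_on 0 T z -> picard z w.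
  move=> z'; have [cz'|nz'] := pselect (cont_on 0 T z'); last by exists z'.
  have [y [psi hy]] := sv _ _ (h0 + e *: h (z' T).1) x (forced_cont cb cf1 cz') (forced_cont cg cf2 cz').
  by exists (fun t => (y t, psi t)).
pose u n := iter n Phi z.
have cu n : cont_on 0 T (u n) by elim: n => // n IH; exact: picard_cont (hPhi _ IH).
have [B [B0 hB _]] := cont_on_max T0 (cont_onB (cu 1%N) (cu 0%N)).
have step n : forall t, 0 <= t <= T -> `|u n.+1 t - u n t| <= B / 2 ^+ n.
  elim: n => [|n IH] t tT; first by rewrite expr0 divr1; exact: hB.
  have := picard_contraction (cu n) (cu n.+1) (hPhi _ (cu n)) (hPhi _ (cu n.+1)) IH tT.
  by rewrite exprSr invfM mulrA.
have pow n : 0 < 2 ^+ n :> R by rewrite exprn_gt0.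
have tail n k t : 0 <= t <= T -> `|u (n + k)%N t - u n t| <= 2 * B / 2 ^+ n - 2 * B / 2 ^+ (n + k).
  move=> tT; elim: k => [|k IH]; first by rewrite addn0 !subrr normr0.
  have -> : u (n + k.+1)%N t - u n t = (u (n + k).+1 t - u (n + k)%N t) + (u (n + k)%N t - u n t).
    by rewrite addnS addrA subrK.
  apply: le_trans (ler_normD _ _) _; have := step (n + k)%N t tT.
  have -> : 2 * B / 2 ^+ (n + k.+1) = B / 2 ^+ (n + k).
    rewrite addnS exprS; have := pow (n + k)%N; move: (2 ^+ _) => q q0.
    by field; rewrite gt_eqF.
  by move: IH; move: `|_ - _| `|_ - _| (B / 2 ^+ n) => p1 p2 p3; lra.
have tail' n m t : (n <= m)%N -> 0 <= t <= T -> `|u m t - u n t| <= 2 * B / 2 ^+ n.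
  move=> nm tT; have := tail n (m - n)%N t tT; rewrite subnKC // => h1.
  by apply: le_trans h1 _; rewrite lerBlDr lerDl divr_ge0 // ?mulr_ge0 // ltW.
have small_tail eps : 0 < eps -> exists n, 2 * B / 2 ^+ n <= eps.
  move=> eps0; exists (Num.truncn (2 * B / eps)).+1; set n := (Num.truncn _).+1.
  have B2 : 0 <= 2 * B / eps by rewrite divr_ge0 ?mulr_ge0 // ltW.
  have /truncn_itv/andP[_ h1] := B2.
  have h2 : n%:R <= 2 ^+ n :> R by rewrite -natrX ler_nat ltnW // ltn_expl.
  rewrite ler_pdivrMr // [eps * _]mulrC -ler_pdivrMr //; exact: le_trans (ltW h1) h2.
have lim1 t : exists w : X * X, 0 <= t <= T -> forall n, `|u n t - w| <= 2 * B / 2 ^+ n.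
  have [tT|_] := boolP (0 <= t <= T); last by exists 0.
  have comp n m : (n <= m)%N -> `|(u n t).1 - (u m t).1| <= 2 * B / 2 ^+ n /\
      `|(u n t).2 - (u m t).2| <= 2 * B / 2 ^+ n.
    by move=> nm; have := tail' n m t nm tT; rewrite distrC pair_normE ge_max => /andP.
  have [w1 h1] := @cauchy_rate_limit R X (fun n => (u n t).1) _ (fun n m nm => (comp n m nm).1) small_tail.
  have [w2 h2] := @cauchy_rate_limit R X (fun n => (u n t).2) _ (fun n m nm => (comp n m nm).2) small_tail.
  by exists (w1, w2) => _ n; rewrite pair_normE ge_max h1 h2.
have /choice[w hw] := lim1.
have cw : cont_on 0 T w.
  move=> s sT eps eps0; have e3 : 0 < eps / 3 by rewrite divr_gt0.
  have [n hn] := small_tail _ e3; have [r r0 hr] := cu n s sT _ e3; exists r => // t tT ts.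
  have -> : w t - w s = (u n t - u n s) - (u n t - w t) + (u n s - w s).
    by rewrite opprB [u n t - _ + _]addrC !addrA !subrK.
  apply: le_trans (ler_normD _ _) _; apply: le_trans (lerD (ler_normB _ _) (lexx _)) _.
  have a1 := hr t tT ts; have a2 := le_trans (hw t tT n) hn; have a3 := le_trans (hw s sT n) hn.
  by apply: le_trans (lerD (lerD a1 a2) a3) _; lra.
have pw := hPhi w cw.
have fix_w t : 0 <= t <= T -> Phi w t = w t.
  move=> tT; apply/eqP; rewrite -subr_eq0 -normr_le0; apply/ler_addgt0Pr => eps eps0; rewrite add0r.
  have [n hn] := small_tail _ (divr_gt0 eps0 (ltr0n _ 2)).
  have hwn s : 0 <= s <= T -> `|w s - u n s| <= 2 * B / 2 ^+ n by move=> sT; rewrite distrC hw.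
  have a1 := picard_contraction (cu n) cw (hPhi _ (cu n)) pw hwn tT.
  have a2 := hw t tT n.+1; rewrite exprSr invfM mulrA in a2.
  have -> : Phi w t - w t = (Phi w t - u n.+1 t) + (u n.+1 t - w t) by rewrite addrA subrK.
  apply: le_trans (ler_normD _ _) _; apply: le_trans (lerD a1 a2) _.
  by move: hn; move: (2 * B / _) => q; lra.
exists (fun t => (Phi w t).1), (fun t => (Phi w t).2).
have [[c1 c2] m1 m2 i1 i2] := pw; split => //.
- apply: mild_eq m1 => s sT; rewrite -fix_w // scalerDl -!addrA; congr (_ + _); exact: addrC.
- apply: mild_eq m2 => s sT; rewrite -fix_w // scalerDl -!addrA; congr (_ + _); exact: addrC.
- by rewrite i2 -fix_w // scalerDl -!addrA; congr (_ + _); exact: addrC.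
Qed.

End step.

(** The step e is the same at every rho, so finitely many steps lead from 0 to 1. *)
Lemma solvable1 : solvable 1.
Proof.
have k0 : 0 <= 2 * (c * (L * (4 * T + 1))).
  by rewrite mulr_ge0 // mulr_ge0 ?(ltW c0) // mulr_ge0 // addr_ge0 // mulr_ge0.
have /truncn_itv/andP[_ hN] := k0; set N := (Num.truncn _).+1 in hN.
have N0 : 0 < N%:R :> R by rewrite ltr0n.
have key (k : nat) : (k <= N)%N -> solvable (k%:R / N%:R).
  elim: k => [|k IH] kN; first by rewrite mul0r; exact: solvable0.
  move=> f1 f2 h0 x cf1 cf2; rewrite -natr1 mulrDl mul1r.
  apply: (@picard_fixpoint (k%:R / N%:R) N%:R^-1 _ _ _ _ _ _ _ _ cf1 cf2 (fun=> 0)) => //.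
  - by rewrite -{2}[N%:R^-1]mul1r -mulrDl natr1 ler_pdivrMr // mul1r ler_nat.
  - rewrite (_ : 2 * _ = 2 * (c * (L * (4 * T + 1))) / N%:R); last by ring.
    by rewrite ler_pdivrMr // mul1r ltW.
  - exact: cont_on_cst.
  - exact: IH (ltnW kN).
by have := key N (leqnn N); rewrite divff // gt_eqF.
Qed.

End continuation.

(** * Solutions of the forward-backward equation *)

Section main.
Context {R : realType} {X : completeNormedModType R}.

Lemma dot_inner_product (dot : {dot X for idfun}) :
  (forall x : X, `|x| = Num.sqrt (dot x x)) -> inner_product (dot : X -> X -> R).
Proof.
move=> norm_dot; split=> [u v w|a u v|u v|u].
- exact: linearDl.
- exact: linearZl_LR.
- by rewrite hermC expr0 mul1r.
- rewrite norm_dot sqr_sqrtr //; have [->|u0] := eqVneq u 0; first by rewrite linear0l.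
  by rewrite ltW // neq0_dnorm_gt0.
Qed.

Section fixed_inner_product.
Variable d : X -> X -> R.
Hypothesis dP : inner_product d.
Variables (T : R) (A : set (X * X)).
Let As := adjoint_graph d A.
Let S := sg A.
Let S' := sg As.
Hypothesis Tpos : 0 < T.
Hypothesis A_generator : exists S : R -> X -> X, generates A S.
Hypothesis A_cases : As = A \/ As = opp_graph A.
Implicit Types (b g : R -> X -> X -> X) (h : X -> X).

Let T0 : 0 <= T := ltW Tpos.
Let TT : 0 <= T <= T. Proof. by rewrite T0 lexx. Qed.
Let OT : 0 <= (0 : R) <= T. Proof. by rewrite lexx T0. Qed.

Lemma mild_solution_mild b g h x y psi : mild_solution T d A b g h x y psi ->
  [/\ cont_on 0 T y /\ cont_on 0 T psi,
      mild (d := d) T true S y (fun s => b s (y s) (psi s)),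
      mild (d := d) T false S' psi (fun s => g s (y s) (psi s)),
      y 0 = x & psi T = h (y T)].
Proof.
move=> [/within_contP cy /within_contP cp iy ip].
have [gA gB dual inv] := dual_semigroups dP A_generator A_cases.
have [Ca Ca1 SPa] := C0_semigroup_on T gA.1; have [Cb Cb1 SPb] := C0_semigroup_on T gB.1.
have at_point o (f : R -> X) v : has_bochner_integral `[o, o]%classic f v -> v = 0.
  move=> /(bochner_weak dP) h1; apply: (ip_ext dP) => w; have hw := h1 w (lexx o).
  have := integral_is_cat (lexx o) (lexx o) hw hw; rewrite (ip0l dP).
  by move=> /(integral_is_uniq (measurable_I _ _) hw); lra.
split => //.
- apply: (mild_of_anchor (a := 0) (x := x) SPa dual) => // [t /andP[]//|t w tT].
  have [t0 _] := andP tT; rewrite hull_up // subr0 (ger0_norm t0) -(ipBl dP).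
  have := bochner_weak dP w t0 (iy t tT); apply: integral_is_eq; first exact: measurable_I.
  by move=> s; rewrite /= in_itv /= => /andP[_ st]; rewrite ger0_norm // subr_ge0.
- apply: (mild_of_anchor (a := T) (x := h (y T)) SPb (dual_sym dP dual)) => // [t /andP[]//|t w tT].
  have [_ tT'] := andP tT; rewrite hull_down // distrC ger0_norm ?subr_ge0 // -(ipBl dP).
  have := bochner_weak dP w tT' (ip t tT); apply: integral_is_eq; first exact: measurable_I.
  by move=> s; rewrite /= in_itv /= => /andP[ts _]; rewrite distrC ger0_norm // subr_ge0.
- have := at_point _ _ _ (iy 0 OT); have [_ _ S0 _ _] := SPa.
  by rewrite S0 => /eqP; rewrite subr_eq0 => /eqP.
- have := at_point _ _ _ (ip T TT); have [_ _ S0 _ _] := SPb.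
  by rewrite subrr S0 => /eqP; rewrite subr_eq0 => /eqP.
Qed.

Lemma mild_mild_solution b g h x y psi :
  jointly_continuous T b -> jointly_continuous T g ->
  cont_on 0 T y -> cont_on 0 T psi ->
  mild (d := d) T true S y (fun s => b s (y s) (psi s)) ->
  mild (d := d) T false S' psi (fun s => g s (y s) (psi s)) ->
  y 0 = x -> psi T = h (y T) -> mild_solution T d A b g h x y psi.
Proof.
move=> cb cg cy cp my mp y0 pT.
have [gA gB dual inv] := dual_semigroups dP A_generator A_cases.
have [Ca Ca1 SPa] := C0_semigroup_on T gA.1; have [Cb Cb1 SPb] := C0_semigroup_on T gB.1.
split; [exact/within_contP | exact/within_contP | |] => t tT; have [t0 tT'] := andP tT.
  have cF := convolution_cont Ca1 SPa tT (lexx 0) tT' (cont_on_path cb cy cp).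
  have [v hv] : exists v, has_bochner_integral `[0, t]%classic
      (fun s => S (t - s) (b s (y s) (psi s))) v.
    apply: (cont_bochner dP t0); apply: cont_on_eq cF => s /andP[_ st].
    by rewrite ger0_norm // subr_ge0.
  suff <- : v = y t - S t x by [].
  apply: (ip_ext dP) => w; have h1 := bochner_weak dP w t0 hv.
  have := my 0 t w OT tT t0; rewrite hull_up // subr0 (ger0_norm t0) y0 -(ipBl dP) => h2.
  apply: integral_is_uniq h1 _; first exact: measurable_I.
  apply: integral_is_eq h2; first exact: measurable_I.
  by move=> s; rewrite /= in_itv /= => /andP[_ st]; rewrite ger0_norm // subr_ge0.
have cF := convolution_cont Cb1 SPb tT t0 (lexx T) (cont_on_path cg cy cp).
have [v hv] : exists v, has_bochner_integral `[t, T]%classic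
    (fun s => S' (s - t) (g s (y s) (psi s))) v.
  apply: (cont_bochner dP tT'); apply: cont_on_eq cF => s /andP[ts _].
  by rewrite distrC ger0_norm // subr_ge0.
suff <- : v = psi t - S' (T - t) (h (y T)) by [].
apply: (ip_ext dP) => w; have h1 := bochner_weak dP w tT' hv.
have := mp T t w TT tT tT'; rewrite hull_down // distrC ger0_norm ?subr_ge0 // pT -(ipBl dP) => h2.
apply: integral_is_uniq h1 _; first exact: measurable_I.
apply: integral_is_eq h2; first exact: measurable_I.
by move=> s; rewrite /= in_itv /= => /andP[ts _]; rewrite distrC ger0_norm // subr_ge0.
Qed.

Lemma lyapunov_stable b g h Pi : G2 T b g h -> G3 T b g h ->
  type_I T d A b g h Pi \/ type_II T d A b g h Pi ->
  exists2 c : R, 0 < c & stable (d := d) T A b g h c.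
Proof.
move=> G2P G3P hPi; have [_ [L [L0 _ lb lg lh]]] := G2P.
case: hPi => -[saP [M [Mb [ Theta [Q0 [Qb [dataP [mu [K [mu0 K0 [ini ter run]]]]]]]]]]].
all: have [CPi hCPi] := Pi_bounded saP.
all: have hPi t z : 0 <= t <= T -> `|Pi t z| <= `|CPi| * `|z| by
  move=> tT; apply: le_trans (hCPi t z tT) _; rewrite ler_wpM2r // ler_norm.
all: have [mM mMb _ _] := dataP.
  have run' := running_I dP G2P G3P saP mM mMb run.
  have ter' := terminal_I dP G2P G3P T0 ter.
  by apply: (stability_estimate dP T0 A_generator A_cases G2P G3P saP dataP (ltW mu0) (lexx 0)
    K0 run' ter' ini (ltW L0) (normr_ge0 CPi) hPi lb lg lh Tpos); left.
have run' := running_II dP G2P G3P saP mM mMb run.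
have ter' := terminal_II dP G2P G3P T0 ter.
by apply: (stability_estimate dP T0 A_generator A_cases G2P G3P saP dataP (lexx 0) (ltW mu0)
  K0 run' ter' ini (ltW L0) (normr_ge0 CPi) hPi lb lg lh Tpos); right.
Qed.

Lemma sup_norm_le (u : R -> X) B : (forall t, 0 <= t <= T -> `|u t| <= B) -> sup_norm T u <= B.
Proof.
move=> uB; apply: ge_sup; first by exists `|u 0|, 0 => //; rewrite /= in_itv /= lexx T0.
by move=> _ [t tT <-]; apply: uB; move: tT; rewrite /= in_itv.
Qed.

(** Comparing with the zero path, a solution under this forcing, yields the a priori bound. *)
Lemma solves_zero b g h : jointly_continuous T b -> jointly_continuous T g ->
  solves (d := d) T A b g h 1 (fun s => - b s 0 0) (fun s => - g s 0 0) (- h 0) 0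
    (fun=> 0) (fun=> 0).
Proof.
move=> cb cg; have [gA gB dual inv] := dual_semigroups dP A_generator A_cases.
have zero fw (V : R -> X -> X) C : semigroup_on T C V -> mild (d := d) T fw V (fun=> 0) (fun=> 0).
  move=> [lV _ _ _ _] p q w pT qT pq.
  have pq' : Num.min p q <= Num.max p q by rewrite le_max !ge_min lexx.
  have := integral_is_cst 0 pq'; rewrite mul0r.
  rewrite (lin0 (lV _ (normr_ge0 _))) (ip0l dP) subrr.
  apply: integral_is_eq; first exact: measurable_I.
  by move=> s _; rewrite (lin0 (lV _ (normr_ge0 _))) (ip0l dP).
have [Ca _ SPa] := C0_semigroup_on T gA.1; have [Cb _ SPb] := C0_semigroup_on T gB.1.
split => //.
- by split; exact: cont_on_cst.
- by apply: mild_eq (zero true _ _ SPa) => s sT; rewrite scale1r subrr.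
- by apply: mild_eq (zero false _ _ SPb) => s sT; rewrite scale1r subrr.
- by rewrite scale1r subrr.
Qed.

Lemma comparison b g h c x y psi f1 f2 (h0 x' : X) y' psi' : 0 < c ->
  stable (d := d) T A b g h c -> jointly_continuous T b -> jointly_continuous T g ->
  mild_solution T d A b g h x y psi ->
  cont_on 0 T f1 -> cont_on 0 T f2 -> solves (d := d) T A b g h 1 f1 f2 h0 x' y' psi' ->
  forall t, 0 <= t <= T -> `|(y' t - y t, psi' t - psi t)| <=
    c * (`|x' - x| + `|h0| + \int[lebesgue_measure]_(s in `[0, T]%classic) (`|f1 s| + `|f2 s|)).
Proof.
move=> c0 st cb cg ms cf1 cf2 sol t tT.
have [[cy cp] my mp y0 pT] := mild_solution_mild ms.
have sol0 : solves (d := d) T A b g h 1 (fun=> 0) (fun=> 0) 0 x y psi.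
  split=> //; last by rewrite scale1r addr0.
  - by apply: mild_eq my => s _; rewrite scale1r addr0.
  - by apply: mild_eq mp => s _; rewrite scale1r addr0.
have cN := cont_onD (cont_on_norm cf1) (cont_on_norm cf2).
have iN := integral_is_cont ((within_contP _ _ _).2 cN).
set N := \int[_]_(_ in _) _ in iN *.
have N0 : 0 <= N.
  have := integral_is_le (measurable_I 0 T) _ (integral_is_cst 0 T0) iN.
  by rewrite mul0r; apply => s _; exact: addr_ge0.
have iN' : integral_is `[0, T]%classic (fun s => `|f1 s - 0| + `|f2 s - 0|) N.
  by apply: integral_is_eq iN => [|s _]; [exact: measurable_I | rewrite !subr0].
have r01 : 0 <= (1 : R) <= 1 by rewrite ler01 lexx.
have a0 := normr_ge0 (x' - x); have a1 := normr_ge0 h0.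
have cst0 := @cont_on_cst R X 0 T 0.
have key := st _ _ _ _ _ _ _ _ _ _ _ _ _ r01 cst0 cst0 cf1 cf2 sol0 sol
  N (`|x' - x| + `|h0| + N) iN'.
apply: key => //.
- by rewrite -addrA lerDl addr_ge0.
- by rewrite subr0 -addrA addrCA lerDl addr_ge0.
- by rewrite lerDr addr_ge0.
Qed.

End fixed_inner_product.
End main.

Theorem theorem6p1 (R : realType) (X : completeNormedModType R)
  (dot : {dot X for idfun})
  (hilbert_norm : forall x : X, `|x| = Num.sqrt (dot x x))
  (X_separable : separable X)
  (T : R) (T_gt0 : 0 < T)
  (A : set (X * X))
  (A_generator : exists S : R -> X -> X, generates A S)
  (A_cases :
    (adjoint_graph dot A = A /\
       exists2 sigma0 : R, 0 < sigma0 & sup (spectrum A) = - sigma0) \/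
    adjoint_graph dot A = opp_graph A)
  (b g : R -> X -> X -> X) (h : X -> X)
  (bgh_G2 : G2 T b g h) (bgh_G3 : G3 T b g h)
  (Pi : R -> X * X -> X * X)
  (Pi_lyapunov : type_I T dot A b g h Pi \/ type_II T dot A b g h Pi) :
  (forall x : X, exists y psi : R -> X,
     mild_solution T dot A b g h x y psi /\
     forall y' psi' : R -> X, mild_solution T dot A b g h x y' psi' ->
       forall t, 0 <= t <= T -> y' t = y t /\ psi' t = psi t) /\
  exists K : R, 0 < K /\
    forall (x : X) (y psi : R -> X), mild_solution T dot A b g h x y psi ->
      sup_norm T y + sup_norm T psi <=
        K * (`|x| + `|h 0| +
             \int[lebesgue_measure]_(s in `[0, T]%classic)
               (`|b s 0 0| + `|g s 0 0|)) /\
      forall (b' g' : R -> X -> X -> X) (h' : X -> X) (x' : X)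
        (y' psi' : R -> X),
        G2 T b' g' h' -> G3 T b' g' h' ->
        mild_solution T dot A b' g' h' x' y' psi' ->
        sup_norm T (y' \- y) + sup_norm T (psi' \- psi) <=
          K * (`|x' - x| + `|h' (y' T) - h (y' T)| +
               \int[lebesgue_measure]_(s in `[0, T]%classic)
                 (`|b' s (y' s) (psi' s) - b s (y' s) (psi' s)| +
                  `|g' s (y' s) (psi' s) - g s (y' s) (psi' s)|)).
Proof.
have dP := dot_inner_product hilbert_norm.
have cases : adjoint_graph dot A = A \/ adjoint_graph dot A = opp_graph A.
  by case: A_cases => [[E _]|]; [left | right].
have T0 : 0 <= T := ltW T_gt0.
have [[cb cg _] [L [L0 _ lb lg lh]]] := bgh_G2.
have [c c0 st] := lyapunov_stable dP T_gt0 A_generator cases bgh_G2 bgh_G3 Pi_lyapunov.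
have path_le (y psi : R -> X) (x : X) k1 k2 k3 :
    mild_solution T dot A b g h x y psi ->
    cont_on 0 T k1 -> cont_on 0 T k2 -> forall x' y' psi',
    solves (d := dot) T A b g h 1 k1 k2 k3 x' y' psi' ->
    forall t, 0 <= t <= T -> `|y' t - y t| <= c * (`|x' - x| + `|k3| +
      \int[lebesgue_measure]_(s in `[0, T]%classic) (`|k1 s| + `|k2 s|)) /\
      `|psi' t - psi t| <= c * (`|x' - x| + `|k3| +
      \int[lebesgue_measure]_(s in `[0, T]%classic) (`|k1 s| + `|k2 s|)).
  move=> ms ck1 ck2 x' y' psi' sol t tT.
  have := comparison dP T_gt0 A_generator cases c0 st cb cg ms ck1 ck2 sol tT.
  by rewrite pair_normE ge_max => /andP.
split.
  move=> x.
  have c00 := @cont_on_cst R X 0 T 0.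
  have [y [psi sol]] := solvable1 dP T0 A_generator cases cb cg (ltW L0) c0 lb lg lh st 0 x c00 c00.
  have ms : mild_solution T dot A b g h x y psi.
    have [[cy cp] my mp y0 pT] := sol.
    apply: (mild_mild_solution dP T_gt0 A_generator cases cb cg cy cp) => //.
    - by apply: mild_eq my => s _; rewrite scale1r addr0.
    - by apply: mild_eq mp => s _; rewrite scale1r addr0.
    - by rewrite pT scale1r addr0.
  exists y, psi; split => // y' psi' ms' t tT.
  have [h1 h2] := path_le _ _ _ _ _ _ ms' c00 c00 _ _ _ sol t tT.
  have Z : \int[lebesgue_measure]_(s in `[0, T]%classic) (`|0 : X| + `|0 : X|) = 0 :> R.
    by rewrite normr0 addr0 Rintegral_cst ?mul0r //; exact: measurable_I.
  move: h1 h2; rewrite Z subrr !normr0 !addr0 mulr0 !normr_le0 !subr_eq0.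
  by move=> /eqP-> /eqP->.
exists (2 * c); split; first by rewrite mulr_gt0.
move=> x y psi ms; have [[cy cp] my mp y0 pT] := mild_solution_mild dP T_gt0 A_generator cases ms.
have both (u v : R -> X) B : (forall t, 0 <= t <= T -> `|u t| <= c * B /\ `|v t| <= c * B) ->
    sup_norm T u + sup_norm T v <= 2 * c * B.
  move=> uv; have := @sup_norm_le R X T T_gt0 u (c * B) (fun t tT => (uv t tT).1).
  have := @sup_norm_le R X T T_gt0 v (c * B) (fun t tT => (uv t tT).2); lra.
split.
  have czero := @cont_on_cst R X 0 T 0.
  have cn (k : R -> X -> X -> X) : jointly_continuous T k -> cont_on 0 T (fun s => - k s 0 0).
    by move=> ck; apply: (cont_onP (k := -%R)) (cont_on_path ck czero czero); exact: opp_continuous.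
  apply: both => t tT.
  have := path_le _ _ _ _ _ _ ms (cn _ cb) (cn _ cg) _ _ _
    (solves_zero dP A_generator cases h cb cg) t tT.
  rewrite !sub0r !normrN.
  by under eq_Rintegral do rewrite !normrN.
move=> b' g' h' x' y' psi' [[cb' cg' _] _] _ ms'.
have [[cy' cp'] my' mp' y0' pT'] := mild_solution_mild dP T_gt0 A_generator cases ms'.
apply: both => t tT.
have cpath := fun k ck => @cont_on_path R X T k y' psi' ck cy' cp'.
apply: (path_le _ _ _ _ _ _ ms (cont_onB (cpath _ cb') (cpath _ cb))
   (cont_onB (cpath _ cg') (cpath _ cg)) _ _ _ _ t tT).
split=> //.
- by apply: mild_eq my' => s _; rewrite scale1r addrC subrK.
- by apply: mild_eq mp' => s _; rewrite scale1r addrC subrK.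
- by rewrite pT' scale1r addrC subrK.
Qed.
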